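(* Let $n\ge1$ and $r\ge 0$. The image of $U_{\mathcal Z}(\mathfrak{sl}_n)$ under the homomorphism $\zeta_r:\mathbf U(n)\to\mathbf U(n,r)$ is equal to the integral $q$-Schur algebra $U_{\mathcal Z}(n,r)$. Hence, for any field $k$ which is a $\mathcal Z$-algebra, base change induces an epimorphism $\zeta_r=\zeta_r\otimes1:U_k(\mathfrak{sl}_n)\to U_k(n,r)$.
   Context: $\mathbb N=\{0,1,2,\dots\}$, $\upsilon$ is an indeterminate, $\mathcal Z=\mathbb Z[\upsilon,\upsilon^{-1}]$. $[m]=\frac{\upsilon^m-\upsilon^{-m}}{\upsilon-\upsilon^{-1}}$, $[m]!=[1]\cdots[m]$. Quantum $\mathfrak{gl}_n$: $\mathbf U(n)$ is the $\mathbb Q(\upsilon)$-algebra with generators $E_i,F_i$ ($1\le i\le n-1$), $K_j^{\pm1}$ ($1\le j\le n$) and relations $K_iK_j=K_jK_i$, $K_iK_i^{-1}=1$; $K_iE_j=\upsilon^{\delta_{i,j}-\delta_{i,j+1}}E_jK_i$; $K_iF_j=\upsilon^{-\delta_{i,j}+\delta_{i,j+1}}F_jK_i$; $E_iF_j-F_jE_i=\delta_{ij}\frac{\tilde K_i-\tilde K_i^{-1}}{\upsilon-\upsilon^{-1}}$ with $\tilde K_i=K_iK_{i+1}^{-1}$; $E_iE_j=E_jE_i$, $F_iF_j=F_jF_i$ if $|i-j|>1$; $E_i^2E_j-(\upsilon+\upsilon^{-1})E_iE_jE_i+E_jE_i^2=0$ and likewise for the $F$'s if $|i-j|=1$. The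 quantum enveloping algebra $\mathbf U(\mathfrak{sl}_n)$ is identified with the subalgebra of $\mathbf U(n)$ generated by $E_i,F_i,\tilde K_i^{\pm1}$ ($1\le i\le n-1$), and $U_{\mathcal Z}(\mathfrak{sl}_n)$ is the $\mathcal Z$-subalgebra generated by all $E_i^{(m)}=E_i^m/[m]!$, $F_i^{(m)}=F_i^m/[m]!$, $\tilde K_i^{\pm1}$ ($1\le i\le n-1$, $m\ge0$). For a field $k$ that is a $\mathcal Z$-algebra, $U_k(\mathfrak{sl}_n)=U_{\mathcal Z}(\mathfrak{sl}_n)\otimes_{\mathcal Z}k$. $q$-Schur algebras: for a commutative ring $R$ and $q^{1/2}\in R$, $A_q(n)$ is the $R$-algebra generated by $c_{ij}$ ($1\le i,j\le n$) with relations $c_{ij}c_{im}=c_{im}c_{ij}$ for all $i,j,m$; $c_{ij}c_{rs}=qc_{rs}c_{ij}$ for $i>r$, $j\le s$; $c_{ij}c_{rs}=(q-1)c_{rj}c_{is}+c_{rs}c_{ij}$ for $i>r$, $j>s$. It is a bialgebra with $\Delta(c_{ij})=\sum_tc_{it}\otimes c_{tj}$, counit $c_{ij}\mapsto\delta_{ij}$. Its degree $r$ part $A_q(n,r)$ is a subcoalgebra, and $U_R(n,r)=A_q(n,r)^*$ is the $q$-Schur algebra. Let $\Xi(n,r)$ be the set of $n\times n$ matrices over $\mathbb N$ with entry sum $r$; $\{\xi_A\}_{A\in\Xi(n,r)}$ is the basis dual to the monomials $c^A=c_{11}^{a_{11}}c_{21}^{a_{21}}\cdots c_{n1}^{a_{n1}}c_{12}^{a_{12}}\cdots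 c_{nn}^{a_{nn}}$, and $[A]=q^{-d_A/2}\xi_A$ with $d_A=-\sum_{i<s,j>t}a_{ij}a_{st}+\sum_{j>t}a_{ij}a_{it}$. Write $\mathbf U(n,r)=U_{\mathbb Q(\upsilon)}(n,r)$ and $U_{\mathcal Z}(n,r)$ for $q^{1/2}=\upsilon$, and $U_k(n,r)\cong U_{\mathcal Z}(n,r)\otimes_{\mathcal Z}k$. For a matrix $A$ over $\mathbb N$ with zero diagonal and $\mathbf j\in\mathbb Z^n$ put $A(\mathbf j,r)=\sum_D\upsilon^{\sum_id_ij_i}[A+D]$, over diagonal $D=\mathrm{diag}(d_1,\dots,d_n)$ over $\mathbb N$ with $A+D\in\Xi(n,r)$. $\zeta_r:\mathbf U(n)\to\mathbf U(n,r)$ is the algebra epimorphism with $E_h\mapsto E_{h,h+1}(\mathbf 0,r)$, $F_h\mapsto E_{h+1,h}(\mathbf 0,r)$ ($E_{i,j}$ matrix units), $K_1^{j_1}\cdots K_n^{j_n}\mapsto 0(\mathbf j,r)$. *)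

(* Defs.v *)
From HB Require Import structures.
From mathcomp Require Import all_boot all_order all_algebra ring_quotient.
From mathcomp.finmap Require Import finmap.
From mathcomp.multinomials Require Import monalg.
From mathcomp Require Import ring.
From mathcomp Require Import boolp classical_sets functions.

Set Implicit Arguments.
Unset Strict Implicit.
Unset Printing Implicit Defensive.

Import GRing.Theory.
Local Open Scope quotient_scope.
Local Open Scope ring_scope.

(* The free associative algebra R<X> is the monoid algebra of the free monoid
   on X.  The operations inherited from malg are sealed: otherwise failed
   unifications unfold finite supports and do not terminate in practice. *)
HB.lock Definition fr_zero (R : comNzRingType) (X : choiceType) :
  {malg R[{fmonom X}]} := 0.
HB.lock Definition fr_opp (R : comNzRingType) (X : choiceType)
  (x : {malg R[{fmonom X}]}) : {malg R[{fmonom X}]} := - x.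
HB.lock Definition fr_add (R : comNzRingType) (X : choiceType)
  (x y : {malg R[{fmonom X}]}) : {malg R[{fmonom X}]} := x + y.
HB.lock Definition fr_one (R : comNzRingType) (X : choiceType) :
  {malg R[{fmonom X}]} := 1.
HB.lock Definition fr_mul (R : comNzRingType) (X : choiceType)
  (x y : {malg R[{fmonom X}]}) : {malg R[{fmonom X}]} := x * y.
HB.lock Definition fr_scale (R : comNzRingType) (X : choiceType)
  (a : R) (x : {malg R[{fmonom X}]}) : {malg R[{fmonom X}]} := a *: x.

Section FreeAlgebra.
Variables (R : comNzRingType) (X : choiceType).

Definition freeAlg : Type := {malg R[{fmonom X}]}.
HB.instance Definition _ := Choice.on freeAlg.

Let F := {malg R[{fmonom X}]}.

Fact fr_addA : associative (@fr_add R X).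
Proof. by move=> x y z; rewrite !fr_add.unlock addrA. Qed.
Fact fr_addC : commutative (@fr_add R X).
Proof. by move=> x y; rewrite !fr_add.unlock addrC. Qed.
Fact fr_add0 : left_id (fr_zero R X) (@fr_add R X).
Proof. by move=> x; rewrite fr_add.unlock fr_zero.unlock add0r. Qed.
Fact fr_addN : left_inverse (fr_zero R X) (@fr_opp R X) (@fr_add R X).
Proof. by move=> x; rewrite fr_add.unlock fr_zero.unlock fr_opp.unlock addNr. Qed.
HB.instance Definition _ :=
  GRing.isZmodule.Build freeAlg fr_addA fr_addC fr_add0 fr_addN.

Fact fr_mulA : associative (@fr_mul R X).
Proof. by move=> x y z; rewrite !fr_mul.unlock mulrA. Qed.
Fact fr_mul1 : left_id (fr_one R X) (@fr_mul R X).
Proof. by move=> x; rewrite fr_mul.unlock fr_one.unlock mul1r. Qed.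
Fact fr_mulr1 : right_id (fr_one R X) (@fr_mul R X).
Proof. by move=> x; rewrite fr_mul.unlock fr_one.unlock mulr1. Qed.
Fact fr_mulDl : left_distributive (@fr_mul R X) (@fr_add R X).
Proof. by move=> x y z; rewrite !fr_mul.unlock fr_add.unlock mulrDl. Qed.
Fact fr_mulDr : right_distributive (@fr_mul R X) (@fr_add R X).
Proof. by move=> x y z; rewrite !fr_mul.unlock fr_add.unlock mulrDr. Qed.
Fact fr_one_neq0 : fr_one R X != fr_zero R X.
Proof. by rewrite fr_one.unlock fr_zero.unlock oner_neq0. Qed.
HB.instance Definition _ := GRing.Zmodule_isNzRing.Build freeAlg
  fr_mulA fr_mul1 fr_mulr1 fr_mulDl fr_mulDr fr_one_neq0.

Fact fr_scaleA a b (x : F) : fr_scale a (fr_scale b x) = fr_scale (a * b) x.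
Proof. by rewrite !fr_scale.unlock scalerA. Qed.
Fact fr_scale1 : left_id (1 : R) (@fr_scale R X).
Proof. by move=> x; rewrite fr_scale.unlock scale1r. Qed.
Fact fr_scaleDr : right_distributive (@fr_scale R X) (@fr_add R X).
Proof. by move=> x y z; rewrite !fr_scale.unlock fr_add.unlock scalerDr. Qed.
Fact fr_scaleDl (x : F) :
  {morph (@fr_scale R X)^~ x : a b / a + b >-> fr_add a b}.
Proof. by move=> a b; rewrite !fr_scale.unlock fr_add.unlock scalerDl. Qed.
HB.instance Definition _ := GRing.Zmodule_isLmodule.Build R freeAlg
  fr_scaleA fr_scale1 fr_scaleDr fr_scaleDl.

Fact fr_scaleAl (a : R) (x y : F) :
  fr_scale a (fr_mul x y) = fr_mul (fr_scale a x) y.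
Proof. by rewrite fr_mul.unlock fr_scale.unlock scalerAl. Qed.
HB.instance Definition _ := GRing.Lmodule_isLalgebra.Build R freeAlg fr_scaleAl.

Fact fr_scaleAr (a : R) (x y : F) :
  fr_scale a (fr_mul x y) = fr_mul x (fr_scale a y).
Proof.
rewrite fr_mul.unlock fr_scale.unlock; apply/malgP=> k.
rewrite [LHS](mcoeffZ a (x * y) k) [X in a * X](mcoeffMl x y k).
rewrite [RHS](mcoeffMlw k (fsubset_refl (msupp x)) (msuppZ_le a y)) mulr_sumr.
apply: eq_bigr=> i _; rewrite mulr_sumr; apply: eq_bigr=> j _.
by rewrite (mcoeffZ a y j) mulrnAr mulrCA.
Qed.
HB.instance Definition _ := GRing.Lalgebra_isAlgebra.Build R freeAlg fr_scaleAr.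


Definition fgen (x : X) : freeAlg := << fmu x >>.

Definition fword (s : seq X) : freeAlg := << FMonom s >>.

Lemma fword_nil : fword [::] = 1.
Proof.
rewrite [RHS](_ : _ = fr_one R X) // fr_one.unlock /fword -fmoneE.
by [].
Qed.

Lemma fword_cat s t : fword (s ++ t) = fword s * fword t.
Proof.
rewrite [RHS](_ : _ = fr_mul (fword s) (fword t)) // fr_mul.unlock.
by rewrite /fword malgM_def fgmulUU mulr1 /mul /= fmmulE.
Qed.

Lemma fword1 x : fword [:: x] = fgen x.
Proof. by rewrite /fword /fgen fmuE. Qed.

Lemma fwordE s : fword s = \prod_(x <- s) fgen x.
Proof.
elim: s => [|x s ih]; first by rewrite big_nil fword_nil.
by rewrite big_cons -ih -fword1 -fword_cat.
Qed.

Lemma freeAlg_ind (P : freeAlg -> Prop) :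
  P 0 -> (forall a s x, P x -> P (a *: fword s + x)) -> forall x, P x.
Proof.
move=> P0 Pw x; rewrite [x]monalgE.
elim: (msupp x : seq _) => [|m l ih].
  by rewrite big_nil; move: P0; rewrite (_ : 0 = fr_zero R X) // fr_zero.unlock.
rewrite big_cons; have := Pw x@_m m _ ih.
rewrite (_ : _ + _ = fr_add (fr_scale x@_m (fword m)) (\sum_(k <- l) << x@_k *g k >>)) //.
rewrite fr_add.unlock fr_scale.unlock.
suff -> : x@_m *: (fword m : F) = << x@_m *g m >> by [].
rewrite /fword fmK; apply/malgP=> k.
by apply: (etrans (mcoeffZ _ _ _)); rewrite 2!mcoeffU mulrnAr mulr1.
Qed.

End FreeAlgebra.

(* The linear extension to R<X> of a function given on words. *)
HB.lock Definition flin (R : comNzRingType) (X : choiceType) (V : lmodType R)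
  (g : seq X -> V) (x : freeAlg R X) : V := \sum_(m <- msupp x) x@_m *: g m.

Section FreeLinear.
Variables (R : comNzRingType) (X : choiceType) (V : lmodType R) (g : seq X -> V).

Local Notation flin := (flin g).

Lemma flinEw (d : {fset {fmonom X}}) x : (msupp x `<=` d)%fset ->
  flin x = \sum_(m <- d) x@_m *: g m.
Proof.
move=> le; rewrite flin.unlock (big_fset_incl _ le) => //= m md /mcoeff_outdom ->.
by rewrite scale0r.
Qed.

Lemma flin_is_linear : linear flin.
Proof.
move=> a x y; have -> : a *: x + y = fr_add (fr_scale a x) y by [].
rewrite fr_add.unlock fr_scale.unlock; pose d := (msupp x `|` msupp y)%fset.
have lex : (msupp x `<=` d)%fset by apply: fsubsetUl.
have ley : (msupp y `<=` d)%fset by apply: fsubsetUr.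
have leD : (msupp ((a *: (x : {malg R[{fmonom X}]}) + y)) `<=` d)%fset.
  apply: fsubset_trans (msuppD_le _ _) _.
  by rewrite fsubUset ley andbT (fsubset_trans (msuppZ_le _ _) lex).
rewrite (flinEw lex) (flinEw ley) (flinEw leD) scaler_sumr -big_split /=.
apply: eq_bigr=> m _.
by rewrite (mcoeffD m (a *: (x : {malg R[{fmonom X}]})) y) (mcoeffZ a x m) scalerDl scalerA.
Qed.
HB.instance Definition _ := GRing.isLinear.Build R (freeAlg R X) V _ flin flin_is_linear.

Lemma flin_word s : flin (fword R s) = g s.
Proof.
rewrite (@flinEw [fset FMonom s]%fset) ?msuppU_le // big_seq_fset1.
by rewrite mcoeffUU scale1r.
Qed.
End FreeLinear.

(* The algebra morphism R<X> -> A with x |-> h x. *)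
Section FreeEval.
Variables (R : comNzRingType) (X : choiceType) (A : algType R) (h : X -> A).

Definition feval : freeAlg R X -> A := flin (fun s => \prod_(x <- s) h x).
HB.instance Definition _ := GRing.Linear.on feval.

Lemma feval_is_monoid_morphism : monoid_morphism feval.
Proof.
split=> [|x y]; first by rewrite /feval -fword_nil flin_word big_nil.
elim/freeAlg_ind: x => [|a s x ih]; first by rewrite mul0r linear0 mul0r.
rewrite mulrDl linearD /= ih -scalerAl linearZ_LR /= linearD linearZ_LR /=.
rewrite mulrDl -scalerAl; congr (_ *: _ + _) => {a x ih}.
elim/freeAlg_ind: y => [|a t y ih]; first by rewrite !linear0 mulr0 linear0 mulr0.
rewrite mulrDr linearD /= ih -scalerAr linearZ_LR /= linearD linearZ_LR /=.
rewrite mulrDr -scalerAr; congr (_ *: _ + _).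
by rewrite /feval -fword_cat !flin_word big_cat.
Qed.
HB.instance Definition _ :=
  GRing.isMonoidMorphism.Build _ _ feval feval_is_monoid_morphism.

Lemma feval_gen x : feval (fgen R x) = h x.
Proof. by rewrite -fword1 /feval flin_word big_seq1. Qed.

Lemma fevalE :
  (feval 0 = 0) * (feval 1 = 1) * (forall x y, feval (x + y) = feval x + feval y) *
  (forall x, feval (- x) = - feval x) *
  (forall x y, feval (x * y) = feval x * feval y) *
  (forall x i, feval (x ^+ i) = feval x ^+ i) *
  (forall a x, feval (a *: x) = a *: feval x) *
  (forall x, feval (fgen R x) = h x).
Proof.
do 7?split; [exact: rmorph0|exact: rmorph1|exact: rmorphD|exact: rmorphN|
  exact: rmorphM|by move=> x i; rewrite rmorphXn|exact: linearZ_LR|exact: feval_gen].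
Qed.
End FreeEval.

(* presAlg rel is the algebra with generators X and relations x = y for all
   x, y with rel x y: the quotient of R<X> by the two-sided ideal spanned by the
   a * (x - y) * b.  It may be trivial, so the generic instances stop at
   pzRingType and lmodType. *)
Section PresentedAlgebra.
Variables (R : comNzRingType) (X : choiceType).
Variable rel : freeAlg R X -> freeAlg R X -> Prop.

Inductive ideal_gen : freeAlg R X -> Prop :=
| ideal_gen0 : ideal_gen 0
| ideal_genD a x y b z :
    rel x y -> ideal_gen z -> ideal_gen (a * (x - y) * b + z).

Definition ideal : {pred freeAlg R X} := fun x => `[< ideal_gen x >].

Lemma idealP x : reflect (ideal_gen x) (x \in ideal).
Proof. exact: asboolP. Qed.

Lemma ideal_addr x y : ideal_gen x -> ideal_gen y -> ideal_gen (x + y).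
Proof.
by move=> ix iy; elim: ix => [|a s t b z st _ ih]; rewrite ?add0r // -addrA; constructor.
Qed.

Lemma ideal_mull a x : ideal_gen x -> ideal_gen (a * x).
Proof.
elim=> [|c s t b z st _ ih]; first by rewrite mulr0; constructor.
by rewrite mulrDr !mulrA; constructor.
Qed.

Lemma ideal_mulr a x : ideal_gen x -> ideal_gen (x * a).
Proof.
elim=> [|c s t b z st _ ih]; first by rewrite mul0r; constructor.
by rewrite mulrDl -!mulrA; rewrite mulrA; constructor.
Qed.

Lemma ideal_zmod_closed : zmod_closed ideal.
Proof.
split; first by apply/idealP; constructor.
move=> x y /idealP ix /idealP iy; apply/idealP/ideal_addr => //.
by rewrite -mulN1r; apply: ideal_mull.
Qed.
HB.instance Definition _ := GRing.isZmodClosed.Build _ ideal ideal_zmod_closed.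

Definition presAlg : Type := Quotient.quot ideal.
HB.instance Definition _ := GRing.Zmodule.on presAlg.
HB.instance Definition _ : EqQuotient _ (Quotient.equiv ideal) presAlg :=
  EqQuotient.on presAlg.

Definition pres (x : freeAlg R X) : presAlg := \pi_presAlg x.

Lemma presP x y : pres x = pres y <-> ideal_gen (x - y).
Proof.
rewrite /pres; split=> [/eqP|h].
  by rewrite -Quotient.idealrBE => /idealP.
by apply/eqP; rewrite -Quotient.idealrBE; apply/idealP.
Qed.

Lemma pres_is_zmod_morphism : zmod_morphism pres.
Proof. exact: (@pi_is_zmod_morphism _ _ _ (Quotient.quot ideal)). Qed.
HB.instance Definition _ := GRing.isZmodMorphism.Build _ _ pres pres_is_zmod_morphism.

Lemma pres_repr (x : presAlg) : pres (repr x) = x.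
Proof. exact: reprK. Qed.

Lemma pres_surj (x : presAlg) : exists y, x = pres y.
Proof. by exists (repr x); rewrite pres_repr. Qed.

Let one : presAlg := lift_cst presAlg (1 : freeAlg R X).
Let mul : presAlg -> presAlg -> presAlg :=
  lift_op2 presAlg (@GRing.mul (freeAlg R X)).
Let scale (a : R) : presAlg -> presAlg :=
  lift_op1 presAlg (@GRing.scale R (freeAlg R X) a).

Let presB_repr x : ideal_gen (repr (pres x) - x).
Proof. by apply/presP; rewrite pres_repr. Qed.

Let pres1 : pres 1 = one.
Proof. by rewrite /one; unlock. Qed.

Let presM x y : pres (x * y) = mul (pres x) (pres y).
Proof.
rewrite /mul; unlock; apply/esym/(iffRL (presP _ _)).
move: (presB_repr x) (presB_repr y); rewrite /pres.
set a := repr (\pi x); set b := repr (\pi y) => ia ib.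
have -> : a * b - x * y = (a - x) * b + x * (b - y).
  by rewrite mulrBl mulrBr addrA subrK.
by apply: ideal_addr; [exact: ideal_mulr|exact: ideal_mull].
Qed.

Let presZ_ a x : pres (a *: x) = scale a (pres x).
Proof.
rewrite /scale; unlock; apply/esym/(iffRL (presP _ _)).
have := presB_repr x; rewrite /pres; move: (repr _) => b ib.
by rewrite -scalerBr -[b - x]mul1r scalerAl; apply: ideal_mull.
Qed.

Let pres_mulA : associative mul.
Proof.
move=> x y z; have [[x' ->] [y' ->] [z' ->]] := And3 (pres_surj x) (pres_surj y) (pres_surj z).
by rewrite -!presM mulrA.
Qed.
Let pres_mul1 : left_id one mul.
Proof. by move=> x; have [x' ->] := pres_surj x; rewrite -pres1 -presM mul1r. Qed.
Let pres_mulr1 : right_id one mul.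
Proof. by move=> x; have [x' ->] := pres_surj x; rewrite -pres1 -presM mulr1. Qed.
Let pres_mulDl : left_distributive mul +%R.
Proof.
move=> x y z; have [[x' ->] [y' ->] [z' ->]] := And3 (pres_surj x) (pres_surj y) (pres_surj z).
by rewrite -raddfD -!presM mulrDl raddfD.
Qed.
Let pres_mulDr : right_distributive mul +%R.
Proof.
move=> x y z; have [[x' ->] [y' ->] [z' ->]] := And3 (pres_surj x) (pres_surj y) (pres_surj z).
by rewrite -raddfD -!presM mulrDr raddfD.
Qed.
HB.instance Definition _ := GRing.Zmodule_isPzRing.Build presAlg
  pres_mulA pres_mul1 pres_mulr1 pres_mulDl pres_mulDr.

Let pres_scaleA a b v : scale a (scale b v) = scale (a * b) v.
Proof. by have [v' ->] := pres_surj v; rewrite -!presZ_ scalerA. Qed.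
Let pres_scale1 : left_id 1 scale.
Proof. by move=> v; have [v' ->] := pres_surj v; rewrite -!presZ_ scale1r. Qed.
Let pres_scaleDr : right_distributive scale +%R.
Proof.
move=> a x y; have [[x' ->] [y' ->]] := conj (pres_surj x) (pres_surj y).
by rewrite -raddfD -!presZ_ scalerDr raddfD.
Qed.
Let pres_scaleDl v : {morph scale^~ v : a b / a + b}.
Proof. by move=> a b; have [v' ->] := pres_surj v; rewrite -!presZ_ scalerDl raddfD. Qed.
HB.instance Definition _ := GRing.Zmodule_isLmodule.Build R presAlg
  pres_scaleA pres_scale1 pres_scaleDr pres_scaleDl.

Lemma pres_is_monoid_morphism : monoid_morphism pres.
Proof. by split; [exact: pres1|exact: presM]. Qed.
HB.instance Definition _ :=
  GRing.isMonoidMorphism.Build _ _ pres pres_is_monoid_morphism.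

Lemma pres_is_scalable : scalable pres.
Proof. exact: presZ_. Qed.
HB.instance Definition _ := GRing.isScalable.Build R _ _ *:%R pres pres_is_scalable.

Lemma presZ a x : pres (a *: x) = a *: pres x.
Proof. exact: presZ_. Qed.

Lemma presAlg_scalerAl (a : R) (x y : presAlg) : a *: (x * y) = a *: x * y.
Proof.
have [[x' ->] [y' ->]] := conj (pres_surj x) (pres_surj y).
by rewrite -rmorphM /= -!presZ -rmorphM /= -scalerAl.
Qed.

Lemma presAlg_scalerAr (a : R) (x y : presAlg) : a *: (x * y) = x * (a *: y).
Proof.
have [[x' ->] [y' ->]] := conj (pres_surj x) (pres_surj y).
by rewrite -rmorphM /= -!presZ -rmorphM /= -scalerAr.
Qed.

Definition pgen (x : X) : presAlg := pres (fgen R x).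

Definition pword (s : seq X) : presAlg := \prod_(x <- s) pgen x.

Lemma pwordE s : pword s = pres (fword R s).
Proof. by rewrite fwordE rmorph_prod. Qed.

Lemma pres_rel x y : rel x y -> pres x = pres y.
Proof.
move=> xy; apply/presP; rewrite -[x - y]mul1r -[1 * _]mulr1 -[_ * 1]addr0.
by apply: ideal_genD => //; apply: ideal_gen0.
Qed.

(* A linear map out of presAlg, given by its values on words; well defined as
   soon as it is compatible with the relations in every context u _ v. *)
Section Functional.
Variables (V : lmodType R) (g : seq X -> V).
Hypothesis gP : forall u v x y, rel x y ->
  flin g (fword R u * x * fword R v) = flin g (fword R u * y * fword R v).

Definition plin (x : presAlg) : V := flin g (repr x).

Lemma flin_ideal x : ideal_gen x -> flin g x = 0.
Proof.
elim=> [|a s t b z st _ ih]; first exact: linear0.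
rewrite linearD /= ih addr0 => {z ih}.
elim/freeAlg_ind: a => [|c u a iha]; first by rewrite !mul0r linear0.
rewrite !mulrDl linearD /= iha addr0 -!scalerAl linearZ_LR /= => {a iha}.
suff -> : flin g (fword R u * (s - t) * b) = 0 by rewrite scaler0.
elim/freeAlg_ind: b => [|d v b ihb]; first by rewrite !mulr0 linear0.
rewrite mulrDr linearD /= ihb addr0 -scalerAr linearZ_LR /= => {b ihb}.
by rewrite mulrBr mulrBl linearB /= (gP _ _ st) subrr scaler0.
Qed.

Lemma plinE x : plin (pres x) = flin g x.
Proof. by apply/eqP; rewrite -subr_eq0 -linearB; apply/eqP/flin_ideal/presB_repr. Qed.

Lemma plin_is_linear : linear plin.
Proof.
move=> a x y; have [[x' ->] [y' ->]] := conj (pres_surj x) (pres_surj y).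
by rewrite -presZ -linearD !plinE linearP.
Qed.

Lemma plin_word s : plin (pword s) = g s.
Proof. by rewrite pwordE plinE flin_word. Qed.
End Functional.

Section Lift.
Variables (A : algType R) (h : X -> A).
Hypothesis hP : forall x y, rel x y -> feval h x = feval h y.

Definition plift : presAlg -> A := plin (fun s => \prod_(x <- s) h x).

Lemma pliftE x : plift (pres x) = feval h x.
Proof.
apply: plinE => u v s t st.
have := hP st; rewrite -!/(feval h _) => hst.
by rewrite !rmorphM /= hst.
Qed.

Lemma plift_gen x : plift (pgen x) = h x.
Proof. by rewrite pliftE feval_gen. Qed.

Lemma plift_is_linear : linear plift.
Proof.
move=> a x y; have [[x' ->] [y' ->]] := conj (pres_surj x) (pres_surj y).
by rewrite -presZ -linearD !pliftE linearP.
Qed.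

Lemma plift_is_monoid_morphism : monoid_morphism plift.
Proof.
split=> [|x y]; first by rewrite -(rmorph1 pres) pliftE rmorph1.
have [[x' ->] [y' ->]] := conj (pres_surj x) (pres_surj y).
by rewrite -rmorphM !pliftE rmorphM.
Qed.

Lemma plift_morph :
  (plift 0 = 0) * (plift 1 = 1) * (forall x y, plift (x + y) = plift x + plift y) *
  (forall x, plift (- x) = - plift x) *
  (forall x y, plift (x * y) = plift x * plift y) *
  (forall a x, plift (a *: x) = a *: plift x).
Proof.
have [p1 pM] := plift_is_monoid_morphism.
have p0 : plift 0 = 0 by rewrite -(raddf0 pres) pliftE raddf0.
have pZ a x : plift (a *: x) = a *: plift x.
  by rewrite -[a *: x]addr0 plift_is_linear p0 addr0.
have pD x y : plift (x + y) = plift x + plift y.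
  by have := plift_is_linear 1 x y; rewrite !scale1r.
by do 5?split=> //; move=> x; rewrite -scaleN1r pZ scaleN1r.
Qed.
End Lift.

End PresentedAlgebra.

(* The smallest subring containing S; with the scalars put in S this is the
   smallest subalgebra. *)
Inductive subring_gen (A : pzRingType) (S : A -> Prop) : A -> Prop :=
| subring_gen_base x : S x -> subring_gen S x
| subring_gen1 : subring_gen S 1
| subring_genB x y : subring_gen S x -> subring_gen S y -> subring_gen S (x - y)
| subring_genM x y : subring_gen S x -> subring_gen S y -> subring_gen S (x * y).

Definition subring_span (A : pzRingType) (S : A -> Prop) : {pred A} :=
  fun x => `[< subring_gen S x >].

Lemma subring_spanP (A : pzRingType) (S : A -> Prop) x :
  reflect (subring_gen S x) (x \in subring_span S).
Proof. exact: asboolP. Qed.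

Lemma subring_span_closed (A : pzRingType) (S : A -> Prop) :
  subring_closed (subring_span S).
Proof.
split=> [|x y /subring_spanP Sx /subring_spanP Sy|x y /subring_spanP Sx /subring_spanP Sy].
- by apply/subring_spanP; apply: subring_gen1.
- by apply/subring_spanP; apply: subring_genB.
- by apply/subring_spanP; apply: subring_genM.
Qed.
HB.instance Definition _ (A : pzRingType) (S : A -> Prop) :=
  GRing.isSubringClosed.Build A (subring_span S) (subring_span_closed S).

(* Q(v) and its subring Z[v, v^-1]. *)
Definition Qv : Type := {fraction {poly rat}}.
HB.instance Definition _ := GRing.Field.on Qv.

Definition vQ : Qv := FracField.tofrac ('X : {poly rat}).

Definition Zv_pred : {pred Qv} := subring_span (fun x => x = vQ \/ x = vQ^-1).
HB.instance Definition _ := GRing.SubringClosed.on Zv_pred.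

Record Zv := MkZv { Zv_val : Qv; Zv_valP : Zv_val \in Zv_pred }.
HB.instance Definition _ := [isSub for Zv_val].
HB.instance Definition _ := [Choice of Zv by <:].
HB.instance Definition _ := [SubChoice_isSubComNzRing of Zv by <:].

Lemma vQ_in : vQ \in Zv_pred.
Proof. by apply/subring_spanP; apply: subring_gen_base; left. Qed.
Definition vZ : Zv := MkZv vQ_in.

(* [m] and [m]! *)
Definition qint (m : nat) : Qv := (vQ ^+ m - vQ ^- m) / (vQ - vQ^-1).
Definition qfact (m : nat) : Qv := \prod_(1 <= i < m.+1) qint i.

(* U(gl_n) for n = m.+1, with 0-based indices: gE, gF range over 'I_m, so there
   are n - 1 of each, and lo i, hi i : 'I_n are the positions written i and i + 1
   in the literature.  gKV i is the inverse of gK i. *)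
Inductive Ugen (m : nat) :=
| gE of 'I_m | gF of 'I_m | gK of 'I_m.+1 | gKV of 'I_m.+1.

Definition Ugen_code m (x : Ugen m) : 'I_m + 'I_m + ('I_m.+1 + 'I_m.+1) :=
  match x with
  | gE i => inl (inl i) | gF i => inl (inr i)
  | gK i => inr (inl i) | gKV i => inr (inr i)
  end.
Definition Ugen_decode m (x : 'I_m + 'I_m + ('I_m.+1 + 'I_m.+1)) : Ugen m :=
  match x with
  | inl (inl i) => gE i | inl (inr i) => gF i
  | inr (inl i) => gK i | inr (inr i) => gKV i
  end.
Lemma Ugen_codeK m : cancel (@Ugen_code m) (@Ugen_decode m).
Proof. by case. Qed.
HB.instance Definition _ m := Choice.copy (Ugen m) (can_type (@Ugen_codeK m)).

Section QuantumGl.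
Variable m : nat.

Definition lo (i : 'I_m) : 'I_m.+1 := widen_ord (leqnSn m) i.
Definition hi (i : 'I_m) : 'I_m.+1 := lift ord0 i.

(* delta_{i,j} - delta_{i,j+1} *)
Definition wt (i : 'I_m.+1) (j : 'I_m) : int := (i == lo j)%:Z - (i == hi j)%:Z.

Definition adjacent (i j : 'I_m) : bool := (i.+1 == j :> nat) || (j.+1 == i :> nat).
Definition distant (i j : 'I_m) : bool := (i.+1 < j)%N || (j.+1 < i)%N.

Local Notation e i := (fgen Qv (gE i)).
Local Notation f i := (fgen Qv (gF i)).
Local Notation k i := (fgen Qv (gK i)).
Local Notation k' i := (fgen Qv (gKV i)).

Inductive Urel : freeAlg Qv (Ugen m) -> freeAlg Qv (Ugen m) -> Prop :=
| Urel_KK i j : Urel (k i * k j) (k j * k i)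
| Urel_KV i : Urel (k i * k' i) 1
| Urel_VK i : Urel (k' i * k i) 1
| Urel_KE i j : Urel (k i * e j) (vQ ^ wt i j *: (e j * k i))
| Urel_KF i j : Urel (k i * f j) (vQ ^ (- wt i j) *: (f j * k i))
| Urel_EF i j : Urel (e i * f j - f j * e i)
    ((i == j)%:R *: ((vQ - vQ^-1)^-1 *: (k (lo i) * k' (hi i) - k (hi i) * k' (lo i))))
| Urel_EE i j : distant i j -> Urel (e i * e j) (e j * e i)
| Urel_FF i j : distant i j -> Urel (f i * f j) (f j * f i)
| Urel_serreE i j : adjacent i j ->
    Urel (e i ^+ 2 * e j - (vQ + vQ^-1) *: (e i * e j * e i) + e j * e i ^+ 2) 0
| Urel_serreF i j : adjacent i j ->
    Urel (f i ^+ 2 * f j - (vQ + vQ^-1) *: (f i * f j * f i) + f j * f i ^+ 2) 0.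

Definition Ugl : Type := presAlg Urel.
HB.instance Definition _ := GRing.PzRing.on Ugl.
HB.instance Definition _ := GRing.Lmodule.on Ugl.

(* The counit is only used to show that U(gl_n) and its base changes are nonzero. *)
Definition Ucounit_gen (x : Ugen m) : Qv^o :=
  match x with gE _ | gF _ => 0 | gK _ | gKV _ => 1 end.

Definition Ucounit (x : Ugl) : Qv := plift (rel := Urel) Ucounit_gen x.

Lemma Ucounit_rel x y : Urel x y -> feval Ucounit_gen x = feval Ucounit_gen y.
Proof.
have s0 (a : Qv) : a *: (0 : Qv^o) = 0 by rewrite scaler0.
have s1 (a : Qv) : a *: (1 - 1 : Qv^o) = 0 by rewrite subrr scaler0.
by case=> *; rewrite !fevalE /= ?(expr2, mulr0, mul0r, mulr1, s0, s1, oppr0, addr0, subrr, scaler0).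
Qed.

Lemma UcounitE :
  (Ucounit 0 = 0) * (Ucounit 1 = 1) *
  (forall x y : Ugl, Ucounit (x + y) = Ucounit x + Ucounit y) *
  (forall x : Ugl, Ucounit (- x) = - Ucounit x) *
  (forall x y : Ugl, Ucounit (x * y) = Ucounit x * Ucounit y) *
  (forall a (x : Ugl), Ucounit (a *: x) = a * Ucounit x).
Proof. exact: plift_morph Ucounit_rel. Qed.

Lemma Ugl_oner_neq0 : (1 : Ugl) != 0.
Proof. by apply/eqP => /(congr1 Ucounit)/eqP; rewrite !UcounitE oner_eq0. Qed.
HB.instance Definition _ := GRing.PzSemiRing_isNonZero.Build Ugl Ugl_oner_neq0.
HB.instance Definition _ :=
  GRing.Lmodule_isLalgebra.Build Qv Ugl (@presAlg_scalerAl _ _ Urel).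
HB.instance Definition _ :=
  GRing.Lalgebra_isAlgebra.Build Qv Ugl (@presAlg_scalerAr _ _ Urel).

Definition UE (i : 'I_m) : Ugl := pgen Urel (gE i).
Definition UF (i : 'I_m) : Ugl := pgen Urel (gF i).
Definition UK (i : 'I_m.+1) : Ugl := pgen Urel (gK i).
Definition UKinv (i : 'I_m.+1) : Ugl := pgen Urel (gKV i).

Definition Kexp (i : 'I_m.+1) (z : int) : Ugl :=
  match z with Posz a => UK i ^+ a | Negz a => UKinv i ^+ a.+1 end.

(* K_1^{j_1} ... K_n^{j_n} for integer exponents. *)
Definition Kmon (j : 'I_m.+1 -> int) : Ugl := \prod_i Kexp i (j i).

Definition Ktilde (i : 'I_m) : Ugl := UK (lo i) * UKinv (hi i).
Definition KtildeV (i : 'I_m) : Ugl := UK (hi i) * UKinv (lo i).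

(* The divided power x^(a) = x^a / [a]!. *)
Definition divpow (x : Ugl) (a : nat) : Ugl := (qfact a)^-1 *: x ^+ a.

(* The Z[v, v^-1]-form of U(sl_n), inside U(gl_n): the subring generated by the
   divided powers, the elements K~_i, K~_i^-1, and the scalars. *)
Inductive UZsl_gen : Ugl -> Prop :=
| UZsl_E i a : UZsl_gen (divpow (UE i) a)
| UZsl_F i a : UZsl_gen (divpow (UF i) a)
| UZsl_K i : UZsl_gen (Ktilde i)
| UZsl_KV i : UZsl_gen (KtildeV i)
| UZsl_scalar (z : Zv) : UZsl_gen (Zv_val z)%:A.

Definition UZsl_pred : {pred Ugl} := subring_span UZsl_gen.
HB.instance Definition _ := GRing.SubringClosed.on UZsl_pred.

Record UZsl := MkUZsl { UZsl_val : Ugl; UZsl_valP : UZsl_val \in UZsl_pred }.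
HB.instance Definition _ := [isSub for UZsl_val].
HB.instance Definition _ := [Choice of UZsl by <:].
HB.instance Definition _ := [SubChoice_isSubNzRing of UZsl by <:].

Fact UZsl_scale_subproof (z : Zv) (x : UZsl) :
  Zv_val z *: UZsl_val x \in UZsl_pred.
Proof.
rewrite -mulr_algl rpredM ?UZsl_valP //.
by apply/subring_spanP; apply: subring_gen_base; apply: UZsl_scalar.
Qed.
Definition UZsl_scale z x := MkUZsl (UZsl_scale_subproof z x).

Fact UZsl_scaleA z1 z2 x :
  UZsl_scale z1 (UZsl_scale z2 x) = UZsl_scale (z1 * z2) x.
Proof. by apply/val_inj; rewrite /= scalerA. Qed.
Fact UZsl_scale1 : left_id 1 UZsl_scale.
Proof. by move=> x; apply/val_inj; rewrite /= scale1r. Qed.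
Fact UZsl_scaleDr : right_distributive UZsl_scale +%R.
Proof. by move=> z x y; apply/val_inj; rewrite /= scalerDr. Qed.
Fact UZsl_scaleDl x : {morph UZsl_scale^~ x : z1 z2 / z1 + z2}.
Proof. by move=> z1 z2; apply/val_inj; rewrite /= scalerDl. Qed.
HB.instance Definition _ := GRing.Zmodule_isLmodule.Build Zv UZsl
  UZsl_scaleA UZsl_scale1 UZsl_scaleDr UZsl_scaleDl.

Fact UZsl_scaleAl (z : Zv) (x y : UZsl) : z *: (x * y) = z *: x * y.
Proof. by apply/val_inj; rewrite /= scalerAl. Qed.
HB.instance Definition _ := GRing.Lmodule_isLalgebra.Build Zv UZsl UZsl_scaleAl.
Fact UZsl_scaleAr (z : Zv) (x y : UZsl) : z *: (x * y) = x * (z *: y).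
Proof. by apply/val_inj; rewrite /= scalerAr. Qed.
HB.instance Definition _ := GRing.Lalgebra_isAlgebra.Build Zv UZsl UZsl_scaleAr.

Lemma UZsl_counit (x : UZsl) : Ucounit (UZsl_val x) \in Zv_pred.
Proof.
have cg g : Ucounit (pgen Urel g) = Ucounit_gen g by apply: plift_gen Ucounit_rel _.
have cX y a : Ucounit (y ^+ a) = Ucounit y ^+ a.
  by elim: a => [|a ih]; rewrite ?expr0 ?exprS UcounitE ?ih.
have cD y a : Ucounit y = 0 -> Ucounit (divpow y a) \in Zv_pred.
  move=> y0; rewrite /divpow UcounitE cX y0 expr0n; case: a => [|a] /=.
    by rewrite /qfact big_geq // invr1 mul1r rpred1.
  by rewrite mulr0 rpred0.
have /subring_spanP := UZsl_valP x; elim=> [_ []|||].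
- by move=> i a; apply: cD; rewrite cg.
- by move=> i a; apply: cD; rewrite cg.
- by move=> i; rewrite /Ktilde UcounitE !cg mulr1 rpred1.
- by move=> i; rewrite /KtildeV UcounitE !cg mulr1 rpred1.
- by move=> z; rewrite !UcounitE mulr1 Zv_valP.
- by rewrite UcounitE rpred1.
- by move=> y z _ yZ _ zZ; rewrite !UcounitE; apply: rpredB.
- by move=> y z _ yZ _ zZ; rewrite UcounitE; apply: rpredM.
Qed.
End QuantumGl.

(* Sums over r-tuples, split along concatenation. *)
Section TupleSum.
Variables (R : pzRingType) (I : finType).

Definition tsum k (h : seq I -> R) : R := \sum_(T : k.-tuple I) h T.

Lemma tsum0 h : tsum 0 h = h [::].
Proof.
rewrite /tsum (big_pred1 ([tuple] : 0.-tuple I)) // => T /=.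
by apply/esym/eqP/tuple0.
Qed.

Lemma tsumS k h : tsum k.+1 h = \sum_x tsum k (fun T => h (x :: T)).
Proof.
rewrite pair_big /= /tsum.
rewrite (reindex (fun p : I * k.-tuple I => [tuple of p.1 :: p.2])) //=.
exists (fun T : k.+1.-tuple I => (thead T, [tuple of behead T])) => [[x T] _|T _] /=.
  by congr (_, _); apply/val_inj.
by apply/val_inj; rewrite /= -[RHS]/(tval T) [in RHS](tuple_eta T).
Qed.

Lemma eq_tsum k h1 h2 : (forall T, size T = k -> h1 T = h2 T) -> tsum k h1 = tsum k h2.
Proof. by move=> h12; apply: eq_bigr => T _; rewrite h12 ?size_tuple. Qed.

Lemma tsum_cat a b h :
  tsum (a + b) h = tsum a (fun T1 => tsum b (fun T2 => h (T1 ++ T2))).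
Proof.
elim: a h => [|a ih] h; first by rewrite tsum0.
by rewrite addSn !tsumS; apply: eq_bigr => x _; rewrite ih.
Qed.
End TupleSum.

(* The q-Schur algebra over R with q^{1/2} = v.
   - Aq is the R-algebra A_q(n) on the c_ij, Aqr its degree r part A_q(n, r).
   - qSchur is the linear dual of Aqr.  Its product is dual to the
     comultiplication c_ij |-> \sum_t c_it (x) c_tj, that is (qS_mulE)
       (f * g)(c_{i1 j1} ... c_{ir jr})
         = \sum_(t1, ..., tr) f(c_{i1 t1} ... c_{ir tr}) g(c_{t1 j1} ... c_{tr jr}),
     and its unit is the counit c_ij |-> delta_ij (qS_oneE).
   A word in the c_ij is a sequence of pairs, and ev f s is f at the word s when
   s has length r. *)
Section QSchur.
Variables (R : comNzRingType) (v : R) (n r : nat).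
Notation P := ('I_n * 'I_n)%type.
Let q : R := v ^+ 2.
Local Notation c i j := (fgen R ((i, j) : P)).

Inductive Aqrel : freeAlg R P -> freeAlg R P -> Prop :=
| Aqrel_row (i j s : 'I_n) : Aqrel (c i j * c i s) (c i s * c i j)
| Aqrel_le (i j k s : 'I_n) : (k < i)%N -> (j <= s)%N ->
    Aqrel (c i j * c k s) (q *: (c k s * c i j))
| Aqrel_gt (i j k s : 'I_n) : (k < i)%N -> (s < j)%N ->
    Aqrel (c i j * c k s) ((q - 1) *: (c k j * c i s) + c k s * c i j).

Definition Aq : Type := presAlg Aqrel.
HB.instance Definition _ := GRing.PzRing.on Aq.
HB.instance Definition _ := GRing.Lmodule.on Aq.

Definition cgen (p : P) : Aq := pgen Aqrel p.
Definition cword (s : seq P) : Aq := \prod_(p <- s) cgen p.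

Definition Aqr_pred : {pred Aq} := fun x =>
  `[< exists a : {ffun r.-tuple P -> R}, x = \sum_w a w *: cword w >].

Lemma Aqr_pred_closed : submod_closed Aqr_pred.
Proof.
split=> [|a x y /asboolP[b ->] /asboolP[b' ->]].
  by apply/asboolP; exists [ffun=> 0]; rewrite big1 // => w _; rewrite ffunE scale0r.
apply/asboolP; exists [ffun w => a * b w + b' w].
rewrite scaler_sumr -big_split; apply: eq_bigr => w _.
by rewrite ffunE scalerDl scalerA.
Qed.
HB.instance Definition _ := GRing.isSubmodClosed.Build R Aq Aqr_pred Aqr_pred_closed.

Record Aqr := MkAqr { Aqr_val : Aq; Aqr_valP : Aqr_val \in Aqr_pred }.
HB.instance Definition _ := [isSub for Aqr_val].
HB.instance Definition _ := [Choice of Aqr by <:].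
HB.instance Definition _ := [SubChoice_isSubLmodule of Aqr by <:].

Lemma cword_in (w : r.-tuple P) : cword w \in Aqr_pred.
Proof.
apply/asboolP; exists [ffun u => (u == w)%:R]; rewrite (bigD1 w) //= ffunE eqxx.
rewrite scale1r big1 ?addr0 // => u /negPf uw.
by rewrite ffunE uw scale0r.
Qed.
Definition cmonr (w : r.-tuple P) : Aqr := MkAqr (cword_in w).

Lemma cmonr_span (x : Aqr) :
  exists a : {ffun r.-tuple P -> R}, x = \sum_w a w *: cmonr w.
Proof.
have /asboolP[a xE] := Aqr_valP x; exists a; apply/val_inj; rewrite raddf_sum /=.
by rewrite xE; apply: eq_bigr.
Qed.

Definition qS_pred : {pred Aqr -> R^o} := fun f => `[< linear f >].

Lemma qS_pred_closed : submod_closed qS_pred.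
Proof.
split=> [|a f g /asboolP fL /asboolP gL]; apply/asboolP => b x y.
  by have e : b *: (0 : R^o) + 0 = 0 by rewrite scaler0 addr0.
have E z : (a *: f + g) z = a *: f z + g z by [].
rewrite !E fL gL !scalerDr !scalerA [b * a]mulrC !addrA; congr (_ + _).
by rewrite addrAC.
Qed.
HB.instance Definition _ := GRing.isSubmodClosed.Build R _ qS_pred qS_pred_closed.

Record qSchur := MkqS { qS_fun : Aqr -> R^o; qS_funP : qS_fun \in qS_pred }.
HB.instance Definition _ := [isSub for qS_fun].
HB.instance Definition _ := [Choice of qSchur by <:].
HB.instance Definition _ := [SubChoice_isSubLmodule of qSchur by <:].

Lemma qS_linear (f : qSchur) : linear (qS_fun f).
Proof. exact/asboolP/qS_funP. Qed.
HB.instance Definition _ (f : qSchur) :=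
  GRing.isLinear.Build R Aqr R^o _ (qS_fun f) (qS_linear f).

Lemma qSP (f g : qSchur) :
  (forall w, qS_fun f (cmonr w) = qS_fun g (cmonr w)) -> f = g.
Proof.
move=> fg; apply/val_inj/funext => x /=; have [a ->] := cmonr_span x.
by rewrite !linear_sum /=; apply: eq_bigr=> w _; rewrite !linearZ_LR /= fg.
Qed.

(* qrel Z: the values Z a b, meant for the products c_a c_b, respect the relations. *)
Definition qrel (Z : P -> P -> R) : Prop :=
  [/\ forall i j s, Z (i, j) (i, s) = Z (i, s) (i, j),
      forall i j k s : 'I_n, (k < i)%N -> (j <= s)%N ->
        Z (i, j) (k, s) = q * Z (k, s) (i, j) &
      forall i j k s : 'I_n, (k < i)%N -> (s < j)%N ->
        Z (i, j) (k, s) = (q - 1) * Z (k, j) (i, s) + Z (k, s) (i, j)].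

Lemma qrel0 Z : (forall a b, Z a b = 0) -> qrel Z.
Proof. by move=> Z0; split=> *; rewrite !Z0 ?mulr0 ?addr0. Qed.

Lemma qrel_sum (I : finType) (Z : I -> P -> P -> R) :
  (forall x, qrel (Z x)) -> qrel (fun a b => \sum_x Z x a b).
Proof.
move=> Zq; split=> [i j s|i j k s ki js|i j k s ki sj].
- by apply: eq_bigr => x _; case: (Zq x).
- by rewrite mulr_sumr; apply: eq_bigr => x _; have [_ -> //] := Zq x.
- rewrite mulr_sumr -big_split; apply: eq_bigr => x _; by have [_ _ -> //] := Zq x.
Qed.

Lemma eq_qrel Z1 Z2 : (forall a b, Z1 a b = Z2 a b) -> qrel Z1 -> qrel Z2.
Proof.
by move=> e [h1 h2 h3]; split=> *; rewrite -!e; [apply: h1|apply: h2|apply: h3].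
Qed.

(* The comultiplication in degree 2: the product of qrel families is qrel. *)
Definition conv2 (X Y : P -> P -> R) (a b : P) : R :=
  \sum_t \sum_t' X (a.1, t) (b.1, t') * Y (t, a.2) (t', b.2).

Lemma sum2_sym (H H' : 'I_n -> 'I_n -> R) :
  (forall t, H t t = H' t t) ->
  (forall t t' : 'I_n, (t < t')%N -> H t t' + H t' t = H' t t' + H' t' t) ->
  \sum_t \sum_t' H t t' = \sum_t \sum_t' H' t t'.
Proof.
move=> Hd Hs.
have E (G : 'I_n -> 'I_n -> R) : \sum_t \sum_t' G t t' =
    \sum_t G t t + \sum_(t : 'I_n) \sum_(t' : 'I_n | (t < t')%N) (G t t' + G t' t).
  have -> : \sum_(t : 'I_n) \sum_(t' : 'I_n | (t < t')%N) (G t t' + G t' t) =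
      \sum_(t : 'I_n) \sum_(t' : 'I_n | (t < t')%N) G t t' +
      \sum_(t : 'I_n) \sum_(t' : 'I_n | (t' < t)%N) G t t'.
    rewrite [X in _ = _ + X](exchange_big_dep xpredT) //= -big_split /=.
    by apply: eq_bigr => t _; rewrite big_split.
  rewrite -!big_split; apply: eq_bigr => t _ /=.
  rewrite (bigD1 t) //= (bigID (fun t' : 'I_n => (t < t')%N)) /=; congr (_ + (_ + _)).
    by apply: eq_bigl => t'; rewrite -val_eqE /= neq_ltn; case: ltngtP.
  by apply: eq_bigl => t'; rewrite -val_eqE /=; case: ltngtP.
rewrite !E; congr (_ + _); first by apply: eq_bigr.
by apply: eq_bigr => t _; apply: eq_bigr => t' /Hs.
Qed.

Lemma conv2_qrel X Y : qrel X -> qrel Y -> qrel (conv2 X Y).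
Proof.
move=> [X1 X2 X3] [Y1 Y2 Y3].
have Yrow (j s t t' : 'I_n) : (t < t')%N ->
    Y (t, j) (t', s) + Y (t', j) (t, s) = Y (t, s) (t', j) + Y (t', s) (t, j).
  move=> tt'; case: (ltngtP j s) => [js|sj|/val_inj -> //].
  - by rewrite (Y2 t' j t s tt' (ltnW js)) (Y3 t' s t j tt' js); ring.
  - by rewrite (Y3 t' j t s tt' sj) (Y2 t' s t j tt' (ltnW sj)); ring.
split=> [i j s|i j k s ki js|i j k s ki sj]; rewrite /conv2 /=.
- apply: sum2_sym => [t|t t' tt']; first by rewrite Y1.
  by rewrite (X1 i t' t) -!mulrDr Yrow.
- rewrite mulr_sumr; under [RHS]eq_bigr do rewrite mulr_sumr.
  apply: sum2_sym => [t|t t' tt'].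
    by rewrite (X2 i t k t ki (leqnn _)) (Y1 t j s) mulrA.
  rewrite (X2 i t k t' ki (ltnW tt')) (X3 i t' k t ki tt') (Y2 t' j t s tt' js).
  case: (ltngtP j s) (js) => [{}js _|//|/val_inj <- _].
    by rewrite (Y3 t' s t j tt' js); ring.
  by rewrite (Y2 t' j t j tt' (leqnn _)); ring.
- rewrite mulr_sumr -big_split /=.
  under [RHS]eq_bigr do rewrite mulr_sumr -big_split /=.
  apply: sum2_sym => [t|t t' tt'].
    by rewrite (X2 i t k t ki (leqnn _)) (Y1 t j s); ring.
  rewrite (X2 i t k t' ki (ltnW tt')) (X3 i t' k t ki tt') (Y3 t' j t s tt' sj).
  by rewrite (Y2 t' s t j tt' (ltnW sj)); ring.
Qed.

Section FromWords.
Variable g : seq P -> R.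

Let g' : seq P -> R^o := g.

Hypothesis gP : forall u w, qrel (fun a b => g (u ++ a :: b :: w)).

Let gword u w a b :
  flin g' (fword R u * (fgen R a * fgen R b) * fword R w) = g (u ++ a :: b :: w).
Proof. by rewrite -!fword1 -!fword_cat flin_word -catA. Qed.

Lemma qrel_compat u w x y : Aqrel x y ->
  flin g' (fword R u * x * fword R w) = flin g' (fword R u * y * fword R w).
Proof.
have [grow gle ggt] := gP u w.
case=> [i j s|i j k s ki js|i j k s ki sj].
- by rewrite !gword grow.
- by rewrite -scalerAr -scalerAl linearZ_LR /= !gword gle.
- by rewrite mulrDr mulrDl -scalerAr -scalerAl linearP /= !gword ggt.
Qed.

Definition qS_of_fun (x : Aqr) : R^o := plin (rel := Aqrel) g' (val x).

Lemma qS_of_funP : qS_of_fun \in qS_pred.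
Proof.
apply/asboolP=> a x y.
by rewrite /qS_of_fun (_ : val (a *: x + y) = a *: val x + val y) //
  (plin_is_linear qrel_compat).
Qed.
Definition qS_of : qSchur := MkqS qS_of_funP.

Lemma qS_ofE (w : r.-tuple P) : qS_fun qS_of (cmonr w) = g w.
Proof. exact: (plin_word qrel_compat). Qed.
End FromWords.

Definition ev (f : qSchur) (s : seq P) : R := qS_fun f (insubd (0 : Aqr) (cword s)).

Arguments ev : simpl never.

Lemma evE f (w : r.-tuple P) : ev f w = qS_fun f (cmonr w).
Proof. by rewrite /ev; congr (qS_fun f _); apply/val_inj; rewrite val_insubd cword_in. Qed.

Lemma cword_seq_in s : size s = r -> cword s \in Aqr_pred.
Proof. by move=> sr; apply: (cword_in (Tuple (introT eqP sr))). Qed.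

Lemma ev_qrel f u w : (size u + 2 + size w)%N = r ->
  qrel (fun a b => ev f (u ++ a :: b :: w)).
Proof.
move=> sz.
have in_r a b : cword (u ++ a :: b :: w) \in Aqr_pred.
  by apply: cword_seq_in; rewrite size_cat /= -sz -addnA.
have cE a b : cword (u ++ a :: b :: w) =
    pres Aqrel (fword R u * (fgen R a * fgen R b) * fword R w).
  rewrite -[cword _]/(pword Aqrel _) pwordE -!fword1 -!fword_cat -catA //.
pose x a b : Aqr := MkAqr (in_r a b).
have evx a b : ev f (u ++ a :: b :: w) = qS_fun f (x a b).
  by rewrite /ev; congr (qS_fun f _); apply/val_inj; rewrite val_insubd in_r.
have rel0 (y z : freeAlg R P) : Aqrel y z ->
    pres Aqrel (fword R u * y * fword R w) = pres Aqrel (fword R u * z * fword R w).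
  by move=> yz; rewrite !rmorphM /= (pres_rel yz).
apply: (eq_qrel (fun a b => esym (evx a b))).
split=> [i j s|i j k s ki js|i j k s ki sj].
- by congr (qS_fun f _); apply/val_inj; rewrite /= !cE; apply/rel0/Aqrel_row.
- rewrite -[RHS](linearZ_LR (qS_fun f)) /=; congr (qS_fun f _); apply/val_inj.
  by rewrite /= !cE (rel0 _ _ (Aqrel_le ki js)) -scalerAr -scalerAl presZ.
- rewrite -[X in X + _](linearZ_LR (qS_fun f)) /= -linearD /=.
  congr (qS_fun f _); apply/val_inj.
  rewrite /= !cE (rel0 _ _ (Aqrel_gt ki sj)) mulrDr mulrDl rmorphD /=.
  by rewrite -scalerAr -scalerAl presZ.
Qed.

Definition conv (f g : qSchur) (s : seq P) : R :=
  if size s == r then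
    \sum_(T : r.-tuple 'I_n) ev f (zip (map fst s) T) * ev g (zip T (map snd s))
  else 0.

Lemma conv_qrel f g u w : qrel (fun a b => conv f g (u ++ a :: b :: w)).
Proof.
have sz a b : size (u ++ a :: b :: w) = (size u + (2 + size w))%N.
  by rewrite size_cat.
have [sr|/negPf sr] := eqVneq (size u + (2 + size w))%N r; last first.
  by apply: qrel0 => a b; rewrite /conv sz sr.
pose X T1 T2 a b := ev f (zip (map fst u) T1 ++ a :: b :: zip (map fst w) T2).
pose Y T1 T2 a b := ev g (zip T1 (map snd u) ++ a :: b :: zip T2 (map snd w)).
pose Z a b := \sum_(T : (size u).-tuple 'I_n * (size w).-tuple 'I_n)
  conv2 (X T.1 T.2) (Y T.1 T.2) a b.
apply: (@eq_qrel Z) => [a b|].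
  rewrite /Z /conv sz sr eqxx.
  pose h T := ev f (zip (map fst (u ++ a :: b :: w)) T) *
              ev g (zip T (map snd (u ++ a :: b :: w))).
  rewrite -[RHS]/(tsum r h) -sr tsum_cat -(pair_bigA _ (fun T1 T2 =>
    conv2 (X (tval T1) (tval T2)) (Y (tval T1) (tval T2)) a b)) /=.
  apply: eq_bigr => T1 _; rewrite /conv2 exchange_big tsumS /=.
  apply: eq_bigr => t _; rewrite exchange_big tsumS /=.
  apply: eq_bigr => t' _; apply: eq_bigr => T2 _.
  by rewrite /h !map_cat /= !zip_cat ?size_map ?size_tuple.
apply: qrel_sum => -[T1 T2] /=.
by apply: conv2_qrel; apply: ev_qrel;
  rewrite !size_zip !size_map !size_tuple !minnn -addnA.
Qed.

Definition qS_mul (f g : qSchur) : qSchur := qS_of (conv_qrel f g).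

Lemma qS_mulE f g s : size s = r ->
  ev (qS_mul f g) s =
  \sum_(T : r.-tuple 'I_n) ev f (zip (map fst s) T) * ev g (zip T (map snd s)).
Proof.
move=> sr; rewrite -[s]/(tval (Tuple (introT eqP sr))) evE qS_ofE /conv /=.
by rewrite sr eqxx.
Qed.

Definition counit (s : seq P) : R :=
  if size s == r then (map fst s == map snd s)%:R else 0.

Lemma counit_qrel u w : qrel (fun a b => counit (u ++ a :: b :: w)).
Proof.
have cE a b : counit (u ++ a :: b :: w) =
    counit (u ++ a :: b :: w) * (a.1 == a.2)%:R * (b.1 == b.2)%:R.
  rewrite /counit; case: ifP => _; last by rewrite !mul0r.
  rewrite !map_cat eqseq_cat ?size_map //= !eqseq_cons.
  by case: (a.1 == _) (b.1 == _) => [] []; rewrite ?andbF ?mulr1 ?mulr0 ?mul0r.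
split=> [i j s|i j k s ki js|i j k s ki sj].
- rewrite cE [RHS]cE /=; case: (eqVneq i j) => [<-|]; last by rewrite !mulr0 mul0r.
  by case: (eqVneq i s) => [<-|]; last by rewrite !mulr0 mul0r.
- rewrite cE [in RHS]cE /=.
  case: (eqVneq i j) js => [<-|_ _]; last by rewrite !(mulr0, mul0r).
  case: (eqVneq k s) ki => [<-|_ _ _]; last by rewrite !(mulr0, mul0r).
  by move=> ki ik; have := leq_trans ki ik; rewrite ltnn.
rewrite cE [in X in _ = X + _]cE [in X in _ = _ + X]cE /=.
have -> : (counit (u ++ [:: (k, j), (i, s) & w]) * (k == j)%:R * (i == s)%:R = 0).
  case: (eqVneq k j) sj => [<-|_ _]; last by rewrite !(mulr0, mul0r).
  case: (eqVneq i s) ki => [<-|_ _ _]; last by rewrite !(mulr0, mul0r).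
  by move=> ki ik; have := ltn_trans ki ik; rewrite ltnn.
rewrite mulr0 add0r.
case: (eqVneq i j) => [<-|_]; last by rewrite !(mulr0, mul0r).
case: (eqVneq k s) => [<-|_]; last by rewrite !(mulr0, mul0r).
by rewrite /counit !size_cat /= !map_cat !eqseq_cat ?size_map //= !eqseq_cons !eqxx.
Qed.

Definition qS_one : qSchur := qS_of counit_qrel.

Lemma qS_oneE s : size s = r -> ev qS_one s = (map fst s == map snd s)%:R.
Proof.
move=> sr; rewrite -[s]/(tval (Tuple (introT eqP sr))) evE qS_ofE /counit /=.
by rewrite sr eqxx.
Qed.

Lemma qS_ext (f g : qSchur) : (forall s, size s = r -> ev f s = ev g s) -> f = g.
Proof. by move=> fg; apply: qSP => w; rewrite -!evE fg ?size_tuple. Qed.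

Lemma evD (f g : qSchur) s : ev (f + g) s = ev f s + ev g s.
Proof. by []. Qed.

Lemma evZ a (f : qSchur) s : ev (a *: f) s = a * ev f s.
Proof. by []. Qed.

Lemma zip_size (s t : seq 'I_n) : size s = r -> size t = r -> size (zip s t) = r.
Proof. by move=> sr tr; rewrite size_zip sr tr minnn. Qed.

Lemma map_zip1 (s t : seq 'I_n) : size s = r -> size t = r -> map fst (zip s t) = s.
Proof. by move=> sr tr; rewrite -/(unzip1 _) unzip1_zip ?sr ?tr. Qed.

Lemma map_zip2 (s t : seq 'I_n) : size s = r -> size t = r -> map snd (zip s t) = t.
Proof. by move=> sr tr; rewrite -/(unzip2 _) unzip2_zip ?sr ?tr. Qed.

Fact qS_mulA : associative qS_mul.
Proof.
move=> f g h; apply: qS_ext => s sr; have sz1 : size (map fst s) = r by rewrite size_map.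
have sz2 : size (map snd s) = r by rewrite size_map.
rewrite !qS_mulE //.
under eq_bigr => T _ do
  rewrite qS_mulE ?zip_size ?map_zip1 ?map_zip2 ?size_tuple // mulr_sumr.
under [RHS]eq_bigr => T _ do
  rewrite qS_mulE ?zip_size ?map_zip1 ?map_zip2 ?size_tuple // mulr_suml.
rewrite exchange_big; apply: eq_bigr => T _; apply: eq_bigr => T' _.
by rewrite mulrA.
Qed.

Fact qS_mul1 : left_id qS_one qS_mul.
Proof.
move=> f; apply: qS_ext => s sr; have sz1 : size (map fst s) == r by rewrite size_map sr.
rewrite qS_mulE // (bigD1 (Tuple sz1)) //= big1 => [|T TN].
  rewrite qS_oneE ?zip_size ?(eqP sz1) // map_zip1 ?(eqP sz1) // map_zip2 ?(eqP sz1) //.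
  by rewrite eqxx mul1r addr0; congr ev; apply: zip_unzip.
rewrite qS_oneE ?zip_size ?size_tuple ?(eqP sz1) //.
rewrite map_zip1 ?size_tuple ?(eqP sz1) // map_zip2 ?size_tuple ?(eqP sz1) //.
rewrite eq_sym (_ : (tval T == _) = false) ?mul0r //.
by apply/negbTE; move: TN; rewrite -val_eqE.
Qed.

Fact qS_mulr1 : right_id qS_one qS_mul.
Proof.
move=> f; apply: qS_ext => s sr; have sz2 : size (map snd s) == r by rewrite size_map sr.
rewrite qS_mulE // (bigD1 (Tuple sz2)) //= big1 => [|T TN].
  rewrite [X in _ * X]qS_oneE ?zip_size ?(eqP sz2) // map_zip1 ?(eqP sz2) // map_zip2 ?(eqP sz2) //.
  by rewrite eqxx mulr1 addr0; congr ev; apply: zip_unzip.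
rewrite [X in _ * X]qS_oneE ?zip_size ?size_tuple ?(eqP sz2) //.
rewrite map_zip1 ?size_tuple ?(eqP sz2) // map_zip2 ?size_tuple ?(eqP sz2) //.
rewrite (_ : (tval T == _) = false) ?mulr0 //.
by apply/negbTE; move: TN; rewrite -val_eqE.
Qed.

Fact qS_mulDl : left_distributive qS_mul +%R.
Proof.
move=> f g h; apply: qS_ext => s sr; rewrite evD !qS_mulE // -big_split.
by apply: eq_bigr => T _; rewrite evD mulrDl.
Qed.

Fact qS_mulDr : right_distributive qS_mul +%R.
Proof.
move=> f g h; apply: qS_ext => s sr; rewrite evD !qS_mulE // -big_split.
by apply: eq_bigr => T _; rewrite evD mulrDr.
Qed.

HB.instance Definition _ := GRing.Zmodule_isPzRing.Build qSchur
  qS_mulA qS_mul1 qS_mulr1 qS_mulDl qS_mulDr.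

Lemma qS_scaleAl (a : R) (f g : qSchur) : a *: (f * g) = a *: f * g.
Proof.
apply: qS_ext => s sr; rewrite evZ !qS_mulE // mulr_sumr.
by apply: eq_bigr => T _; rewrite evZ mulrA.
Qed.

Lemma qS_scaleAr (a : R) (f g : qSchur) : a *: (f * g) = f * (a *: g).
Proof.
apply: qS_ext => s sr; rewrite evZ !qS_mulE // mulr_sumr.
by apply: eq_bigr => T _; rewrite evZ mulrCA.
Qed.

End QSchur.
Arguments ev : simpl never.

Section QSchurAlg.
Variables (R : comNzRingType) (v : R) (m r : nat).

Lemma qS_oner_neq0 : (1 : qSchur v m.+1 r) != 0.
Proof.
pose s : seq ('I_m.+1 * 'I_m.+1) := nseq r (ord0, ord0).
apply/eqP => /(congr1 (fun f => ev f s)) e.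
have := qS_oneE v (size_nseq r (ord0, ord0) : size s = r).
by rewrite !map_nseq eqxx [LHS]e => /esym/eqP; rewrite oner_eq0.
Qed.
HB.instance Definition _ :=
  GRing.PzSemiRing_isNonZero.Build (qSchur v m.+1 r) qS_oner_neq0.
HB.instance Definition _ :=
  GRing.Lmodule_isLalgebra.Build R (qSchur v m.+1 r) (@qS_scaleAl R v m.+1 r).
HB.instance Definition _ :=
  GRing.Lalgebra_isAlgebra.Build R (qSchur v m.+1 r) (@qS_scaleAr R v m.+1 r).
End QSchurAlg.

(* For phi : R -> S, the map A_q(n, r)_R^* -> A_q(n, r)_S^* that applies phi to the
   values on monomials.  Through it U_S(n, r) is identified with
   U_R(n, r) (x)_R S: the element f (x) c corresponds to c *: qS_bc f. *)
Section QSchurBaseChange.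
Variables (R S : comNzRingType) (phi : {rmorphism R -> S}) (v : R) (n r : nat).

Definition bc_fun (f : qSchur v n r) (s : seq ('I_n * 'I_n)) : S :=
  if size s == r then phi (ev f s) else 0.

Lemma bc_fun_qrel f u w : qrel (phi v) (fun a b => bc_fun f (u ++ a :: b :: w)).
Proof.
have sz a b : size (u ++ a :: b :: w) = (size u + 2 + size w)%N.
  by rewrite size_cat -addnA.
have [sr|/negPf sr] := eqVneq (size u + 2 + size w)%N r; last first.
  by apply: qrel0 => a b; rewrite /bc_fun sz sr.
have [f1 f2 f3] := ev_qrel f sr.
split=> [i j s|i j k s ki js|i j k s ki sj]; rewrite /bc_fun !sz sr eqxx.
- by rewrite f1.
- by rewrite f2 // rmorphM rmorphXn.
- by rewrite f3 // rmorphD rmorphM rmorphB rmorphXn rmorph1.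
Qed.

Definition qS_bc (f : qSchur v n r) : qSchur (phi v) n r := qS_of r (bc_fun_qrel f).

Lemma qS_bcE f s : size s = r -> ev (qS_bc f) s = phi (ev f s).
Proof.
move=> sr; rewrite -[s]/(tval (Tuple (introT eqP sr))) evE qS_ofE /bc_fun /=.
by rewrite sr eqxx.
Qed.
End QSchurBaseChange.

Section DualBasis.
Variables (R : comNzRingType) (v : R) (n r : nat).

Definition mxtotal (A : 'M[nat]_n) : nat := (\sum_i \sum_j A i j)%N.

(* c^A = c_11^{a_11} c_21^{a_21} ... c_n1^{a_n1} c_12^{a_12} ... c_nn^{a_nn}: the
   product is noncommutative and runs through the columns one after the other. *)
Definition cmon (A : 'M[nat]_n) : Aq v n := \prod_j \prod_i cgen v (i, j) ^+ A i j.

(* The dual basis element at c^A, for A of entry sum r: the functional which is 1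
   at c^A and 0 at the other monomials c^B of degree r.  It is unique since the c^B
   span; the default value 0 of xget would only matter if it did not exist. *)
Definition xi (A : 'M[nat]_n) : qSchur v n r :=
  xget 0 [set f | forall B, mxtotal B = r ->
    forall x : Aqr v n r, Aqr_val x = cmon B -> qS_fun f x = (B == A)%:R].
End DualBasis.

Section BLM.
Variables n r : nat.

(* d_A; [A] = q^{-d_A/2} xi_A with q^{1/2} = v. *)
Definition dA (A : 'M[nat]_n) : int :=
  - (\sum_(i < n) \sum_(j < n) \sum_(s < n | (i < s)%N) \sum_(t < n | (t < j)%N)
       (A i j * A s t)%N%:Z)
  + \sum_(i < n) \sum_(j < n) \sum_(t < n | (t < j)%N) (A i j * A i t)%N%:Z.

Definition bracket (A : 'M[nat]_n) : qSchur vQ n r := vQ ^ (- dA A) *: xi vQ r A.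

(* A(j, r).  The bound d i <= r on the diagonal entries of D is implied by the
   condition that A + D has entry sum r. *)
Definition Ajr (A : 'M[nat]_n) (j : 'I_n -> int) : qSchur vQ n r :=
  \sum_(d : {ffun 'I_n -> 'I_r.+1} | mxtotal (A + diag_mx (\row_i (d i : nat))) == r)
    vQ ^ (\sum_i (d i)%:Z * j i) *: bracket (A + diag_mx (\row_i (d i : nat))).
End BLM.

(* The additive extension of b to the free abelian group on M * N. *)
HB.lock Definition tens_lin (M N : choiceType) (V : zmodType) (b : M -> N -> V)
    (x : {malg int[(M * N)%type]}) : V :=
  \sum_(p <- msupp x) b p.1 p.2 *~ x@_p.

(* The tensor product of modules over a commutative ring Z: the free abelian group
   on M * N modulo the usual relations. *)
Section Tensor.
Variables (Z : comNzRingType) (M N : lmodType Z).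

Definition tens_free : Type := {malg int[(M * N)%type]}.
HB.instance Definition _ := GRing.Zmodule.on tens_free.

Definition tens_gen (m : M) (n : N) : tens_free := << (m, n) >>.

Inductive tens_rel : tens_free -> Prop :=
| tens_rel_Dl m m' n : tens_rel (tens_gen (m + m') n - tens_gen m n - tens_gen m' n)
| tens_rel_Dr m n n' : tens_rel (tens_gen m (n + n') - tens_gen m n - tens_gen m n')
| tens_rel_Z a m n : tens_rel (tens_gen (a *: m) n - tens_gen m (a *: n)).

Inductive tens_sub : tens_free -> Prop :=
| tens_sub0 : tens_sub 0
| tens_subD x y : tens_rel x -> tens_sub y -> tens_sub (x + y)
| tens_subB x y : tens_rel x -> tens_sub y -> tens_sub (- x + y).

Definition tens_pred : {pred tens_free} := fun x => `[< tens_sub x >].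

Lemma tens_zmod_closed : zmod_closed tens_pred.
Proof.
have D x y : tens_sub x -> tens_sub y -> tens_sub (x + y).
  by elim=> [|u w ru _ ih|u w ru _ ih] sy; rewrite ?add0r // -addrA;
    [apply: tens_subD|apply: tens_subB] => //; apply: ih.
have O x : tens_sub x -> tens_sub (- x).
  elim=> [|u w ru _ ih|u w ru _ ih]; first by rewrite oppr0; apply: tens_sub0.
    by rewrite opprD; apply: tens_subB.
  by rewrite opprD opprK; apply: tens_subD.
split; first exact/asboolP/tens_sub0.
by move=> x y /asboolP sx /asboolP sy; apply/asboolP/D/O.
Qed.
HB.instance Definition _ := GRing.isZmodClosed.Build _ tens_pred tens_zmod_closed.

Definition tensor : Type := Quotient.quot tens_pred.
HB.instance Definition _ := GRing.Zmodule.on tensor.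
HB.instance Definition _ : EqQuotient _ (Quotient.equiv tens_pred) tensor :=
  EqQuotient.on tensor.

Definition tpi (x : tens_free) : tensor := \pi_tensor x.

Lemma tpi_is_zmod_morphism : zmod_morphism tpi.
Proof. exact: (@pi_is_zmod_morphism _ _ _ (Quotient.quot tens_pred)). Qed.
HB.instance Definition _ := GRing.isZmodMorphism.Build _ _ tpi tpi_is_zmod_morphism.

Definition tens (m : M) (n : N) : tensor := tpi (tens_gen m n).

Lemma tpiP x : tpi x = 0 <-> tens_sub x.
Proof.
rewrite -(raddf0 tpi) /tpi; split=> [/eqP|h].
  by rewrite -Quotient.idealrBE subr0 => /asboolP.
by apply/eqP; rewrite -Quotient.idealrBE subr0; apply/asboolP.
Qed.

Let tpi_rel x : tens_rel x -> tpi x = 0.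
Proof. by move=> rx; apply/tpiP; rewrite -[x]addr0; apply: tens_subD => //; apply: tens_sub0. Qed.

Lemma tensDl m m' n : tens (m + m') n = tens m n + tens m' n.
Proof.
apply/eqP; rewrite -subr_eq0 opprD addrA /tens -!raddfB /=.
exact/eqP/tpi_rel/tens_rel_Dl.
Qed.
Lemma tensDr m n n' : tens m (n + n') = tens m n + tens m n'.
Proof.
apply/eqP; rewrite -subr_eq0 opprD addrA /tens -!raddfB /=.
exact/eqP/tpi_rel/tens_rel_Dr.
Qed.
Lemma tensZ a m n : tens (a *: m) n = tens m (a *: n).
Proof.
by apply/eqP; rewrite -subr_eq0 /tens -raddfB /=; apply/eqP/tpi_rel/tens_rel_Z.
Qed.
Lemma tens0l n : tens 0 n = 0.
Proof. by apply: (addrI (tens 0 n)); rewrite -tensDl !addr0. Qed.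
Lemma tensNl m n : tens (- m) n = - tens m n.
Proof. by apply/eqP; rewrite -addr_eq0 -tensDl addNr tens0l. Qed.
Lemma tensMzl m n z : tens (m *~ z) n = tens m n *~ z.
Proof.
have tn a : tens (m *+ a) n = tens m n *+ a.
  by elim: a => [|a ih]; rewrite ?tens0l // !mulrS tensDl ih.
by case: z => a; rewrite -?pmulrn ?NegzE ?mulrNz ?tensNl -?pmulrn tn.
Qed.

Lemma tens_ind (P : tensor -> Prop) :
  P 0 -> (forall m n x, P x -> P (tens m n + x)) -> forall x, P x.
Proof.
move=> P0 Pt x; rewrite -[x](reprK x) -[\pi _]/(tpi _).
rewrite [repr x]monalgE; elim: (msupp _ : seq _) => [|[m n] l ih].
  by rewrite big_nil raddf0.
rewrite big_cons raddfD /=.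
suff -> : tpi << (repr x)@_(m, n) *g (m, n) >> = tens (m *~ (repr x)@_(m, n)) n.
  exact: Pt.
rewrite tensMzl /tens -raddfMz; congr (tpi _).
apply/malgP=> k; rewrite raddfMz /= !mcoeffU.
by case: (_ == _); rewrite ?mulr1n ?mulr0n ?mul0rz ?intz.
Qed.

Section Lift.
Variables (V : zmodType) (b : M -> N -> V).

Definition balanced : Prop :=
  [/\ forall m m' n, b (m + m') n = b m n + b m' n,
      forall m n n', b m (n + n') = b m n + b m n' &
      forall a m n, b (a *: m) n = b m (a *: n)].

Definition tlift (x : tensor) : V := tens_lin b (repr x).

Lemma tens_linEw (d : {fset (M * N)%type}) (x : tens_free) : (msupp x `<=` d)%fset ->
  tens_lin b x = \sum_(p <- d) b p.1 p.2 *~ x@_p.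
Proof.
move=> le; rewrite tens_lin.unlock (big_fset_incl _ le) => //= p pd /mcoeff_outdom ->.
by rewrite mulr0z.
Qed.

Lemma tens_lin_is_zmod_morphism : zmod_morphism (tens_lin b : tens_free -> V).
Proof.
move=> x y; pose d := (msupp x `|` msupp y)%fset.
rewrite (@tens_linEw d) ?msuppB_le // (@tens_linEw d x) ?fsubsetUl //.
rewrite (@tens_linEw d y) ?fsubsetUr // -sumrB; apply: eq_bigr=> p _.
by rewrite (mcoeffB p x y) mulrzBr.
Qed.
HB.instance Definition _ := GRing.isZmodMorphism.Build tens_free V
  (tens_lin b : tens_free -> V) tens_lin_is_zmod_morphism.

Lemma tens_lin_gen m n : tens_lin b (tens_gen m n) = b m n.
Proof.
rewrite (@tens_linEw [fset (m, n)]%fset) ?msuppU_le // big_seq_fset1.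
by rewrite /tens_gen mcoeffUU mulr1z.
Qed.

Hypothesis bB : balanced.

Lemma tliftE x : tlift (tpi x) = tens_lin b x.
Proof.
have [b1 b2 b3] := bB.
have rel0 y : tens_rel y -> tens_lin b y = 0.
  by case=> *; rewrite !raddfB /= !tens_lin_gen ?b1 ?b2 ?b3 ?subrr // addrAC addrK subrr.
have sub0 y : tens_sub y -> tens_lin b y = 0.
  by elim=> [|u w /rel0 ru _ ih|u w /rel0 ru _ ih];
    rewrite ?raddf0 // raddfD ?raddfN /= ru ih ?oppr0 addr0.
apply/eqP; rewrite -subr_eq0 /tlift -raddfB; apply/eqP/sub0/tpiP.
by rewrite raddfB /= [tpi (repr _)](reprK (tpi x)) subrr.
Qed.

Lemma tlift_tens m n : tlift (tens m n) = b m n.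
Proof. by rewrite /tens tliftE tens_lin_gen. Qed.

Lemma tliftD x y : tlift (x + y) = tlift x + tlift y.
Proof. by rewrite -(reprK x) -(reprK y) -!/(tpi _) -raddfD !tliftE raddfD. Qed.

Lemma tlift0 : tlift 0 = 0.
Proof. by apply: (addrI (tlift 0)); rewrite -tliftD !addr0. Qed.
End Lift.

End Tensor.

(* For phi : Z -> k and a Z-algebra M, the k-algebra M (x)_Z k, where restr phi is
   k viewed as a Z-module through phi, and bct u c is u (x) c. *)
Section BaseChange.
Variables (Z k : comNzRingType) (phi : {rmorphism Z -> k}).

Definition restr of {rmorphism Z -> k} : Type := k.
HB.instance Definition _ := GRing.ComNzRing.on (restr phi).

Definition restr_scale (a : Z) (c : restr phi) : restr phi := phi a * c.
Fact restr_scaleA a b c : restr_scale a (restr_scale b c) = restr_scale (a * b) c.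
Proof. by rewrite /restr_scale mulrA rmorphM. Qed.
Fact restr_scale1 : left_id 1 restr_scale.
Proof. by move=> c; rewrite /restr_scale rmorph1 mul1r. Qed.
Fact restr_scaleDr : right_distributive restr_scale +%R.
Proof. by move=> a c d; rewrite /restr_scale mulrDr. Qed.
Fact restr_scaleDl c : {morph restr_scale^~ c : a b / a + b}.
Proof. by move=> a b; rewrite /restr_scale rmorphD mulrDl. Qed.
HB.instance Definition _ := GRing.Zmodule_isLmodule.Build Z (restr phi)
  restr_scaleA restr_scale1 restr_scaleDr restr_scaleDl.

Lemma restr_scaleE a (c : restr phi) : a *: c = (phi a * c : k).
Proof. by []. Qed.

Variable M : algType Z.

Definition baseChange : Type := tensor M (restr phi).
HB.instance Definition _ := GRing.Zmodule.on baseChange.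

Definition bct (u : M) (c : k) : baseChange := tens u (c : restr phi).

Let mulb u c : M -> restr phi -> baseChange := fun u' c' => bct (u * u') (c * c').

Let mulb_bal u c : balanced (mulb u c).
Proof.
split=> *; rewrite /mulb /bct; first by rewrite mulrDr tensDl.
  by rewrite mulrDr tensDr.
by rewrite -scalerAr tensZ restr_scaleE mulrCA.
Qed.

Let mulr_ (y : baseChange) : M -> restr phi -> baseChange := fun u c => tlift (mulb u c) y.

Let mulr_bal y : balanced (mulr_ y).
Proof.
have E0 u c : tlift (mulb u c) 0 = 0 := tlift0 (mulb_bal u c).
have EP u c u1 c1 x :
    tlift (mulb u c) (tens u1 c1 + x) = mulb u c u1 c1 + tlift (mulb u c) x.
  by rewrite (tliftD (mulb_bal u c)) (tlift_tens (mulb_bal u c)).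
split=> [u u' c|u c c'|a u c]; rewrite /mulr_; elim/tens_ind: y => [|u1 c1 x ih].
- by rewrite !E0 addr0.
- rewrite !EP ih {1}/mulb /bct mulrDl tensDl; exact: addrACA.
- by rewrite !E0 addr0.
- rewrite !EP ih {1}/mulb /bct mulrDl tensDr; exact: addrACA.
- by rewrite !E0.
- rewrite !EP ih; congr (_ + _).
  by rewrite /mulb /bct -scalerAl tensZ !restr_scaleE mulrA.
Qed.

Definition bc_mul (x y : baseChange) : baseChange := tlift (mulr_ y) x.
Definition bc_one : baseChange := bct 1 1.
Definition bc_scale (c : k) : baseChange -> baseChange :=
  tlift (fun u (c' : restr phi) => bct u (c * c')).

Let bc_scale_bal c : balanced (fun u (c' : restr phi) => bct u (c * c')).
Proof.
split=> *; rewrite /bct; first by rewrite tensDl.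
  by rewrite mulrDr tensDr.
by rewrite tensZ !restr_scaleE mulrCA.
Qed.

Let bc_mulE u c u' c' : bc_mul (bct u c) (bct u' c') = bct (u * u') (c * c').
Proof. by rewrite /bc_mul (tlift_tens (mulr_bal _)) /mulr_ (tlift_tens (mulb_bal _ _)). Qed.

Fact bc_mulDl : left_distributive bc_mul +%R.
Proof. by move=> x y z; apply: tliftD (mulr_bal _) _ _. Qed.

Fact bc_mulDr : right_distributive bc_mul +%R.
Proof.
move=> x y z; elim/tens_ind: x => [|u c x ih].
  by rewrite /bc_mul !(tlift0 (mulr_bal _)) addr0.
rewrite !bc_mulDl ih addrACA; congr (_ + _).
by rewrite /bc_mul !(tlift_tens (mulr_bal _)); apply: tliftD (mulb_bal _ _) _ _.
Qed.

Let bc_mul0l x : bc_mul 0 x = 0.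
Proof. by apply: (addrI (bc_mul 0 x)); rewrite -bc_mulDl !addr0. Qed.
Let bc_mul0r x : bc_mul x 0 = 0.
Proof. by apply: (addrI (bc_mul x 0)); rewrite -bc_mulDr !addr0. Qed.

Fact bc_mulA : associative bc_mul.
Proof.
move=> x y z; elim/tens_ind: x => [|u c x ihx]; first by rewrite !bc_mul0l.
rewrite !bc_mulDl ihx; congr (_ + _) => {x ihx}.
elim/tens_ind: y => [|u' c' y ihy]; first by rewrite !(bc_mul0l, bc_mul0r).
rewrite !(bc_mulDl, bc_mulDr) ihy; congr (_ + _) => {y ihy}.
elim/tens_ind: z => [|u'' c'' z ihz]; first by rewrite !bc_mul0r.
rewrite !bc_mulDr ihz; congr (_ + _).
by rewrite -!/(bct _ _) !bc_mulE !mulrA.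
Qed.

Fact bc_mul1 : left_id bc_one bc_mul.
Proof.
move=> x; elim/tens_ind: x => [|u c x ih]; first by rewrite bc_mul0r.
by rewrite bc_mulDr ih -/(bct _ _) bc_mulE !mul1r.
Qed.

Fact bc_mulr1 : right_id bc_one bc_mul.
Proof.
move=> x; elim/tens_ind: x => [|u c x ih]; first by rewrite bc_mul0l.
by rewrite bc_mulDl ih -/(bct _ _) bc_mulE !mulr1.
Qed.

HB.instance Definition _ := GRing.Zmodule_isPzRing.Build baseChange
  bc_mulA bc_mul1 bc_mulr1 bc_mulDl bc_mulDr.

Lemma bctM u c u' c' : bct u c * bct u' c' = bct (u * u') (c * c').
Proof. exact: bc_mulE. Qed.

Let bc_scaleE c u c' : bc_scale c (bct u c') = bct u (c * c').
Proof. exact: (tlift_tens (bc_scale_bal c)). Qed.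

Fact bc_scaleDr : right_distributive bc_scale +%R.
Proof. by move=> c; apply: tliftD (bc_scale_bal c). Qed.
Let bc_scale0 c : bc_scale c 0 = 0.
Proof. exact: tlift0 (bc_scale_bal c). Qed.
Fact bc_scaleA c d x : bc_scale c (bc_scale d x) = bc_scale (c * d) x.
Proof.
elim/tens_ind: x => [|u c' x ih]; first by rewrite !bc_scale0.
by rewrite !bc_scaleDr ih -/(bct _ _) !bc_scaleE mulrA.
Qed.
Fact bc_scale1 : left_id 1 bc_scale.
Proof.
move=> x; elim/tens_ind: x => [|u c' x ih]; first by rewrite bc_scale0.
by rewrite bc_scaleDr ih -/(bct _ _) bc_scaleE mul1r.
Qed.
Fact bc_scaleDl x : {morph bc_scale^~ x : c d / c + d}.
Proof.
move=> c d; elim/tens_ind: x => [|u c' x ih]; first by rewrite !bc_scale0 addr0.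
rewrite !bc_scaleDr ih addrACA; congr (_ + _).
by rewrite -!/(bct _ _) !bc_scaleE mulrDl /bct tensDr.
Qed.
HB.instance Definition _ := GRing.Zmodule_isLmodule.Build k baseChange
  bc_scaleA bc_scale1 bc_scaleDr bc_scaleDl.

Lemma bctZ c u c' : c *: bct u c' = bct u (c * c').
Proof. exact: bc_scaleE. Qed.

Lemma baseChange_scaleAl c (x y : baseChange) : c *: (x * y) = c *: x * y.
Proof.
elim/tens_ind: x => [|u d x ih]; first by rewrite !(mul0r, scaler0).
rewrite mulrDl !scalerDr mulrDl ih; congr (_ + _) => {x ih}.
elim/tens_ind: y => [|u' d' y ih]; first by rewrite !(mulr0, scaler0).
rewrite !mulrDr scalerDr ih; congr (_ + _).
by rewrite -!/(bct _ _) bctM !bctZ bctM mulrA.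
Qed.

Lemma baseChange_scaleAr c (x y : baseChange) : c *: (x * y) = x * (c *: y).
Proof.
elim/tens_ind: x => [|u d x ih]; first by rewrite !(mul0r, scaler0).
rewrite mulrDl !scalerDr mulrDl ih; congr (_ + _) => {x ih}.
elim/tens_ind: y => [|u' d' y ih]; first by rewrite !(mulr0, scaler0).
rewrite !mulrDr !scalerDr mulrDr ih; congr (_ + _).
by rewrite -!/(bct _ _) bctM !bctZ bctM mulrCA.
Qed.
End BaseChange.

(* U_k(sl_n), for a field k which is a Z[v, v^-1]-algebra through phi. *)
Section UkSl.
Variables (m : nat) (k : fieldType) (phi : {rmorphism Zv -> k}).

Definition Uk_sl : Type := baseChange phi (UZsl m).
HB.instance Definition _ := GRing.PzRing.on Uk_sl.
HB.instance Definition _ := GRing.Lmodule.on Uk_sl.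

Lemma Uk_sl_oner_neq0 : (1 : Uk_sl) != 0.
Proof.
pose b (u : UZsl m) (c : restr phi) : k := phi (MkZv (UZsl_counit u)) * c.
have bB : balanced b.
  rewrite /b; split=> [u u' c|u c c'|a u c]; rewrite ?mulrDr //.
    rewrite -mulrDl -rmorphD; congr (phi _ * _); apply/val_inj => /=.
    by rewrite UcounitE.
  rewrite restr_scaleE mulrCA mulrA -rmorphM; congr (phi _ * _); apply/val_inj => /=.
  by rewrite UcounitE.
have b1 : tlift b (1 : Uk_sl) = 1.
  rewrite (tlift_tens bB) /b mulr1 -(rmorph1 phi); congr (phi _).
  by apply/val_inj; rewrite /= UcounitE.
by apply/eqP => e; move: b1; rewrite e (tlift0 bB) => /esym/eqP; rewrite oner_eq0.
Qed.
HB.instance Definition _ := GRing.PzSemiRing_isNonZero.Build Uk_sl Uk_sl_oner_neq0.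
HB.instance Definition _ := GRing.Lmodule_isLalgebra.Build k Uk_sl
  (@baseChange_scaleAl _ _ phi (UZsl m)).
HB.instance Definition _ := GRing.Lalgebra_isAlgebra.Build k Uk_sl
  (@baseChange_scaleAr _ _ phi (UZsl m)).
End UkSl.

(* The inclusion Z[v, v^-1] -> Q(v), and the embedding of the integral q-Schur
   algebra U_Z(n, r) into U(n, r) that it induces. *)
Definition Zv_incl : {rmorphism Zv -> Qv} := val.

Definition qS_incl (n r : nat) : qSchur vZ n r -> qSchur vQ n r :=
  qS_bc Zv_incl (v := vZ) (n := n) (r := r).

(* Main.v *)
Require Import Defs.
From HB Require Import structures.
From mathcomp Require Import all_boot all_order all_algebra.
From mathcomp Require Import boolp classical_sets.
From mathcomp Require Import zify ring.

Set Implicit Arguments.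
Unset Strict Implicit.
Unset Printing Implicit Defensive.

Import GRing.Theory.
Local Open Scope ring_scope.

(* An element f of U_R(n, r) is the matrix (f(c_{i1 j1} ... c_{ir jr})) indexed by pairs
   of words, and the product is the matrix product.  Divided powers of E_h and F_h, and
   the diagonal idempotents, are explicit such matrices over any R.  They generate
   U_R(n, r): by induction on sum a_ij (i - j)^2, the dual basis element of A is a
   divided power times the dual basis element of a matrix A' of smaller spread, up to a
   unit and terms of smaller spread.  This also yields the existence of the dual basis,
   hence the explicit form of A(j, r) and of the images of the generators under zeta.
   It remains to produce the idempotents from U_Z(sl_n).  By the commutation formula for
   E_h^(a) F_h^(a), the image contains the Gaussian binomials [k; t] in the weight
   k = d_h - d_{h+1}; as k is bounded by r, integral combinations of their shifts are
   the indicators of single values of k, and since sum_i d_i = r is fixed, products of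
   these over h isolate a single weight d. *)

(** * Words and the elements moving letters *)

(** No basis theorem for A_q(n) is assumed. That the monomials c^A span comes from rewriting words;
    that they are independent is known only once dual functionals exist. Elements of U_R(n, r) are
    therefore built from functions on all words of length r, and the price is to check that such a
    function respects the relations in every context. The generation argument is run over any
    commutative ring in which v is invertible, because it is needed three times: over Q(v) to give
    [xi] a meaning, over Z[v, v^-1] to reach the integral form, and over k, where U_k(n, r) is the
    dual over k and not a tensor product. The matrices that move letters carry no normalising power
    of v. The image of a divided power is such a matrix times an invertible diagonal one, and the
    K_i themselves are not at hand in U_Z(sl_n), so the diagonal factor can be removed only after
    the weight idempotents have been found. *)

Definition cont n (s : seq 'I_n) : {ffun 'I_n -> nat} := [ffun i => count_mem i s].

Lemma cont_perm n (s t : seq 'I_n) : perm_eq s t -> cont s = cont t.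
Proof. by move=> /permP st; apply/ffunP => i; rewrite !ffunE. Qed.

Lemma cont_sum n (s : seq 'I_n) : (\sum_i cont s i)%N = size s.
Proof.
under eq_bigr => i _ do rewrite ffunE.
elim: s => [|x s ih] /=; first by rewrite big1.
rewrite big_split /= ih (bigD1 x) //= eqxx big1 ?addn0 // => i.
by rewrite eq_sym => /negPf ->.
Qed.

Section QrelFamilies.
Variables (R : comNzRingType) (v : R) (n : nat).
Notation P := ('I_n * 'I_n)%type.

Lemma qrelD (Z1 Z2 : P -> P -> R) : qrel v Z1 -> qrel v Z2 -> qrel v (fun a b => Z1 a b + Z2 a b).
Proof.
move=> [a1 a2 a3] [b1 b2 b3]; split=> *.
- by rewrite a1 b1.
- by rewrite a2 // b2 // mulrDr.
- by rewrite a3 // b3 // mulrDr addrACA.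
Qed.

Lemma qrelZ c (Z : P -> P -> R) : qrel v Z -> qrel v (fun a b => c * Z a b).
Proof.
move=> [a1 a2 a3]; split=> *.
- by rewrite a1.
- by rewrite a2 // mulrCA.
- by rewrite a3 // mulrDr mulrCA.
Qed.

(** All terms of a relation have the same multiset of column indices, so a factor that depends only
    on the content of the column word is constant along the relation. *)
Lemma qrel_contr (g : seq P -> R) (phi : {ffun 'I_n -> nat} -> R) u w :
  qrel v (fun a b => g (u ++ a :: b :: w)) ->
  qrel v (fun a b => g (u ++ a :: b :: w) * phi (cont (map snd (u ++ a :: b :: w)))).
Proof.
have E (j s i1 i2 i3 i4 : 'I_n) :
  cont (map snd (u ++ (i1, j) :: (i2, s) :: w)) = cont (map snd (u ++ (i3, s) :: (i4, j) :: w)).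
  apply: cont_perm; rewrite !map_cat /= perm_cat2l.
  by rewrite -[X in perm_eq X](cat1s j) -[X in perm_eq _ X](cat1s s) (perm_catCA [:: j] [:: s]).
move=> [a1 a2 a3]; split=> [i j s|i j k s ki js|i j k s ki sj].
- by rewrite a1 (E j s i i i i).
- by rewrite a2 // (E j s i k k i) mulrA.
- by rewrite a3 // (E j s k i k i) -(E j s i k k i) mulrDl mulrA.
Qed.
End QrelFamilies.

(* A word of pairs (i_k, j_k) stands for the matrix entry in row (i_1, ..., i_r) and
   column (j_1, ..., j_r).  Up to a diagonal factor, stepw x y c a is the a-th divided
   power of E_h or F_h acting on tensors: it turns a letters y of the column into x, with
   a factor c for each pair of an unchanged y and a changed one to its right. *)
Fixpoint stepw (R : comNzRingType) n (x y : 'I_n) (c : R) (a : nat) (s : seq ('I_n * 'I_n)) : R :=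
  if s is p :: s' then
    (p.1 == p.2)%:R * (if p.2 == y then c ^+ a else 1) * stepw x y c a s' +
    (if a is a'.+1 then (p == (x, y))%:R * stepw x y c a' s' else 0)
  else (a == 0)%:R.

Definition adjc n (i j : 'I_n) : bool := (i.+1 == j :> nat) || (j.+1 == i :> nat).

(** Two neighbouring letters use up at most two of the a changes, so a = 0, a = 1 and a >= 2 are the
    only cases; impossible combinations of the index equalities are dropped and the others left to
    [ring]. *)
Ltac step_cases a := case: a => [|[|a]]; repeat match goal with |- forall b : bool, _ => case end;
  let F := fresh "F" in move=> F; try discriminate F;
  lazy iota beta delta [andb nat_of_bool]; try ring.

Section Step.
Variables (R : comNzRingType) (v w : R) (n : nat).
Hypothesis vw : v * w = 1.
Notation P := ('I_n * 'I_n)%type.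

(** This is q for E_h and q^-1 for F_h. Carrying an inverse w of v along keeps R an arbitrary
    commutative ring. *)
Definition stepc (x y : 'I_n) : R := if (x < y)%N then v ^+ 2 else w ^+ 2.

Lemma stepw_qrel (x y : 'I_n) a u t : adjc x y ->
  qrel v (fun p p' => stepw x y (stepc x y) a (u ++ p :: p' :: t)).
Proof.
move=> xy; set c := stepc x y.
elim: u a => [|p u ih] a /=; last first.
  apply: qrelD; first exact/qrelZ/ih.
  by case: a => [|a]; [exact: qrel0|exact/qrelZ/ih].
have vw2 : v ^+ 2 * w ^+ 2 = 1 by rewrite -exprMn vw expr1n.
have xy' : x.+1 = y :> nat /\ c = v ^+ 2 \/ y.+1 = x :> nat /\ c * v ^+ 2 = 1.
  move: xy; rewrite /c /stepc /adjc => /orP[]/eqP xy; [left|right]; split=> //.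
    by rewrite -xy ltnSn.
  by rewrite -xy ltnNge leqnSn /= mulrC.
(* The relation holds for any function g of the remaining word, so the recursion can be forgotten
   and a finite check on the equalities between indices is left. *)
move: (stepw x y c) => g; move: c xy' => c xy' {xy vw2}.
have E1 (p : P) : (p == (x, y)) = (p.1 == x :> nat) && (p.2 == y :> nat).
  by case: p => p1 p2; rewrite -pair_eqE.
have adj : x.+1 = y :> nat \/ y.+1 = x :> nat by case: xy' => -[]; [left|right].
have vE (i j : 'I_n) : (i == j) = (i == j :> nat) by [].
have cV a' (z : R) : c * v ^+ 2 = 1 -> v ^+ 2 * (c ^+ a'.+1 * z) = c ^+ a' * z.
  by move=> cE; rewrite (exprS c) !mulrA [v ^+ 2 * c]mulrC cE mul1r.
split=> [i j s|i j k s ki js|i j k s ki sj]; rewrite /= ?E1 ?vE /=.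
(* The listed coincidences contradict the adjacency of x and y or the order of the indices. Once
   they are excluded, the identity holds for each remaining choice of truth values. *)
- have : ~~ [|| [&& i == j :> nat, i == x :> nat & j == y :> nat] |
     [&& i == s :> nat, i == x :> nat & s == y :> nat]].
    by clear g c E1 vE xy' cV; lia.
  move: (nat_of_ord i == j) (nat_of_ord i == s).
  move: (nat_of_ord i == x) (nat_of_ord j == y) (nat_of_ord s == y).
  by step_cases a.
- case: xy' => -[xy cE].
  + have : ~~ [|| [&& i == j :> nat & k == s :> nat], [&& i == x :> nat & k == x :> nat],
       [&& i == x :> nat, j == y :> nat & k == s :> nat] |
       [&& i == j :> nat, k == x :> nat, s == y :> nat & j != y :> nat]].
      by clear g c E1 vE cV cE; lia.
    move: (nat_of_ord i == j) (nat_of_ord k == s).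
    move: (nat_of_ord i == x) (nat_of_ord j == y) (nat_of_ord k == x) (nat_of_ord s == y).
    by step_cases a; rewrite -?cE ?(exprS c); ring.
  + have : ~~ [|| [&& i == j :> nat & k == s :> nat], [&& i == x :> nat & k == x :> nat],
       [&& i == j :> nat, k == x :> nat & s == y :> nat] |
       [&& i == x :> nat, j == y :> nat, k == s :> nat & s != y :> nat]].
      by clear g c E1 vE cV cE; lia.
    move: (nat_of_ord i == j) (nat_of_ord k == s).
    move: (nat_of_ord i == x) (nat_of_ord j == y) (nat_of_ord k == x) (nat_of_ord s == y).
    by step_cases a; rewrite !(mul1r, mul0r, add0r, addr0) cV ?expr0 ?mul1r.
- have : ~~ [|| [&& k == j :> nat & i == s :> nat], [&& i == x :> nat & k == x :> nat],
     [&& k == j :> nat, i == x :> nat & s == y :> nat], [&& k == x :> nat, j == y :> nat & i == s :> nat],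
     [&& i == j :> nat, k == x :> nat, s == y :> nat & j == y :> nat] |
     [&& i == x :> nat, j == y :> nat, k == s :> nat & s == y :> nat]].
    clear g c E1 vE xy' cV; lia.
  move: (nat_of_ord k == j) (nat_of_ord i == j) (nat_of_ord k == s) (nat_of_ord i == s).
  move: (nat_of_ord i == x) (nat_of_ord j == y) (nat_of_ord k == x) (nat_of_ord s == y).
  by step_cases a.
Qed.
End Step.

Lemma ev_qS_of (R : comNzRingType) (v : R) n r (g : seq ('I_n * 'I_n) -> R) gP s :
  size s = r -> ev (@qS_of R v n r g gP) s = g s.
Proof. by move=> sr; rewrite -[s]/(tval (Tuple (introT eqP sr))) evE qS_ofE. Qed.

(** * Functions of the weight, as diagonal elements *)

Section Diagonal.
Variables (R : comNzRingType) (v : R) (n r : nat).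
Notation P := ('I_n * 'I_n)%type.
Notation S := (qSchur v n r).
Implicit Types (phi psi : {ffun 'I_n -> nat} -> R) (f g : S) (s : seq P).

Lemma ev_mul f g s : size s = r -> ev (f * g) s =
  \sum_(T : r.-tuple 'I_n) ev f (zip (map fst s) T) * ev g (zip T (map snd s)).
Proof. exact: qS_mulE. Qed.

Lemma ev_one s : size s = r -> ev (1 : S) s = (map fst s == map snd s)%:R.
Proof. exact: qS_oneE. Qed.

(** For phi a power of v, linear in the exponent, this is the image of a monomial in the K_i; for
    phi an indicator it is a weight idempotent. *)
Definition diagw phi s : R := counit R r s * phi (cont (map snd s)).

Definition diagq phi : S :=
  qS_of r (g := diagw phi) (fun u t => qrel_contr phi (counit_qrel v r u t)).

Lemma ev_diagq phi s : size s = r ->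
  ev (diagq phi) s = (map fst s == map snd s)%:R * phi (cont (map snd s)).
Proof. by move=> sr; rewrite ev_qS_of // /diagw /counit sr eqxx. Qed.

Lemma ev_mul_diagq f phi s : size s = r ->
  ev (f * diagq phi) s = ev f s * phi (cont (map snd s)).
Proof.
move=> sr; have sz2 : size (map snd s) == r by rewrite size_map sr.
rewrite ev_mul // (bigD1 (Tuple sz2)) //= big1 => [|T TN].
  rewrite ev_diagq ?(zip_size (r := r)) ?(eqP sz2) // (map_zip1 (r := r)) ?(eqP sz2) // (map_zip2 (r := r)) ?(eqP sz2) //.
  by rewrite eqxx mul1r addr0; congr (ev _ _ * _); apply: zip_unzip.
rewrite ev_diagq ?(zip_size (r := r)) ?size_tuple ?(eqP sz2) //.
rewrite (map_zip1 (r := r)) ?size_tuple ?(eqP sz2) // (map_zip2 (r := r)) ?size_tuple ?(eqP sz2) //.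
rewrite (_ : (tval T == _) = false) ?mul0r ?mulr0 //.
by apply/negbTE; move: TN; rewrite -val_eqE.
Qed.

Lemma ev_diagq_mul f phi s : size s = r ->
  ev (diagq phi * f) s = phi (cont (map fst s)) * ev f s.
Proof.
move=> sr; have sz1 : size (map fst s) == r by rewrite size_map sr.
rewrite ev_mul // (bigD1 (Tuple sz1)) //= big1 => [|T TN].
  rewrite ev_diagq ?(zip_size (r := r)) ?(eqP sz1) // (map_zip1 (r := r)) ?(eqP sz1) // (map_zip2 (r := r)) ?(eqP sz1) //.
  by rewrite eqxx mul1r addr0; congr (_ * ev _ _); apply: zip_unzip.
rewrite ev_diagq ?(zip_size (r := r)) ?size_tuple ?(eqP sz1) //.
rewrite (map_zip1 (r := r)) ?size_tuple ?(eqP sz1) // (map_zip2 (r := r)) ?size_tuple ?(eqP sz1) //.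
rewrite eq_sym (_ : (tval T == _) = false) ?mul0r //.
by apply/negbTE; move: TN; rewrite -val_eqE.
Qed.

Lemma eq_diagq phi psi : (forall mu : {ffun _}, (\sum_i mu i)%N = r -> phi mu = psi mu) ->
  diagq phi = diagq psi.
Proof.
move=> e; apply: qS_ext => s sr; rewrite !ev_diagq // e //.
by rewrite cont_sum size_map.
Qed.

Lemma diagqM phi psi : diagq phi * diagq psi = diagq (fun mu => phi mu * psi mu).
Proof. by apply: qS_ext => s sr; rewrite ev_mul_diagq // !ev_diagq // mulrA. Qed.

Lemma diagq1 : diagq (fun=> 1) = 1.
Proof. by apply: qS_ext => s sr; rewrite ev_diagq // ev_one // mulr1. Qed.

Lemma diagqD phi psi : diagq phi + diagq psi = diagq (fun mu => phi mu + psi mu).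
Proof. by apply: qS_ext => s sr; rewrite evD !ev_diagq // mulrDr. Qed.

Lemma diagqZ c phi : c *: diagq phi = diagq (fun mu => c * phi mu).
Proof. by apply: qS_ext => s sr; rewrite evZ !ev_diagq // mulrCA. Qed.

Lemma diagq0 : diagq (fun=> 0) = 0.
Proof. by apply: (addrI (diagq (fun=> 0))); rewrite diagqD !addr0. Qed.

Lemma diagqN phi : - diagq phi = diagq (fun mu => - phi mu).
Proof.
by rewrite -scaleN1r diagqZ; apply: eq_diagq => mu _; rewrite mulN1r.
Qed.
End Diagonal.

(** * Products of the elements that move letters *)

Section StepElements.
Variables (R : comNzRingType) (v w : R) (n r : nat).
Hypothesis vw : v * w = 1.
Notation P := ('I_n * 'I_n)%type.
Notation S := (qSchur v n r).

Definition stepq x y (xy : adjc x y) a : S :=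
  qS_of r (fun u t => stepw_qrel vw a u t xy).

Lemma ev_stepq x y (xy : adjc x y) a s : size s = r ->
  ev (stepq xy a) s = stepw x y (stepc v w x y) a s.
Proof. exact: ev_qS_of. Qed.

Lemma stepw0 x y (c : R) (s : seq P) : stepw x y c 0 s = (map fst s == map snd s)%:R.
Proof.
elim: s => [|[i j] s ih] //=; rewrite ih eqseq_cons addr0 expr0.
by case: (i == j); rewrite ?mul0r // mul1r; case: (j == y); rewrite mul1r.
Qed.

Lemma stepq0 x y (xy : adjc x y) : stepq xy 0 = 1.
Proof. by apply: qS_ext => s sr; rewrite ev_stepq // ev_one // stepw0. Qed.

(** The quantum integer in its unsymmetrised form, which needs no division: for c = v^2 or v^-2 it
    is [a] up to a power of v. *)
Definition geom (c : R) a : R := \sum_(i < a) c ^+ i.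

(** Of the a + 1 changed letters, the left factor changes one and the right factor the others. For
    the right factor the chosen letter is an unchanged y, so it contributes c for each changed
    letter to its right; summing over the choice gives the geometric sum. *)
Lemma stepw_mul x y (c : R) a (s : seq P) : x != y ->
  tsum (size s) (fun T => stepw x y c 1 (zip (map fst s) T) * stepw x y c a (zip T (map snd s))) =
  geom c a.+1 * stepw x y c a.+1 s.
Proof.
move=> xy; elim: s a => [|[i j] s ih] a; first by rewrite tsum0 /= mul0r mulr0.
have M0 a' : tsum (size s) (fun T => stepw x y c 0 (zip (map fst s) T) *
      stepw x y c a' (zip T (map snd s))) = stepw x y c a' s.
  have sz : size (map fst s) == size s by rewrite size_map.
  rewrite /tsum (bigD1 (Tuple sz)) //= big1 => [|T TN].
    rewrite addr0 stepw0 /= -/(unzip1 _) -/(unzip2 _) unzip1_zip ?unzip2_zip ?size_map //.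
    by rewrite eqxx mul1r zip_unzip.
  rewrite stepw0 -/(unzip1 _) -/(unzip2 _) unzip1_zip ?unzip2_zip ?size_map ?size_tuple //.
  rewrite -/(unzip1 _) eq_sym (_ : (tval T == _) = false) ?mul0r //.
  by apply/negbTE; move: TN; rewrite -val_eqE.
rewrite tsumS /=.
pose A t (T : seq 'I_n) := stepw x y c t (zip (map fst s) T).
pose B t (T : seq 'I_n) := stepw x y c t (zip T (map snd s)).
pose B' T : R := if a is a'.+1 then B a' T else 0.
pose k (t : 'I_n) : R := if t == y then c else 1.
(* The head letter is kept by both factors, changed by the right one, changed by the left one, or
   changed by both; the last case is void because x and y differ. *)
have E T t : stepw x y c 1 ((i, t) :: zip (map fst s) T) * stepw x y c a ((t, j) :: zip T (map snd s)) =
    (i == t)%:R * k t * (t == j)%:R * k j ^+ a * (A 1%N T * B a T)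
    + (i == t)%:R * k t * ((t, j) == (x, y))%:R * (A 1%N T * B' T)
    + ((i, t) == (x, y))%:R * (t == j)%:R * k j ^+ a * (A 0%N T * B a T)
    + ((i, t) == (x, y))%:R * ((t, j) == (x, y))%:R * (A 0%N T * B' T).
  rewrite /= -/(A 0%N T) -/(A 1%N T) -/(B a T) expr1 -/(k t).
  have -> : (if j == y then c ^+ a else 1) = k j ^+ a.
    by rewrite /k; case: ifP => // _; rewrite expr1n.
  by rewrite /B'; case: a {B'} => [|a']; rewrite -?/(B a' T); ring.
have M1 : tsum (size s) (fun T => A 1%N T * B' T) = geom c a * stepw x y c a s.
  rewrite /B'; case: a {B' E} => [|a'] /=; last exact: ih.
  by rewrite /geom big_ord0 mul0r /tsum big1 // => T _; rewrite mulr0.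
have Et t : tsum (size s) (fun T => stepw x y c 1 ((i, t) :: zip (map fst s) T) *
      stepw x y c a ((t, j) :: zip T (map snd s))) =
    (i == t)%:R * (k t * (t == j)%:R * k j ^+ a * (geom c a.+1 * stepw x y c a.+1 s)
      + k t * ((t, j) == (x, y))%:R * (geom c a * stepw x y c a s))
    + ((i, t) == (x, y))%:R * ((t == j)%:R * k j ^+ a * stepw x y c a s).
  have q0 : ((i, t) == (x, y))%:R * ((t, j) == (x, y))%:R = 0 :> R.
    rewrite -!pair_eqE /=; case: (t =P y) => [->|]; last by rewrite andbF mul0r.
    by rewrite (eq_sym y x) (negPf xy) mulr0.
  rewrite -ih -M1 -M0 -/(tsum _ _) /tsum mulrDr !mulrA !mulr_sumr -!big_split.
  by apply: eq_bigr => T _; rewrite E q0 mul0r addr0 !mulrA.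
rewrite (eq_bigr _ (fun t _ => Et t)) big_split /= (bigD1 i) //= eqxx mul1r.
rewrite big1 ?addr0 => [|t /negPf it]; last by rewrite eq_sym it mul0r.
rewrite (bigD1 y) //= big1 ?addr0 => [|t /negPf ty]; last first.
  by rewrite -pair_eqE /= ty andbF mul0r.
have -> : geom c a.+1 = geom c a + c ^+ a by rewrite /geom big_ord_recr.
have -> : (if j == y then c ^+ a.+1 else 1) = k j ^+ a.+1.
  by rewrite /k; case: ifP => // _; rewrite expr1n.
rewrite -!pair_eqE /= eqxx andbT.
have -> : k i * (i == j)%:R * k j ^+ a = (i == j)%:R * k j ^+ a.+1.
  by case: (i =P j) => [->|]; rewrite ?mulr1 ?mulr0 ?mul0r ?mul1r ?exprS.
have -> : k i * ((i == x) && (j == y))%:R = ((i == x) && (j == y))%:R.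
  by case: (i =P x) => [->|]; rewrite /k ?(negPf xy) ?mul1r // mulr0.
have -> : (i == x)%:R * ((y == j)%:R * k j ^+ a * stepw x y c a s) =
    ((i == x) && (j == y))%:R * (c ^+ a * stepw x y c a s).
  by rewrite (eq_sym y j) /k; case: (i == x) (j == y) => [] []; rewrite ?mul0r ?mul1r.
ring.
Qed.

Lemma adjc_neq (x y : 'I_n) : adjc x y -> x != y.
Proof. by move=> xy; apply/eqP => e; move: xy; rewrite /adjc e; lia. Qed.

Lemma stepq_mul x y (xy : adjc x y) a :
  stepq xy 1 * stepq xy a = geom (stepc v w x y) a.+1 *: stepq xy a.+1.
Proof.
apply: qS_ext => s sr; rewrite ev_mul // evZ ev_stepq // -stepw_mul ?adjc_neq //.
rewrite sr; apply: eq_bigr => T _; rewrite !ev_stepq //.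
  by rewrite (zip_size (r := r)) ?size_tuple ?size_map.
by rewrite (zip_size (r := r)) ?size_tuple ?size_map.
Qed.

Lemma stepw_cont x y c a (s : seq P) i : x != y -> stepw x y c a s != 0 :> R ->
  (cont (map fst s) i + a * (i == y) = cont (map snd s) i + a * (i == x))%N.
Proof.
move=> xy; elim: s a => [|[p q] s ih] a.
  by case: a => [|a]; rewrite /= ?eqxx // !ffunE /= !mul0n.
have cC (z : 'I_n) (l : seq 'I_n) : cont (z :: l) i = ((z == i) + cont l i)%N by rewrite !ffunE.
rewrite /= !cC => nz.
have [pq|pq] : p = q /\ stepw x y c a s != 0 \/
    p = x /\ q = y /\ exists2 a', a = a'.+1 & stepw x y c a' s != 0.
- have [e1|e1] := eqVneq (stepw x y c a s) 0.
    right; move: nz; rewrite e1 mulr0 add0r; case: a e1 => [|a'] _; first by rewrite eqxx.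
    rewrite -pair_eqE /=; case: (p =P x) => [->|]; last by rewrite mul0r eqxx.
    case: (q =P y) => [->|]; last by rewrite mul0r eqxx.
    by rewrite mul1r => nz; split=> //; split=> //; exists a'.
  have [->|pq] := eqVneq p q; first by left.
  right; move: nz; rewrite (negPf pq) !mul0r add0r; case: a {e1} => [|a']; first by rewrite eqxx.
  rewrite -pair_eqE /=; case: (p =P x) => [->|]; last by rewrite mul0r eqxx.
  case: (q =P y) => [->|]; last by rewrite mul0r eqxx.
  by rewrite mul1r => nz; split=> //; split=> //; exists a'.
- by case: pq => <- /ih; lia.
case: pq => -> [-> [a' -> /ih]]; rewrite !mulSn (eq_sym x i) (eq_sym y i).
move: (cont (map fst s) i) (cont (map snd s) i) (a' * (i == y))%N (a' * (i == x))%N.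
by move: (nat_of_bool (i == x)) (nat_of_bool (i == y)) => b1 b2 c1 c2 d1 d2; lia.
Qed.

(** The truncated subtraction is harmless: if the column word has fewer than a letters y, the value
    of [stepw] is 0. *)
Definition shiftc (x y : 'I_n) (a : nat) (mu : {ffun 'I_n -> nat}) : {ffun 'I_n -> nat} :=
  [ffun i => (mu i + a * (i == x) - a * (i == y))%N].

Lemma diagq_step x y (xy : adjc x y) a phi :
  diagq v r phi * stepq xy a = stepq xy a * diagq v r (fun mu => phi (shiftc x y a mu)).
Proof.
apply: qS_ext => s sr; rewrite ev_diagq_mul // ev_mul_diagq // ev_stepq // mulrC.
have [->|nz] := eqVneq (stepw x y (stepc v w x y) a s) 0; first by rewrite !mul0r.
congr (_ * phi _); apply/ffunP => i; rewrite [RHS]ffunE.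
by rewrite -(stepw_cont i (adjc_neq xy) nz) addnK.
Qed.
End StepElements.

(** * Sorted words determine an element of the q-Schur algebra *)

Lemma not_sorted_split (T : Type) (e : rel T) s : ~~ sorted e s ->
  exists u a b w, s = u ++ a :: b :: w /\ ~~ e a b.
Proof.
case: s => [//|x s]; elim: s x => [//|y s ih] x /=; rewrite negb_and.
case/orP => [xy|/ih [u [a [b [w [-> ab]]]]]]; first by exists [::], x, y, s.
by exists (x :: u), a, b, w.
Qed.

Lemma pairwise_flatten_nseq (T : Type) (e : rel T) (k : T -> nat) (s : seq T) :
  reflexive e -> pairwise e s -> pairwise e (flatten [seq nseq (k x) x | x <- s]).
Proof.
move=> er; elim: s => [//|x s ih] /= /andP[xs /ih es].
rewrite pairwise_cat es andbT; apply/andP; split; last first.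
  by elim: (k x) => [//|k' ih'] /=; rewrite ih' andbT all_nseq er orbT.
rewrite /allrel all_nseq; apply/orP; right; elim: s xs {ih es} => [//|y s ih] /= /andP[xy xs].
by rewrite /= all_cat; apply/andP; split; [rewrite all_nseq xy orbT|exact: ih].
Qed.

Section Words.
Variable n : nat.
Notation P := ('I_n * 'I_n)%type.
Implicit Types (s : seq P) (A B : 'M[nat]_n).

(* The order of the factors of c^A. *)
Definition lexle : rel P := fun p q => (p.2 < q.2)%N || ((p.2 == q.2) && (p.1 <= q.1)%N).

Lemma lexle_refl : reflexive lexle.
Proof. by move=> p; rewrite /lexle eqxx leqnn orbT. Qed.

Lemma lexle_trans : transitive lexle.
Proof.
move=> [i j] [k l] [p q]; rewrite /lexle /= -!val_eqE /=; lia.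
Qed.

Lemma lexle_anti : antisymmetric lexle.
Proof.
move=> [i j] [k l]; rewrite /lexle /= -!val_eqE /= => h.
by congr (_, _); apply: val_inj; move: h => /=; lia.
Qed.

Definition lexpairs : seq P := [seq (i, j) | j <- enum 'I_n, i <- enum 'I_n].

Definition wordof B : seq P := flatten [seq nseq (B p.1 p.2) p | p <- lexpairs].

Definition cntmx s : 'M[nat]_n := \matrix_(i, j) count_mem (i, j) s.

Lemma lexpairs_pairwise : pairwise lexle lexpairs.
Proof.
have : pairwise (fun i j : 'I_n => (i < j)%N) (enum 'I_n).
  by rewrite -(pairwise_map val ltn) val_enum_ord -sorted_pairwise ?iota_ltn_sorted //; exact: ltn_trans.
rewrite /lexpairs; move: {1 3}(enum 'I_n) => t; elim: t => [//|j t ih] /= /andP[jt /ih et].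
rewrite pairwise_cat et andbT; apply/andP; split; last first.
  rewrite pairwise_map; apply: (@sub_pairwise _ (fun i k : 'I_n => (i < k)%N)).
    by move=> i k ik; rewrite /= /lexle /= eqxx (ltnW ik) orbT.
  by rewrite -(pairwise_map val ltn) val_enum_ord -sorted_pairwise ?iota_ltn_sorted //; exact: ltn_trans.
apply/allrelP => [[i k] [i' k'] /mapP[x _ [-> ->]] /allpairsP[[y z] [/= yt _ [-> ->]]]].
by rewrite /lexle /= (allP jt).
Qed.

Lemma wordof_sorted B : sorted lexle (wordof B).
Proof.
rewrite sorted_pairwise; last exact: lexle_trans.
exact: pairwise_flatten_nseq lexle_refl lexpairs_pairwise.
Qed.

Lemma lexpairs_uniq : uniq lexpairs.
Proof.
apply: allpairs_uniq; rewrite ?enum_uniq //.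
by move=> [a b] [c d] _ _ /= [-> ->].
Qed.

Lemma mem_lexpairs p : p \in lexpairs.
Proof.
by case: p => i j; apply/allpairsP; exists (j, i); rewrite !mem_enum.
Qed.

Lemma count_wordof p B : count_mem p (wordof B) = B p.1 p.2.
Proof.
rewrite /wordof count_flatten -map_comp sumnE big_map.
rewrite (bigD1_seq p) ?mem_lexpairs ?lexpairs_uniq //= count_nseq /= eqxx mul1n.
by rewrite big1 ?addn0 // => q /negPf qp; rewrite count_nseq /= qp.
Qed.

Lemma cntmxK B : cntmx (wordof B) = B.
Proof. by apply/matrixP => i j; rewrite mxE count_wordof. Qed.

Lemma cntmx_perm s t : perm_eq s t -> cntmx s = cntmx t.
Proof. by move=> /permP st; apply/matrixP => i j; rewrite !mxE. Qed.

Lemma wordofK s : sorted lexle s -> wordof (cntmx s) = s.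
Proof.
move=> ss; apply: (sorted_eq lexle_trans lexle_anti) => //; first exact: wordof_sorted.
by apply/allP => p _; rewrite /= count_wordof mxE -surjective_pairing.
Qed.

Lemma mxtotal_cntmx s : mxtotal (cntmx s) = size s.
Proof.
rewrite /mxtotal pair_big /=; under eq_bigr => p _ do rewrite mxE -surjective_pairing.
elim: s => [|x s ih] /=; first by rewrite big1.
rewrite big_split /= ih (bigD1 x) //= eqxx big1 ?addn0 // => p.
by rewrite eq_sym => /negPf ->.
Qed.

Lemma size_wordof B : size (wordof B) = mxtotal B.
Proof. by rewrite -mxtotal_cntmx cntmxK. Qed.

Lemma cmonE (R : comNzRingType) (v : R) B : cmon v B = cword v (wordof B).
Proof.
have enumE : enum 'I_n = index_enum 'I_n by rewrite enumT [index_enum _]unlock.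
rewrite /cmon /cword /wordof big_flatten big_map /= big_allpairs_dep /= enumE.
apply: eq_bigr => j _; apply: eq_bigr => i _.
by rewrite big_nseq iter_mulr_1.
Qed.

(* Drops under every rewriting step of A_q(n) that sorts a word. *)
Fixpoint disorder s : nat :=
  if s is p :: s' then ((p.2 * n + p.1) * size s' + disorder s')%N else 0%N.

(** Exchanging two neighbours, or only their columns, preserves the sum of their codes j * n + i,
    and in [disorder] the left one counts once more than the right one. So only the left code
    matters. *)
Lemma disorder_swap u (a b a' b' : P) w :
  (a'.2 * n + a'.1 + (b'.2 * n + b'.1) = a.2 * n + a.1 + (b.2 * n + b.1))%N ->
  (a'.2 * n + a'.1 < a.2 * n + a.1)%N ->
  (disorder (u ++ a' :: b' :: w) < disorder (u ++ a :: b :: w))%N.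
Proof.
move=> e l; elim: u => [|x u ih] /=; last by rewrite !size_cat /= ltn_add2l.
move: (a.2 * n + a.1)%N (b.2 * n + b.1)%N (a'.2 * n + a'.1)%N (b'.2 * n + b'.1)%N e l.
by move=> ca cb ca' cb' e l; nia.
Qed.
End Words.

Section Reduction.
Variables (R : comNzRingType) (v w : R) (n r : nat).
Hypothesis vw : v * w = 1.
Notation P := ('I_n * 'I_n)%type.
Notation S := (qSchur v n r).
Implicit Types (f g : S) (s : seq P).

Lemma sqr_vw : v ^+ 2 * w ^+ 2 = 1. Proof. by rewrite -exprMn vw expr1n. Qed.

(** Each violation of the order is rewritten into words of smaller disorder. The pair (i, j)(k, l)
    with i < k and l < j stands on the right of its relation with coefficient q, which is where q
    has to be invertible. *)
Lemma qS_eq0_wordof f : (forall B, mxtotal B = r -> ev f (wordof B) = 0) -> f = 0.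
Proof.
move=> f0; apply: qS_ext => s sr; rewrite [RHS](_ : _ = 0); last by rewrite -(scale0r f) evZ mul0r.
have [d] := ubnP (disorder s); elim: d s sr => // d ih s sr lt_d.
have [ss|/not_sorted_split[u [[i j] [[k l] [t [sE nle]]]]]] := boolP (sorted (@lexle n) s).
  by rewrite -(wordofK ss) f0 // mxtotal_cntmx.
have sz (a b : P) : size (u ++ a :: b :: t) = r by rewrite -sr sE !size_cat.
have step (a' b' : P) : (a'.2 * n + a'.1 + (b'.2 * n + b'.1) = j * n + i + (l * n + k))%N ->
  (a'.2 * n + a'.1 < j * n + i)%N -> ev f (u ++ a' :: b' :: t) = 0.
  move=> e1 e2; apply: ih => //; have := disorder_swap u t (a := (i, j)) (b := (k, l)) e1 e2.
  rewrite -sE; move: lt_d; lia.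
have /(ev_qrel f)[f1 f2 f3] : (size u + 2 + size t)%N = r.
  by rewrite -sr sE size_cat /= -addnA.
move: nle; rewrite /lexle /= negb_or negb_and -!leqNgt => /andP[lj jik].
have [ln kn jn iN] := And4 (ltn_ord l) (ltn_ord k) (ltn_ord j) (ltn_ord i).
rewrite sE; case: (ltngtP l j) lj jik => // [lj _ _|/val_inj lj _ /=].
- case: (ltngtP k i) => [ki|ik|/val_inj ki].
  + rewrite f3 // (step (k, l) (i, j)) ?addr0 /=; [|lia|nia].
    have := f2 i l k j ki (ltnW lj); rewrite (step (i, l) (k, j)) /=; [|lia|nia].
    move/esym/(congr1 (fun z => w ^+ 2 * z)).
    by rewrite mulr0 mulrA [w ^+ 2 * _]mulrC sqr_vw mul1r => ->; rewrite mulr0.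
  + have := f2 k l i j ik (ltnW lj); rewrite (step (k, l) (i, j)) /=; [|lia|nia].
    move/esym/(congr1 (fun z => w ^+ 2 * z)).
    by rewrite mulr0 mulrA [w ^+ 2 * _]mulrC sqr_vw mul1r.
  + by subst k; rewrite f1 step //=; nia.
- subst l; rewrite eqxx /= -ltnNge => ki; rewrite f2 // step ?mulr0 //=; lia.
Qed.

Lemma qS_ext_wordof f g :
  (forall B, mxtotal B = r -> ev f (wordof B) = ev g (wordof B)) -> f = g.
Proof.
move=> fg; apply/eqP; rewrite -subr_eq0; apply/eqP/qS_eq0_wordof => B Br.
by rewrite evD -scaleN1r evZ fg // mulN1r subrr.
Qed.

(** Two letters of one column only q-commute, with no second term. Sorting the rows inside the
    columns therefore costs a power of q that is the same for all functionals. *)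
Lemma ev_colsorted s : size s = r -> sorted leq (map (fun p : P => nat_of_ord p.2) s) ->
  exists c c', c * c' = 1 /\ forall f, ev f s = c * ev f (wordof (cntmx s)).
Proof.
have [d] := ubnP (disorder s); elim: d s => // d ih s lt_d sr ss.
have [ls|/not_sorted_split[u [[i j] [[k l] [t [sE nle]]]]]] := boolP (sorted (@lexle n) s).
  by exists 1, 1; split=> [|f]; rewrite ?mulr1 // mul1r wordofK.
have [jl ki] : j = l /\ (k < i)%N.
  move: nle; rewrite /lexle /= negb_or negb_and -!leqNgt => /andP[lj].
  have jl : (j <= l)%N.
    move: ss; rewrite sE map_cat sorted_pairwise; last exact: leq_trans.
    by rewrite pairwise_cat /= => /and3P[_ _ /andP[/andP[]]].
  have -> : j = l by apply/val_inj/anti_leq; rewrite jl.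
  by rewrite eqxx /= -ltnNge.
case: l / jl sE nle => sE _.
set s' := u ++ (k, j) :: (i, j) :: t.
have ps : perm_eq s s' by rewrite sE /s' perm_cat2l (perm_catCA [:: (i, j)] [:: (k, j)]).
have [|||c [c' [cc' fE]]] := ih s'.
- rewrite -ltnS; apply: leq_trans lt_d; rewrite ltnS sE; apply: disorder_swap => /=; lia.
- by rewrite -(perm_size ps).
- by move: ss; rewrite sE !map_cat.
exists (v ^+ 2 * c), (c' * w ^+ 2); split=> [|f].
  by rewrite mulrA -(mulrA (v ^+ 2)) cc' mulr1 sqr_vw.
have /(ev_qrel f)[_ f2 _] : (size u + 2 + size t)%N = r.
  by rewrite -sr sE size_cat /= -addnA.
by rewrite (cntmx_perm ps) sE f2 // -/s' fE mulrA.
Qed.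
End Reduction.

(** * The spread of a matrix *)

Section Rank.
Variable n : nat.
Notation P := ('I_n * 'I_n)%type.
Implicit Types (i j x y : 'I_n) (A B : 'M[nat]_n) (s : seq P).

Definition odist i j : nat := (i - j + (j - i))%N.

Definition spread A : nat := (\sum_i \sum_j A i j * odist i j ^ 2)%N.

Definition nearer x y j : bool := (odist y j < odist x j)%N.

Definition move1 x y (p : P) : P := if (p.1 == x) && nearer x y p.2 then (y, p.2) else p.

(** The matrix A' of the induction: every letter of row x whose column is nearer to y goes to row y,
    and a step element brings it back. *)
Definition moved x y A : 'M[nat]_n := cntmx (map (move1 x y) (wordof A)).

Definition movable x y A j : nat := if nearer x y j then A x j else 0%N.

Lemma nearerE x y j : adjc x y -> nearer x y j -> odist x j = (odist y j).+1.
Proof. rewrite /adjc /nearer /odist; lia. Qed.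

Lemma nearerNE x y j : adjc x y -> ~~ nearer x y j -> odist y j = (odist x j).+1.
Proof. rewrite /adjc /nearer /odist; lia. Qed.

Lemma odist_adjc x y : adjc x y -> odist x y = 1%N.
Proof. rewrite /adjc /odist; lia. Qed.

(** In column j, tau j letters go from row x to row y and t j letters go back; the entries are
    natural numbers, hence the subtraction-free form. *)
Lemma spread_move x y A B (t tau : 'I_n -> nat) :
  (forall i j, B i j + tau j * (i == x) + t j * (i == y) =
               A i j + t j * (i == x) + tau j * (i == y))%N ->
  (spread B + \sum_j (tau j * odist x j ^ 2 + t j * odist y j ^ 2) =
   spread A + \sum_j (t j * odist x j ^ 2 + tau j * odist y j ^ 2))%N.
Proof.
move=> AB.
have E (C : 'M[nat]_n) (f g : 'I_n -> nat) : (spread C + \sum_j (f j * odist x j ^ 2 + g j * odist y j ^ 2) =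
    \sum_i \sum_j (C i j + f j * (i == x) + g j * (i == y)) * odist i j ^ 2)%N.
  have S1 z (h : 'I_n -> nat) : (\sum_j h j * odist z j ^ 2 =
      \sum_i \sum_j h j * (i == z) * odist i j ^ 2)%N.
    rewrite exchange_big /=; apply: eq_bigr => j _; rewrite (bigD1 z) //= eqxx muln1.
    by rewrite big1 ?addn0 // => i /negPf ->; rewrite muln0.
  rewrite big_split /= !S1 addnA -!big_split; apply: eq_bigr => i _ /=.
  by rewrite -!big_split; apply: eq_bigr => j _ /=; rewrite !mulnDl.
by rewrite !E; apply: eq_bigr => i _; apply: eq_bigr => j _; rewrite AB.
Qed.

Lemma movedE x y A i j :
  (moved x y A i j + movable x y A j * (i == x) = A i j + movable x y A j * (i == y))%N.
Proof.
rewrite /moved mxE /movable -{2 3 4}(cntmxK A) !mxE.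
elim: (wordof A) => [|[k l] s ih] /=; first by case: ifP; rewrite !mul0n.
have -> : (if nearer x y j then ((k, l) == (x, j)) + count_mem (x, j) s else 0)%N =
    ([&& nearer x y l, k == x & l == j] +
     if nearer x y j then count_mem (x, j) s else 0)%N.
  rewrite -pair_eqE /=; case: (l =P j) => [->|_]; last by rewrite !andbF.
  by rewrite andbT; case: (nearer x y j); rewrite ?add0n ?andbF.
have -> : ((move1 x y (k, l) == (i, j)) =
    if nearer x y l && (k == x) then (i == y) && (l == j) else (i == k) && (l == j) :> bool).
  rewrite /move1 /= andbC; case: ifP => _; rewrite -pair_eqE /=; congr (_ && _); exact: eq_sym.
rewrite xpair_eqE !mulnDl -!addnA.
have kE : ((if nearer x y l && (k == x) then (i == y) && (l == j) else (i == k) && (l == j) : bool)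
   + [&& nearer x y l, k == x & l == j] * (i == x) =
   ((k == i) && (l == j)) + [&& nearer x y l, k == x & l == j] * (i == y))%N.
  rewrite (eq_sym k i); case: (k =P x) => [->|_]; last by rewrite !andbF.
  by case: (nearer x y l) (l == j) (i == x) (i == y) => [] [] [] [].
have addACA' a b c d : (a + (b + (c + d)) = (a + c) + (b + d))%N by lia.
by rewrite [LHS]addACA' [RHS]addACA' kE ih.
Qed.

Lemma mxtotal_moved x y A : mxtotal (moved x y A) = mxtotal A.
Proof. by rewrite mxtotal_cntmx size_map size_wordof. Qed.

Lemma moved_nearer x y A j : x != y -> nearer x y j -> moved x y A x j = 0%N.
Proof.
move=> xy kj; have := movedE x y A x j.
by rewrite eqxx (negPf xy) /movable kj muln1 muln0; lia.
Qed.

Lemma spread_moved x y A : adjc x y -> (0 < \sum_j movable x y A j)%N ->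
  (spread (moved x y A) < spread A)%N.
Proof.
move=> xy; have e0 i j : (moved x y A i j + movable x y A j * (i == x) + 0 * (i == y) =
    A i j + 0 * (i == x) + movable x y A j * (i == y))%N by rewrite !mul0n !addn0 movedE.
have := spread_move (t := fun=> 0%N) (tau := movable x y A) e0.
under eq_bigr do rewrite mul0n addn0.
under [in RHS]eq_bigr do rewrite mul0n add0n.
move=> e pos.
suff : (\sum_j movable x y A j * odist y j ^ 2 + \sum_j movable x y A j <=
        \sum_j movable x y A j * odist x j ^ 2)%N by lia.
rewrite -big_split; apply: leq_sum => j _ /=; rewrite /movable.
by case: ifP => // /(nearerE xy) ->; nia.
Qed.

(* Since (i - j)^2 is convex, moving the letters in the columns nearer to y than to x is
   the unique way of moving that many letters which maximises the spread. *)
Lemma spread_lt x y A B (t : 'I_n -> nat) : adjc x y ->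
  (forall j, nearer x y j -> j != y -> A y j = 0%N) ->
  (\sum_j t j = \sum_j movable x y A j)%N ->
  (forall i j, B i j + t j * (i == y) = moved x y A i j + t j * (i == x))%N ->
  B <> A -> (spread B < spread A)%N.
Proof.
move=> xy A0 st BE BA; have nxy : x != y := adjc_neq xy.
have BE' i j : (B i j + movable x y A j * (i == x) + t j * (i == y) =
    A i j + t j * (i == x) + movable x y A j * (i == y))%N.
  have := BE i j; have := movedE x y A i j.
  move: (movable x y A j * (i == x))%N (t j * (i == y))%N (t j * (i == x))%N
    (movable x y A j * (i == y))%N (moved x y A i j) => c1 c2 c3 c4 c5; lia.
have tle j : nearer x y j -> j != y -> (t j <= movable x y A j)%N.
  move=> kj jy; have := BE y j; have := movedE x y A y j.
  by rewrite eqxx eq_sym (negPf nxy) !muln0 (A0 j kj jy); lia.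
have tge j : ~~ nearer x y j -> movable x y A j = 0%N by rewrite /movable => /negPf ->.
have dE j : j != y -> odist y j != 0%N.
  by rewrite /odist -val_eqE /= => ?; apply/eqP; lia.
have ky : (odist x y = 1%N) /\ (odist y y = 0%N).
  by rewrite (odist_adjc xy) /odist subnn.
(* The linear terms cancel in the sum over j, since t and [movable] have the same total. They are
   added to make column y, where nothing bounds t, an equality. *)
have le j : (t j * odist x j ^ 2 + movable x y A j * odist y j ^ 2 + movable x y A j +
    ((j != y) && (t j != movable x y A j)) <=
    movable x y A j * odist x j ^ 2 + t j * odist y j ^ 2 + t j)%N.
  have [->|jy] := eqVneq j y; first by rewrite !ky.1 !ky.2 /=; lia.
  have := dE j jy; have [kj|kj] := boolP (nearer x y j).
    have := tle j kj jy; rewrite (nearerE xy kj).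
    by move: (odist y j) (t j) (movable x y A j) => d a b; case: eqP => /=; nia.
  rewrite (tge j kj) (nearerNE xy kj).
  by move: (odist x j) (t j) => d a; case: eqP => /=; nia.
have [/eqP e|neq] := boolP [forall j, (j != y) ==> (t j == movable x y A j)].
  case: BA; have te j : t j = movable x y A j.
    have [->|jy] := eqVneq j y; last by move: e => /eqP/forallP/(_ j); rewrite jy => /eqP.
    move: st; rewrite (bigD1 y) //= [RHS](bigD1 y) //= => st; apply/eqP.
    rewrite -(eqn_add2r (\sum_(i | i != y) t i)%N) st; apply/eqP; congr (_ + _)%N.
    by apply: eq_bigr => i iy; move: e => /eqP/forallP/(_ i); rewrite iy => /eqP.
  apply/matrixP => i j; have := BE' i j; rewrite te.
  by move: (movable x y A j * (i == x))%N (movable x y A j * (i == y))%N => c1 c2; lia.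
have := spread_move BE'; set S1 := (\sum_j _)%N; set S2 := (\sum_j _)%N => rE.
suff : (S2 + (\sum_j movable x y A j) + 1 <= S1 + \sum_j t j)%N by rewrite st; lia.
rewrite /S1 /S2 -!big_split /=.
have [j] : exists j, (j != y) && (t j != movable x y A j).
  by move: neq; rewrite negb_forall => /existsP[j]; rewrite negb_imply; exists j.
move=> hj; apply: leq_trans (leq_sum _ (fun j _ => le j)).
by rewrite [X in (_ <= X)%N]big_split /= leq_add2l (bigD1 j) //= hj leq_addr.
Qed.

(** Take for x the last row with an entry to the right of the diagonal and y = x + 1: row y then has
    no such entry, which is the second condition. If no row has one, the first row with an entry to
    the left of the diagonal and y = x - 1 serve in the same way. *)
Lemma movable_exists A : (forall i j, i != j -> A i j = 0%N) \/
  exists x y, [/\ adjc x y, forall j, nearer x y j -> j != y -> A y j = 0%N &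
                  (0 < \sum_j movable x y A j)%N].
Proof.
pose up (i : 'I_n) := [exists j : 'I_n, (i < j)%N && (A i j != 0%N)].
pose dn (i : 'I_n) := [exists j : 'I_n, (j < i)%N && (A i j != 0%N)].
have pos x y (j : 'I_n) : nearer x y j -> A x j != 0%N -> (0 < \sum_j movable x y A j)%N.
  by move=> kj nz; rewrite (bigD1 j) //= /movable kj; lia.
case: (pickP up) => [i0 up0|noup].
  right; case: (arg_maxnP (fun i : 'I_n => val i) up0) => i /existsP[j /andP[ij nz]] imax.
  have yn : (i.+1 < n)%N by apply: leq_ltn_trans (ltn_ord j).
  exists i, (Ordinal yn); split.
  - by rewrite /adjc /= eqxx.
  - move=> k; rewrite /nearer /odist -val_eqE /= => kk ki; apply/eqP; apply: contraT => nk.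
    have /imax : up (Ordinal yn) by apply/existsP; exists k; rewrite nk andbT /=; lia.
    by rewrite /= ltnn.
  - by apply: (pos _ _ j) => //; rewrite /nearer /odist /=; lia.
case: (pickP dn) => [i0 dn0|nodn].
  right; case: (arg_minnP (fun i : 'I_n => val i) dn0) => i /existsP[j /andP[ij nz]] imin.
  have yn : (i.-1 < n)%N by apply: leq_ltn_trans (leq_pred _) (ltn_ord i).
  exists i, (Ordinal yn); split.
  - by rewrite /adjc /= prednK ?eqxx ?orbT //; apply: leq_ltn_trans ij.
  - move=> k; rewrite /nearer /odist -val_eqE /= => kk ki; apply/eqP; apply: contraT => nk.
    have /imin : dn (Ordinal yn) by apply/existsP; exists k; rewrite nk andbT /=; lia.
    by rewrite /=; lia.
  - by apply: (pos _ _ j) => //; rewrite /nearer /odist /=; lia.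
left=> i j ij; apply/eqP; apply: contraT => nz.
move: ij; rewrite -val_eqE neq_ltn => /orP[ij|ij].
  by have /existsP[] := noup i; exists j; rewrite ij.
by have /existsP[] := nodn i; exists j; rewrite ij.
Qed.
End Rank.

(** * Generation of the q-Schur algebra *)

Section StepWords.
Variables (R : comNzRingType) (n : nat) (x y : 'I_n) (c : R).
Hypothesis xy : x != y.
Notation P := ('I_n * 'I_n)%type.
Notation stepw := (stepw x y c).

Lemma stepw_cons a i k (s : seq P) : stepw a ((i, k) :: s) != 0 ->
  i = k /\ stepw a s != 0 \/
  [/\ i = x, k = y & exists2 a', a = a'.+1 & stepw a' s != 0].
Proof.
rewrite /=; have [->|ik] := eqVneq i k.
  have -> : ((k, k) == (x, y)) = false.
    by rewrite xpair_eqE; case: (k =P x) => //= ->; exact/negbTE.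
  move=> nz; left; split=> //; apply: contraNneq nz => ->.
  by rewrite mulr0; case: a => [|a']; rewrite ?mul0r addr0.
rewrite !mul0r add0r; case: a => [|a]; first by rewrite eqxx.
rewrite xpair_eqE; case: (i =P x) => [->|]; last by rewrite mul0r eqxx.
case: (k =P y) => [->|]; last by rewrite mul0r eqxx.
by rewrite mul1r => nz; right; split=> //; exists a.
Qed.

Lemma stepw_cntmx a (I T J : seq 'I_n) : size T = size I -> size J = size I ->
  stepw a (zip I T) != 0 -> exists t : 'I_n -> nat, (\sum_j t j = a)%N /\
  forall i j, (cntmx (zip I J) i j + t j * (i == y) = cntmx (zip T J) i j + t j * (i == x))%N.
Proof.
elim: I T J a => [|p I ih] [|q T] [|l J] a //= => [_ _|[sT] [sJ] nz].
  case: a => [_|a /=]; last by rewrite eqxx.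
  by exists (fun=> 0%N); rewrite big1 //; split=> // i j; rewrite !mxE.
have cC (k : 'I_n) (s : seq P) i j : cntmx ((k, l) :: s) i j = (((k == i) && (l == j)) + cntmx s i j)%N.
  by rewrite !mxE /= xpair_eqE.
case: (stepw_cons nz) => [[<- {}nz]|[-> -> [a' -> {}nz]]].
  have [t [st tE]] := ih _ _ _ sT sJ nz; exists t; split=> // i j.
  by rewrite !cC -!addnA tE.
have [t [st tE]] := ih _ _ _ sT sJ nz; exists (fun j => (t j + (l == j))%N); split=> [|i j].
  rewrite big_split /= st (bigD1 l) //= eqxx big1 => [|j]; first by rewrite addn0 addn1.
  by rewrite eq_sym => /negPf ->.
rewrite !cC !mulnDl; have := tE i j; rewrite (eq_sym x i) (eq_sym y i).
have -> : ((i == x) && (l == j) = (l == j) * (i == x) :> nat)%N by case: (i == x) (l == j) => [] [].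
have -> : ((i == y) && (l == j) = (l == j) * (i == y) :> nat)%N by case: (i == y) (l == j) => [] [].
move: (cntmx _ i j) (cntmx _ i j) (t j * _)%N (t j * _)%N ((l == j) * (i == x))%N ((l == j) * (i == y))%N.
by move=> *; lia.
Qed.

(** The hypothesis on T forces every letter that [move1] moves to be changed. There are at least a
    of them, so no other letter can change. *)
Lemma stepw_move1_uniq a (I T J : seq 'I_n) : size T = size I -> size J = size I ->
  stepw a (zip I T) != 0 ->
  all (fun p : P => ~~ ((p.1 == x) && nearer x y p.2)) (zip T J) ->
  (a <= count (fun p : P => (p.1 == x) && nearer x y p.2) (zip I J))%N ->
  T = map fst (map (move1 x y) (zip I J)).
Proof.
have cle : forall (I T J : seq 'I_n) a, size T = size I -> size J = size I ->
    stepw a (zip I T) != 0 ->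
    all (fun p : P => ~~ ((p.1 == x) && nearer x y p.2)) (zip T J) ->
    (count (fun p : P => (p.1 == x) && nearer x y p.2) (zip I J) <= a)%N.
  elim=> [|p I' ih] [|q T'] [|l J'] a' //= [sT] [sJ] nz /andP[nq aT].
  case: (stepw_cons nz) => [[<- {}nz]|[-> _ [b -> {}nz]]] in nq *.
    by rewrite (negPf nq) add0n (ih _ _ _ sT sJ nz aT).
  by rewrite -addn1 addnC leq_add ?(ih _ _ _ sT sJ nz aT) // leq_b1.
elim: I T J a => [|p I ih] [|q T] [|l J] a //= [sT] [sJ] nz /andP[nq aT].
case: (stepw_cons nz) => [[<- {}nz]|[-> -> [b -> {}nz]]] in nq *.
  by rewrite /move1 /= (negPf nq) add0n => le; rewrite -(ih _ _ _ sT sJ nz).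
have := cle _ _ _ _ sT sJ nz aT; rewrite eqxx /= /move1 /= eqxx.
case: (nearer x y l) => /=; last by lia.
by move=> _ le; rewrite -(ih _ _ _ sT sJ nz).
Qed.

Lemma stepw_move1_unit (c' : R) (s : seq P) : c * c' = 1 ->
  exists d, stepw (count (fun p : P => (p.1 == x) && nearer x y p.2) s)
    (zip (map fst s) (map fst (map (move1 x y) s))) * d = 1.
Proof.
move=> cc'; elim: s => [|[i j] s [d dE]]; first by exists 1; rewrite mulr1.
rewrite /= /move1 /=; case: ifP => [/andP[/eqP -> _]|ij] /=.
  by exists d; rewrite (negPf xy) !mul0r add0r eqxx mul1r.
rewrite eqxx mul1r add0n xpair_eqE.
have -> : (i == x) && (i == y) = false by case: (i =P x) => //= ->; exact/negbTE.
set k := count _ s in dE *.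
have -> : (match k with 0%N => 0 | a'.+1 => false%:R * stepw a'
   (zip (map fst s) (map fst (map (move1 x y) s))) end) = 0.
  by case: k {dE} => // a; rewrite mul0r.
have ck : c ^+ k * c' ^+ k = 1 by rewrite -exprMn cc' expr1n.
exists ((if i == y then c' ^+ k else 1) * d); rewrite addr0 -mulrA (mulrCA _ _ d) dE.
by case: (i == y); rewrite ?mulr1.
Qed.
End StepWords.

Section Generation.
Variables (R : comNzRingType) (v w : R) (n r : nat).
Hypothesis vw : v * w = 1.
Notation P := ('I_n * 'I_n)%type.
Notation S := (qSchur v n r).
Implicit Types (f g : S) (s : seq P) (A B : 'M[nat]_n).

Definition dual_at A g : Prop :=
  forall B, mxtotal B = r -> ev g (wordof B) = (B == A)%:R.

Lemma stepc_unit (x y : 'I_n) : stepc v w x y * stepc w v x y = 1.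
Proof. by rewrite /stepc; case: ifP; rewrite -exprMn 1?[w * v]mulrC vw expr1n. Qed.

(** On column-sorted words g is a unit at the rearrangements of [moved x y A] and 0 elsewhere. So h
    can be nonzero at B only if B arises from that matrix by turning a letters y into x, and
    [spread_lt] applies; at A itself a single intermediate word contributes, and its contribution is
    a unit. *)
Lemma step_dual x y (xy : adjc x y) A g : mxtotal A = r ->
  (forall j, nearer x y j -> j != y -> A y j = 0%N) -> dual_at (moved x y A) g ->
  let h := stepq r vw xy (\sum_j movable x y A j) * g in
  (exists d, ev h (wordof A) * d = 1) /\
  forall B, mxtotal B = r -> ev h (wordof B) != 0 -> B <> A -> (spread B < spread A)%N.
Proof.
move=> Ar A0 gd h; have nxy := adjc_neq xy; set a := (\sum_j _)%N in h *.
(* The columns are those of a sorted word, so for any rows T the value of g is known up to a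
   unit. *)
have gE T B : size T = r -> mxtotal B = r -> exists d d', d * d' = 1 /\
    ev g (zip T (map snd (wordof B))) =
    d * (cntmx (zip T (map snd (wordof B))) == moved x y A)%:R.
  move=> sT Br; have sB : size (map snd (wordof B)) = r by rewrite size_map size_wordof.
  have sz : size (zip T (map snd (wordof B))) = r by apply: zip_size.
  have [|d [d' [dd' dE]]] := ev_colsorted vw sz; last first.
    by exists d, d'; split=> //; rewrite dE gd // mxtotal_cntmx.
  rewrite (map_comp (fun i : 'I_n => nat_of_ord i) snd) (map_zip2 (r := r)) // -map_comp.
  have := wordof_sorted B; rewrite sorted_map; apply: sub_sorted => p q /=.
  by case/orP => [/ltnW|/andP[/eqP -> _]] //=.
split=> [|B Br nz BA]; last first.
  have [T T0] : exists T : r.-tuple 'I_n,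
      stepw x y (stepc v w x y) a (zip (map fst (wordof B)) T) != 0 /\
      cntmx (zip T (map snd (wordof B))) = moved x y A.
    apply: contrapT => no; case/eqP: nz; rewrite /h ev_mul ?size_wordof //.
    apply: big1 => T _; rewrite ev_stepq; last by rewrite (zip_size (r := r)) ?size_map ?size_wordof ?size_tuple.
    have [d [d' [_ ->]]] := gE T B (size_tuple T) Br.
    have [->|nz] := eqVneq (stepw x y (stepc v w x y) a (zip (map fst (wordof B)) T)) 0.
      by rewrite mul0r.
    case: eqP => [e|_]; last by rewrite !mulr0.
    by case: no; exists T.
  have [||t [st tE]] := stepw_cntmx nxy _ _ T0.1 (J := map snd (wordof B)).
  - by rewrite size_tuple size_map size_wordof.
  - by rewrite !size_map.
  apply: (spread_lt xy A0 st) BA => i j.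
  by rewrite -T0.2 -tE -{1}(cntmxK B) -[in LHS](zip_unzip (wordof B)).
set s := wordof A; have ss : size s = r by rewrite size_wordof.
have aE : a = count (fun p : P => (p.1 == x) && nearer x y p.2) s.
  rewrite /a /movable -[in LHS](cntmxK A); under eq_bigr do rewrite mxE.
  rewrite -/s; elim: s {ss} => [|[i j] s ih] /=.
    by rewrite big1 // => j _; case: ifP.
  rewrite -ih (bigD1 j) //= [in RHS](bigD1 j) //= !xpair_eqE eqxx andbT addnA; congr (_ + _)%N.
    by case: (nearer x y j); rewrite ?andbT ?andbF.
  by apply: eq_bigr => k; rewrite xpair_eqE eq_sym => /negPf ->; rewrite andbF.
pose T0 := map fst (map (move1 x y) s).
have sT0 : size T0 == r by rewrite !size_map ss.
have zE : zip T0 (map snd s) = map (move1 x y) s.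
  have -> : map snd s = map snd (map (move1 x y) s).
    by rewrite -map_comp; apply: eq_map => p; rewrite /= /move1; case: ifP.
  exact: zip_unzip.
have [d dE] := stepw_move1_unit nxy s (stepc_unit x y).
have [e [e' [ee' eE]]] := gE T0 A (eqP sT0) Ar.
exists (d * e').
rewrite /h ev_mul // (bigD1 (Tuple sT0)) //= big1 => [|T TN].
  rewrite addr0 ev_stepq; last by rewrite (zip_size (r := r)) ?size_map ?(eqP sT0).
  rewrite eE zE eqxx mulr1 aE mulrACA ee' mulr1 -[X in _ = X]dE.
  by rewrite -(map_zip1 (r := r) (s := map fst s) (t := T0)) ?size_map // (map_zip1 (r := r)) ?size_map.
rewrite ev_stepq; last by rewrite (zip_size (r := r)) ?size_map ?size_tuple.
have [b [b' [_ ->]]] := gE T A (size_tuple T) Ar.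
have [->|nz] := eqVneq (stepw x y (stepc v w x y) a (zip (map fst s) T)) 0.
  by rewrite mul0r.
case: eqP => [cE|_]; last by rewrite !mulr0.
case/eqP: TN; apply: val_inj; rewrite /= /T0 -[in RHS](zip_unzip s).
apply: (stepw_move1_uniq nxy _ _ nz); rewrite ?size_map ?size_tuple //.
  apply/allP => -[i j] ij; apply/negP => /= /andP[/eqP ix kj].
  have := moved_nearer A nxy kj; rewrite -cE mxE -ix => /eqP.
  by rewrite -leqn0 leqNgt -has_count has_pred1 ij.
by rewrite aE zip_unzip.
Qed.
End Generation.

(** * Triangular construction of the dual basis, and generation *)

Section DualBasisExists.
Variables (R : comNzRingType) (v w : R) (n r : nat).
Hypothesis vw : v * w = 1.
Notation P := ('I_n * 'I_n)%type.
Notation S := (qSchur v n r).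
Implicit Types (f g : S) (s : seq P) (A B : 'M[nat]_n).

Lemma ev_sum (I : Type) (l : seq I) (Q : pred I) (F : I -> S) s :
  ev (\sum_(i <- l | Q i) F i) s = \sum_(i <- l | Q i) ev (F i) s.
Proof.
apply: (big_morph (fun f => ev f s)) => [f g|]; first exact: evD.
by rewrite -(scale0r 0) evZ mul0r.
Qed.

(** There are infinitely many matrices over N; those of entry sum r are listed as contents of the
    words of length r. *)
Definition totals : seq 'M[nat]_n := undup [seq cntmx (val W) | W <- enum {: r.-tuple P}].

Lemma mem_totals A : (A \in totals) = (mxtotal A == r).
Proof.
rewrite mem_undup; apply/mapP/eqP => [[W _ ->]|Ar]; first by rewrite mxtotal_cntmx size_tuple.
have sz : size (wordof A) == r by rewrite size_wordof Ar.
by exists (Tuple sz); rewrite ?mem_enum //= cntmxK.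
Qed.

Definition diag_cont A : {ffun 'I_n -> nat} := [ffun i => A i i].

Lemma dual_diag A : (forall i j, i != j -> A i j = 0%N) ->
  dual_at A (diagq v r (fun mu => (mu == diag_cont A)%:R)).
Proof.
move=> Ad B Br; rewrite ev_diagq ?size_wordof // -natrM mulnb; congr (nat_of_bool _)%:R.
have cE s : map fst s = map snd s ->
    forall i j, cntmx s i j = if i == j then cont (map snd s) i else 0%N.
  elim: s => [|[k l] s ih] /=; first by move=> _ i j; rewrite !mxE !ffunE; case: ifP.
  case=> -> /ih {}ih i j; have := ih i j; rewrite !mxE !ffunE /= xpair_eqE => ->.
  case: (i =P j) => [->|ij]; first by rewrite andbb.
  by case: (l =P i) => // ->; case: (i =P j).
apply/andP/eqP => [[/eqP e /eqP c]|->].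
  apply/matrixP => i j; rewrite -[in LHS](cntmxK B) (cE _ e) c /diag_cont ffunE.
  by case: (i =P j) => [->//|/eqP ij]; rewrite Ad.
have e : map fst (wordof A) = map snd (wordof A).
  apply/eq_in_map => -[i j]; rewrite -has_pred1 has_count count_wordof /= => Aij.
  by apply/eqP; apply: contraTT Aij => ij; rewrite Ad.
split; first exact/eqP.
apply/eqP/ffunP => i; rewrite [RHS]ffunE -[in RHS](cntmxK A) (cE _ e) eqxx //.
Qed.

(** Generation is phrased through a closed predicate, to be instantiated by the trivial one, by the
    integral image and by the image of the map over k. *)
Variable G : S -> Prop.
Hypothesis GD : forall f g, G f -> G g -> G (f + g).
Hypothesis GZ : forall c f, G f -> G (c *: f).
Hypothesis GM : forall f g, G f -> G g -> G (f * g).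
Hypothesis Gstep : forall (x y : 'I_n) (xy : adjc x y) a, G (stepq r vw xy a).
Hypothesis Gdiag : forall lam, G (diagq v r (fun mu => (mu == lam)%:R)).

Lemma closed0 : G 0.
Proof. by rewrite -(scale0r (diagq v r (fun mu => (mu == [ffun=> 0%N])%:R))); apply: GZ. Qed.

Lemma closed_sum (I : Type) (l : seq I) (Q : pred I) (F : I -> S) :
  (forall i, Q i -> G (F i)) -> G (\sum_(i <- l | Q i) F i).
Proof. by move=> h; apply: (big_ind G) => //; exact: closed0. Qed.

Lemma dual_exists A : mxtotal A = r -> exists g, G g /\ dual_at A g.
Proof.
have [k] := ubnP (spread A); elim: k A => // k ih A lt_k Ar.
have [Ad|[x [y [xy A0 pos]]]] := movable_exists A.
  by exists (diagq v r (fun mu => (mu == diag_cont A)%:R)); split=> //; exact: dual_diag.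
have [||g [Gg gd]] := ih (moved x y A).
- by apply: leq_trans (spread_moved xy pos) _; rewrite -ltnS.
- by rewrite mxtotal_moved.
have [] := step_dual vw xy Ar A0 gd; set h := _ * g => -[d hd] hlt.
have : forall B, exists g', mxtotal B = r -> (spread B < spread A)%N -> G g' /\ dual_at B g'.
  move=> B; have [[Br lt]|no] := EM (mxtotal B = r /\ (spread B < spread A)%N).
    have [||g' g'P] := ih B; [by apply: leq_trans lt _; rewrite -ltnS|by []|].
    by exists g'.
  by exists 0 => Br lt; case: no.
move=> /choice[e eP].
pose lower B := (mxtotal B == r) && (spread B < spread A)%N.
(* The sum removes the values of h at matrices of smaller spread, the only ones besides A where h
   may be nonzero; d then inverts the value at A. *)
exists (d *: (h + (-1) *: \sum_(B <- totals | lower B) ev h (wordof B) *: e B)); split.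
  apply: GZ; apply: GD; first exact: GM.
  apply/GZ/closed_sum => B /andP[/eqP Br lt]; apply: GZ; exact: (eP B Br lt).1.
move=> C Cr; rewrite evZ evD evZ ev_sum mulN1r.
have -> : \sum_(B <- totals | lower B) ev (ev h (wordof B) *: e B) (wordof C) =
    if lower C then ev h (wordof C) else 0.
  have tE B : lower B -> ev (ev h (wordof B) *: e B) (wordof C) = ev h (wordof B) * (C == B)%:R.
    by move=> /andP[/eqP Br lt]; rewrite evZ (eP B Br lt).2.
  rewrite (eq_bigr _ tE) -big_filter; case: ifP => lC.
    rewrite (bigD1_seq C) /= ?mem_filter ?lC ?mem_totals ?Cr ?eqxx ?filter_uniq ?undup_uniq //.
    by rewrite mulr1 big1 ?addr0 // => B /negPf; rewrite eq_sym => ->; rewrite mulr0.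
  rewrite big_seq big1 // => B; rewrite mem_filter => /andP[lB _].
  by case: (C =P B) lC => [->|_ _]; rewrite ?lB // mulr0.
have [->|CA] := eqVneq C A.
  by rewrite /lower ltnn andbF subr0 mulrC hd.
rewrite /lower Cr eqxx /=; case: ifP => lt; first by rewrite subrr mulr0.
have [->|nz] := eqVneq (ev h (wordof C)) 0; first by rewrite subrr mulr0.
by move: (hlt C Cr nz); rewrite lt => /(_ (elimN eqP CA)).
Qed.

Lemma qSchur_generated f : G f.
Proof.
have : forall A, exists g, mxtotal A = r -> G g /\ dual_at A g.
  move=> A; have [Ar|no] := EM (mxtotal A = r); last by exists 0 => /no.
  by have [g gP] := dual_exists Ar; exists g.
move=> /choice[e eP].
have -> : f = \sum_(B <- totals | mxtotal B == r) ev f (wordof B) *: e B.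
  apply: (qS_ext_wordof vw) => C Cr; rewrite ev_sum -big_filter.
  have tE B : B \in [seq x <- totals | mxtotal x == r] -> ev (ev f (wordof B) *: e B) (wordof C) = ev f (wordof B) * (C == B)%:R.
    by rewrite mem_filter => /andP[/eqP Br _]; rewrite evZ (eP B Br).2.
  rewrite (eq_big_seq _ tE) (bigD1_seq C) /= ?mem_filter ?mem_totals ?Cr ?eqxx ?filter_uniq ?undup_uniq //.
  by rewrite mulr1 big1 ?addr0 // => B /negPf; rewrite eq_sym => ->; rewrite mulr0.
by apply: closed_sum => B /eqP Br; apply: GZ; exact: (eP B Br).1.
Qed.
End DualBasisExists.

Section DualBasisXi.
Variables (R : comNzRingType) (v w : R) (n r : nat).
Hypothesis vw : v * w = 1.
Implicit Types A B : 'M[nat]_n.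

Lemma ev_wordof (g : qSchur v n r) B (x : Aqr v n r) : mxtotal B = r ->
  Aqr_val x = cmon v B -> qS_fun g x = ev g (wordof B).
Proof.
move=> Br xE; rewrite /ev; congr (qS_fun g _); apply/val_inj.
by rewrite /= xE cmonE val_insubd cword_seq_in ?size_wordof.
Qed.

(** The construction with the trivial predicate gives a functional with the defining property, so
    [xget] does not fall back to its default 0. *)
Lemma ev_xi A B : mxtotal A = r -> mxtotal B = r -> ev (xi v r A) (wordof B) = (B == A)%:R.
Proof.
move=> Ar Br.
have [g [_ gd]] : exists g : qSchur v n r, True /\ dual_at A g.
  by apply: (dual_exists (vw := vw) (G := fun=> True)).
have : (fun f : qSchur v n r => forall B, mxtotal B = r ->
    forall x : Aqr v n r, Aqr_val x = cmon v B -> qS_fun f x = (B == A)%:R) (xi v r A).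
  apply: (@xgetPex _ 0 [set f : qSchur v n r | forall B, mxtotal B = r ->
    forall x : Aqr v n r, Aqr_val x = cmon v B -> qS_fun f x = (B == A)%:R]%classic).
  by exists g => C Cr x xE; rewrite (ev_wordof _ Cr xE) gd.
have xin : cword v (wordof B) \in @Aqr_pred R v n r by rewrite cword_seq_in // size_wordof.
move=> /(_ B Br (MkAqr xin)); rewrite (ev_wordof _ Br) ?cmonE // => -> //.
Qed.
End DualBasisXi.

(** * Quantum numbers and the commutation formula *)

Section QuantumNumbers.
Variables (F : fieldType) (v : F).
Hypothesis vn : forall n, v ^+ n.+1 - v ^- n.+1 != 0.

Definition qn (x : int) : F := (v ^ x - v ^ (- x)) / (v - v^-1).

Definition qf (a : nat) : F := \prod_(i < a) qn i.+1.

Definition gbin (x : int) (t : nat) : F := (\prod_(i < t) qn (x - i%:Z)) / qf t.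

Lemma v_neq0 : v != 0.
Proof. by apply/eqP => v0; move/eqP: (vn 0); rewrite v0 !expr1 invr0 subrr. Qed.

Lemma v_subV_neq0 : v - v^-1 != 0.
Proof. by have := vn 0; rewrite !expr1. Qed.

Lemma vsq_neq1 : v ^+ 2 - 1 != 0.
Proof.
have -> : v ^+ 2 - 1 = v * (v - v^-1) by rewrite mulrBr mulfV ?v_neq0.
by rewrite mulf_neq0 ?v_neq0 ?v_subV_neq0.
Qed.

Lemma qnS_neq0 n : qn n.+1 != 0.
Proof. by rewrite /qn mulf_neq0 ?invr_eq0 ?v_subV_neq0 // -exprnN -exprnP. Qed.

Lemma qn0 : qn 0 = 0.
Proof. by rewrite /qn oppr0 subrr mul0r. Qed.

Lemma qf_neq0 a : qf a != 0.
Proof. by apply/prodf_neq0 => i _; exact: qnS_neq0. Qed.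

Lemma qfS a : qf a.+1 = qf a * qn a.+1.
Proof. by rewrite /qf big_ord_recr. Qed.

Lemma qf0 : qf 0 = 1.
Proof. by rewrite /qf big_ord0. Qed.

Lemma gbin0 x : gbin x 0 = 1.
Proof. by rewrite /gbin big_ord0 qf0 divr1. Qed.

Lemma gbinSr x t : gbin x t.+1 = gbin x t * (qn (x - t%:Z) / qn t.+1).
Proof. by rewrite /gbin big_ord_recr qfS /= invfM; ring. Qed.

Lemma gbinS x t : gbin (x + 1) t.+1 = gbin x t * (qn (x + 1) / qn t.+1).
Proof.
rewrite /gbin big_ord_recl qfS /= subr0 invfM.
have -> : \prod_(i < t) qn (x + 1 - (bump 0 i)%:Z) = \prod_(i < t) qn (x - i%:Z).
  apply: eq_bigr => i _; congr qn; rewrite /bump add1n; lia.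
ring.
Qed.

Lemma qexpD x y : v ^ (x + y) = v ^ x * v ^ y.
Proof. exact: expfzDr v_neq0. Qed.

Lemma qexpN x : v ^ (- x) = (v ^ x)^-1.
Proof. by rewrite invr_expz. Qed.

Lemma qexp_neq0 x : v ^ x != 0.
Proof. exact: expfz_neq0 v_neq0. Qed.

End QuantumNumbers.

Ltac qfield vn :=
  have ? := v_neq0 vn; have ? := vsq_neq1 vn;
  rewrite /qn ?PoszD ?intS !(qexpN, qexpD vn) !expr1z;
  repeat match goal with |- context [exprz ?v ?x] =>
    let h := fresh "nz" in have h := qexp_neq0 vn x; move: (exprz v x) h => ? h end;
  field; repeat (apply/andP; split).

Section QuantumIdentities.
Variables (F : fieldType) (v : F).
Hypothesis vn : forall n, v ^+ n.+1 - v ^- n.+1 != 0.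
Local Notation qn := (qn v).
Local Notation gbin := (gbin v).

Lemma qn_commutator (c k : int) :
  qn k + qn c * qn (k - c - 1) = qn (c + 1) * qn (k - c).
Proof. by qfield vn. Qed.

Lemma qn_mul (a x t : int) :
  qn (x - t) * qn (a - t) + qn (t + 1) * qn (x + a + 1 - t) = qn (a + 1) * qn (x + 1).
Proof. by qfield vn. Qed.

Lemma qn_shift (x t : int) : qn (x + 1) = v ^ (t + 1) * qn (x - t) + v ^ (t - x) * qn (t + 1).
Proof. by qfield vn. Qed.

(** The recursion in a for the coefficients of [dpow_commutation]: the first term comes from moving
    e past a power of f, the second from the commutator. *)
Lemma gbin_mul (a t : nat) (x : int) :
  gbin x t.+1 * qn (a%:Z - t%:Z) + gbin x t * qn (x + a%:Z + 1 - t%:Z) =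
  qn a.+1 * gbin (x + 1) t.+1.
Proof.
have := qn_mul a x t; rewrite gbinSr gbinS -[a.+1]addn1 -[t.+1]addn1 !PoszD.
have := qnS_neq0 vn t; rewrite -[t.+1]addn1 PoszD.
move: (qn (t%:Z + 1)) (gbin x t) => c g c0 e.
apply: (mulfI c0); rewrite mulrDr.
have -> : c * (g * (qn (x - t%:Z) / c) * qn (a%:Z - t%:Z)) = g * (qn (x - t%:Z) * qn (a%:Z - t%:Z)).
  by field.
rewrite [c * (g * _)]mulrCA -mulrDr e; by field.
Qed.

(** The q-Pascal rule. It gives integrality of the binomials and the passage from [k; t] to its
    shifts. *)
Lemma gbin_shift (x : int) (t : nat) :
  gbin (x + 1) t.+1 = v ^ (t%:Z + 1) * gbin x t.+1 + v ^ (t%:Z - x) * gbin x t.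
Proof.
rewrite gbinS gbinSr (qn_shift x t); have := qnS_neq0 vn t; rewrite -[t.+1]addn1 PoszD => c0.
by field.
Qed.

Lemma gbin_small (y t : nat) : (y < t)%N -> gbin y t = 0.
Proof.
move=> yt; rewrite /gbin (bigD1 (Ordinal yt)) //=.
by rewrite subrr (qn0 v) !mul0r.
Qed.

Lemma gbin_diag (t : nat) : gbin t t = 1.
Proof.
elim: t => [|t ih]; first exact: gbin0.
by rewrite -{1}[t.+1]addn1 PoszD gbinS ih mul1r -PoszD addn1 mulfV ?(qnS_neq0 vn).
Qed.

Section Integral.
Variable Zp : subringClosed F.
Hypothesis vZp : forall x : int, v ^ x \in Zp.

Lemma gbin_integral (y t : nat) : gbin y t \in Zp.
Proof.
elim: y t => [|y ih] [|t]; rewrite ?gbin0 ?rpred1 //; first by rewrite gbin_small ?rpred0.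
by rewrite -[y.+1]addn1 PoszD gbin_shift rpredD // rpredM.
Qed.
End Integral.
End QuantumIdentities.

(** * Rank one: indicators of a weight from divided powers *)

Section Sl2.
Variables (F : fieldType) (v : F).
Hypothesis vn : forall n, v ^+ n.+1 - v ^- n.+1 != 0.
(** D phi models the function phi of the weight k. Only the values with |k| <= N count, and this
    bound is what lets finitely many binomials produce an indicator. *)
Variables (A : algType F) (D : (int -> F) -> A) (N : nat) (e f : A).
Hypothesis D_ext : forall phi psi, (forall k : int, `|k|%N <= N -> phi k = psi k)%N -> D phi = D psi.
Hypothesis D_one : D (fun=> 1) = 1.
Hypothesis D_mul : forall phi psi, D phi * D psi = D (fun k => phi k * psi k).
Hypothesis D_add : forall phi psi, D phi + D psi = D (fun k => phi k + psi k).
Hypothesis D_scale : forall c phi, c *: D phi = D (fun k => c * phi k).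
Hypothesis De : forall phi, D phi * e = e * D (fun k => phi (k + 2)).
Hypothesis Df : forall phi, D phi * f = f * D (fun k => phi (k - 2)).
Hypothesis ef : e * f - f * e = D (qn v).

Local Notation qn := (qn v).
Local Notation gbin := (gbin v).

Definition dpow (x : A) (a : nat) : A := (qf v a)^-1 *: x ^+ a.

Lemma dpow0 x : dpow x 0 = 1.
Proof. by rewrite /dpow qf0 invr1 scale1r. Qed.

Lemma dpowS x a : qn a.+1 *: dpow x a.+1 = dpow x a * x.
Proof.
rewrite /dpow qfS invfM scalerA mulrCA mulrV ?unitfE ?qnS_neq0 // mulr1.
by rewrite exprSr -scalerAl.
Qed.

Lemma dpow_comm x a : dpow x a * x = x * dpow x a.
Proof. by rewrite /dpow -scalerAl -scalerAr -exprSr exprS. Qed.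

(** The divided power with exponent b - t, read as 0 for t > b, where truncated subtraction would
    give 1. *)
Definition fd (b t : nat) : A := if (t <= b)%N then dpow f (b - t) else 0.

Lemma e_dpow c : e * dpow f c = dpow f c * e +
  (if c is c'.+1 then dpow f c' * D (fun k => qn (k - c'%:Z)) else 0).
Proof.
elim: c => [|c ih]; first by rewrite dpow0 mulr1 mul1r addr0.
have qc := qnS_neq0 vn c; apply: (scalerI qc).
rewrite scalerDr scalerAr dpowS scalerAl dpowS mulrA ih mulrDl -mulrA.
have -> : e * f = f * e + D qn by rewrite -ef addrC subrK.
rewrite mulrDr mulrA -addrA; congr (_ + _).
have -> : (if c is c'.+1 then dpow f c' * D (fun k => qn (k - c'%:Z)) else 0) * f =
    dpow f c * D (fun k => qn c * qn (k - c%:Z - 1)).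
  case: c {ih qc} => [|c].
    by rewrite mul0r -D_scale (qn0 v) scale0r mulr0.
  rewrite -mulrA Df mulrA -dpowS -scalerAl scalerAr D_scale; congr (_ * _).
  apply: D_ext => k _; congr (_ * qn _); lia.
rewrite -mulrDr D_add scalerAr D_scale; congr (_ * _); apply: D_ext => k _.
by rewrite -addn1 PoszD (qn_commutator vn).
Qed.

Lemma e_fd b t : e * fd b t = fd b t * e + fd b t.+1 * D (fun k => qn (k - b%:Z + t%:Z + 1)).
Proof.
rewrite /fd; case: (leqP t b) => tb; last first.
  by rewrite ltnNge (ltnW tb) /= mulr0 !mul0r addr0.
rewrite e_dpow; congr (_ + _).
case: (ltnP t b) => tb'; last first.
  have -> : (b - t = 0)%N by lia.
  by rewrite mul0r.
rewrite -(subnSK tb'); congr (_ * _); apply: D_ext => k _; congr qn; lia.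
Qed.

Lemma D_dpow phi a : D phi * dpow e a = dpow e a * D (fun k => phi (k + a%:Z * 2)).
Proof.
elim: a phi => [|a ih] phi.
  by rewrite dpow0 mulr1 mul1r; apply: D_ext => k _; rewrite mul0r addr0.
have qc := qnS_neq0 vn a; apply: (scalerI qc).
rewrite scalerAr dpowS mulrA ih -mulrA De mulrA -dpowS -scalerAl; congr (_ *: (_ * _)).
apply: D_ext => k _; congr phi; lia.
Qed.

(** Kostant's formula with the torus part on the far right: moving it past the divided power with
    exponent a - t adds 2(a - t) to the usual shift 2t - a - b, so the shift a - b no longer depends
    on t. *)
Lemma dpow_commutation a b : dpow e a * dpow f b =
  \sum_(t < a.+1) fd b t * dpow e (a - t) * D (fun k => gbin (a%:Z - b%:Z + k) t).
Proof.
elim: a => [|a ih].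
  rewrite big_ord1 /fd subn0 dpow0 mul1r mulr1.
  rewrite (D_ext (psi := fun=> 1)) ?D_one ?mulr1 // => k _; exact: gbin0.
apply: (scalerI (qnS_neq0 vn a)); rewrite scalerAl dpowS dpow_comm -mulrA ih mulr_sumr.
pose G t (k : int) := gbin (a%:Z - b%:Z + k) t.
have E (t : 'I_a.+1) : e * (fd b t * dpow e (a - t) * D (G t)) =
    fd b t * dpow e (a.+1 - t) * D (fun k => qn (a.+1%:Z - t%:Z) * G t k) +
    fd b t.+1 * dpow e (a - t) * D (fun k => qn (a%:Z - b%:Z + k + a%:Z + 1 - t%:Z) * G t k).
  rewrite !mulrA e_fd !mulrDl -!mulrA; congr (fd _ _ * _ + fd _ _ * _).
    have ta : (t <= a)%N by rewrite -ltnS.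
    rewrite -D_scale -scalerAr scalerAl subSn //.
    have -> : a.+1%:Z - t%:Z = (a - t).+1 by lia.
    by rewrite dpowS dpow_comm mulrA.
  rewrite mulrA D_dpow -mulrA D_mul; congr (_ * _); apply: D_ext => k _.
  congr (qn _ * _); have := ltn_ord t; lia.
rewrite (eq_bigr _ (fun t _ => E t)) big_split /=.
(* Both sums are extended to a + 2 terms so as to be compared index by index: the top term of X has
   coefficient [0], and Y is shifted by one with a leading 0. *)
pose X (t : nat) := fd b t * dpow e (a.+1 - t) * D (fun k => qn (a.+1%:Z - t%:Z) * G t k).
pose Y (t : nat) := if t is t'.+1 then fd b t * dpow e (a - t') *
  D (fun k => qn (a%:Z - b%:Z + k + a%:Z + 1 - t'%:Z) * G t' k) else 0.
have -> : \sum_(t < a.+1) fd b t * dpow e (a.+1 - t) *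
    D (fun k => qn (a.+1%:Z - t%:Z) * G t k) = \sum_(t < a.+2) X t.
  by rewrite [RHS]big_ord_recr /= {2}/X subrr -D_scale (qn0 v) scale0r mulr0 addr0.
have -> : \sum_(t < a.+1) fd b t.+1 * dpow e (a - t) *
    D (fun k => qn (a%:Z - b%:Z + k + a%:Z + 1 - t%:Z) * G t k) = \sum_(t < a.+2) Y t.
  by rewrite [RHS]big_ord_recl /= add0r.
rewrite -big_split scaler_sumr; apply: eq_bigr => -[[|t] /= lt] _.
  rewrite addr0 /X scalerAr D_scale; congr (_ * _); apply: D_ext => k _.
  by rewrite /G !gbin0 subr0.
rewrite /X /Y subSS -mulrDr D_add scalerAr D_scale; congr (_ * _); apply: D_ext => k _.
have := gbin_mul vn a t (a%:Z - b%:Z + k); rewrite /G.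
have -> : a.+1%:Z - t.+1%:Z = a%:Z - t%:Z by lia.
have -> : a.+1%:Z - b%:Z + k = a%:Z - b%:Z + k + 1 by lia.
by move=> <-; rewrite [qn (a%:Z - _) * _]mulrC; congr (_ + _); rewrite mulrC.
Qed.

Variables (Zp : subringClosed F) (G : A -> Prop).
Hypothesis vZp : forall x : int, v ^ x \in Zp.
Hypothesis GD : forall x y, G x -> G y -> G (x + y).
Hypothesis GM : forall x y, G x -> G y -> G (x * y).
Hypothesis GZ : forall c x, c \in Zp -> G x -> G (c *: x).
Hypothesis G1 : G 1.
Hypothesis Ge : forall a, G (dpow e a).
Hypothesis Gf : forall a, G (dpow f a).
Hypothesis GK : G (D (fun k => v ^ (- k))).

Lemma form0 : G 0.
Proof. by rewrite -(scale0r 1); apply: GZ => //; exact: rpred0. Qed.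

Lemma formN x : G x -> G (- x).
Proof. by rewrite -scaleN1r; apply: GZ; rewrite rpredN rpred1. Qed.

Lemma form_sum (I : Type) (l : seq I) (Q : pred I) (H : I -> A) :
  (forall i, Q i -> G (H i)) -> G (\sum_(i <- l | Q i) H i).
Proof. by move=> h; apply: (big_ind G) => //; exact: form0. Qed.

(* The term t = a = b of dpow_commutation is the Gaussian binomial itself. *)
Lemma form_gbin t : G (D (fun k => gbin k t)).
Proof.
have [d] := ubnP t; elim: d t => // d ih t lt_t.
have := dpow_commutation t t; rewrite big_ord_recr /= subnn dpow0 mulr1.
rewrite {2}/fd leqnn subnn dpow0 mul1r.
have gE j : D (fun k => gbin (t%:Z - t%:Z + k) j) = D (fun k => gbin k j).
  by apply: D_ext => k _; rewrite subrr add0r.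
rewrite gE => /(canLR (addKr _)) <-.
apply: GD; last exact: GM.
apply/formN/form_sum => j _; rewrite gE; apply: GM; last by apply: ih; have := ltn_ord j; lia.
by apply: GM => //; rewrite /fd; case: ifP => // _; exact: form0.
Qed.

(** The binomials [k; t] need not vanish at negative k, so weights between -N and N have to be
    shifted. The q-Pascal rule raises c by one, and its factor v^(-k) is supplied by [GK]. *)
Lemma form_gbin_shift c t : G (D (fun k => gbin (k + c%:Z) t)).
Proof.
elim: c t => [|c ih] t.
  by rewrite (D_ext (psi := fun k => gbin k t)) => [|k _]; [exact: form_gbin|rewrite addr0].
case: t => [|t].
  by rewrite (D_ext (psi := fun=> 1)) => [|k _]; [rewrite D_one|exact: gbin0].
have -> : D (fun k => gbin (k + c.+1%:Z) t.+1) =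
    v ^ (t%:Z + 1) *: D (fun k => gbin (k + c%:Z) t.+1) +
    v ^ (t%:Z - c%:Z) *: (D (fun k => v ^ (- k)) * D (fun k => gbin (k + c%:Z) t)).
  rewrite D_mul !D_scale D_add; apply: D_ext => k _.
  rewrite -[c.+1]addn1 PoszD addrA (gbin_shift vn); congr (_ + _).
  by rewrite [RHS]mulrA -(qexpD vn); congr (v ^ _ * _); lia.
by apply: GD; apply: GZ => //; apply: GM.
Qed.

(** For y = k + N in 0, ..., 2N the binomial [y; y0] is 0 if y < y0 and 1 if y = y0. The indicator
    of y0 is thus this binomial minus integral multiples of indicators of larger y, and descending
    induction on y0 applies. *)
Lemma form_point (k0 : int) : (`|k0| <= N)%N -> G (D (fun k => (k == k0)%:R)).
Proof.
move=> k0N; have -> : k0 = (`|(k0 + N%:Z)%R|%N)%:Z - N%:Z by lia.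
have {k0N} : (`|(k0 + N%:Z)%R| <= N + N)%N by lia.
move: `|_|%N => y0.
have [d] := ubnP (N + N - y0)%N; elim: d y0 => // d ih y0 lt_d y0N.
rewrite (D_ext (psi := fun k => gbin (k + N%:Z) y0 +
  \sum_(y0.+1 <= y < (N + N).+1) - gbin y y0 * (k == y%:Z - N%:Z)%:R)).
  rewrite -D_add; apply: GD; first exact: form_gbin_shift.
  have -> : D (fun k => \sum_(y0.+1 <= y < (N + N).+1) - gbin y y0 * (k == y%:Z - N%:Z)%:R) =
      \sum_(y0.+1 <= y < (N + N).+1) - gbin y y0 *: D (fun k => (k == y%:Z - N%:Z)%:R).
    elim: (index_iota _ _) => [|y l ihl].
      rewrite big_nil -(scale0r (D (fun=> 1))) D_scale; apply: D_ext => k _.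
      by rewrite big_nil mul0r.
    rewrite big_cons -ihl D_scale D_add; apply: D_ext => k _.
    by rewrite big_cons.
  rewrite big_nat; apply: form_sum => y /andP[y1 y2]; apply: GZ.
    by rewrite rpredN; exact: (gbin_integral vn).
  by apply: ih; lia.
move=> k kN; have -> : k = (`|(k + N%:Z)%R|%N)%:Z - N%:Z by lia.
have : (`|(k + N%:Z)%R| <= N + N)%N by lia.
move: `|_|%N => y yN {k kN}; rewrite subrK.
have eqE (z : nat) : (y%:Z - N%:Z == z%:Z - N%:Z) = (y == z) by apply/eqP/eqP; lia.
rewrite eqE; under eq_bigr do rewrite eqE.
case: (ltngtP y y0) => [yy|yy|->].
- rewrite gbin_small // add0r big_nat big1 // => z /andP[z1 z2].
  by have -> : (y == z) = false by [apply/eqP; lia]; rewrite mulr0.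
- rewrite (bigD1_seq y) ?mem_index_iota ?iota_uniq //=; last by lia.
  rewrite eqxx mulr1 big1 ?addr0 ?subrr // => z /negPf.
  by rewrite eq_sym => ->; rewrite mulr0.
- rewrite (gbin_diag vn) big_nat big1 ?addr0 // => z /andP[z1 z2].
  by have -> : (y0 == z) = false by [apply/eqP; lia]; rewrite mulr0.
Qed.
End Sl2.

(** * Base change and divided powers *)

Section BaseChangeMorphism.
Variables (R R' : comNzRingType) (phi : {rmorphism R -> R'}) (v w : R) (n r : nat).
Hypothesis vw : v * w = 1.
Notation S := (qSchur v n r).
Implicit Types f g : S.

Lemma qS_bcD f g : qS_bc phi (f + g) = qS_bc phi f + qS_bc phi g.
Proof. by apply: qS_ext => s sr; rewrite evD !qS_bcE // evD rmorphD. Qed.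

Lemma qS_bcZ c f : qS_bc phi (c *: f) = phi c *: qS_bc phi f.
Proof. by apply: qS_ext => s sr; rewrite evZ !qS_bcE // evZ rmorphM. Qed.

Lemma qS_bcB f g : qS_bc phi (f - g) = qS_bc phi f - qS_bc phi g.
Proof. by rewrite qS_bcD -scaleN1r qS_bcZ rmorphN1 scaleN1r. Qed.

Lemma qS_bc1 : qS_bc phi (1 : S) = 1.
Proof. by apply: qS_ext => s sr; rewrite qS_bcE // !ev_one // rmorph_nat. Qed.

Lemma qS_bcM f g : qS_bc phi (f * g) = qS_bc phi f * qS_bc phi g.
Proof.
apply: qS_ext => s sr; rewrite qS_bcE // !ev_mul // rmorph_sum; apply: eq_bigr => T _.
by rewrite rmorphM !qS_bcE // (zip_size (r := r)) ?size_map ?size_tuple.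
Qed.

Lemma qS_bc_diagq (psi : {ffun 'I_n -> nat} -> R) :
  qS_bc phi (diagq v r psi) = diagq (phi v) r (fun mu => phi (psi mu)).
Proof.
by apply: qS_ext => s sr; rewrite qS_bcE // !ev_diagq // rmorphM rmorph_nat.
Qed.

Lemma stepw_bc (x y : 'I_n) c a s : phi (stepw x y c a s) = stepw x y (phi c) a s.
Proof.
elim: s a => [|p s ih] a /=; first by rewrite rmorph_nat.
rewrite rmorphD !rmorphM rmorph_nat ih; congr (_ * _ * _ + _).
  by case: ifP => _; rewrite ?rmorphXn ?rmorph1.
by case: a => [|a]; rewrite ?rmorph0 // rmorphM rmorph_nat ih.
Qed.

Lemma qS_bc_stepq (vw' : phi v * phi w = 1) (x y : 'I_n) (xy : adjc x y) a :
  qS_bc phi (stepq r vw xy a) = stepq r vw' xy a.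
Proof.
apply: qS_ext => s sr; rewrite qS_bcE // !ev_stepq // stepw_bc /stepc.
by congr stepw; case: ifP => _; rewrite rmorphXn.
Qed.

Lemma qS_bc_inj : injective phi -> injective (@qS_bc R R' phi v n r).
Proof.
move=> phi_inj f g fg; apply: qS_ext => s sr; apply: phi_inj.
by rewrite -!qS_bcE // fg.
Qed.
End BaseChangeMorphism.

Section StepDiag.
Variables (R : comNzRingType) (v w : R) (n r : nat).
Hypothesis vw : v * w = 1.
Implicit Types phi psi : {ffun 'I_n -> nat} -> R.

Lemma stepq_diagq_ext (x y : 'I_n) (xy : adjc x y) a phi psi :
  (forall mu : {ffun _}, (\sum_i mu i)%N = r -> (a <= mu y)%N -> phi mu = psi mu) ->
  stepq r vw xy a * diagq v r phi = stepq r vw xy a * diagq v r psi.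
Proof.
move=> e; apply: qS_ext => s sr; rewrite !ev_mul_diagq // ev_stepq //.
have [->|nz] := eqVneq (stepw x y (stepc v w x y) a s) 0; first by rewrite !mul0r.
rewrite e // ?cont_sum ?size_map //.
have := stepw_cont y (adjc_neq xy) nz.
by rewrite eqxx eq_sym (negPf (adjc_neq xy)) muln1 muln0 addn0 => <-; rewrite leq_addl.
Qed.
End StepDiag.

Section StepPower.
Variables (F : fieldType) (v : F) (n r : nat).
Hypothesis vn : forall k, v ^+ k.+1 - v ^- k.+1 != 0.
Hypothesis vw : v * v^-1 = 1.
Implicit Types phi : {ffun 'I_n -> nat} -> F.

Lemma geom_qn a : geom (v ^+ 2) a.+1 = qn v a.+1 * v ^ a%:Z.
Proof.
elim: a => [|a ih].
  by rewrite /geom big_ord1 expr0 expr0z mulr1 /qn !expr1z exprN1 mulfV ?(v_subV_neq0 vn).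
rewrite /geom big_ord_recr /= -/(geom _ _) ih exprAC expr2 exprnP.
by qfield vn.
Qed.

Lemma geom_qnV a : geom (v^-1 ^+ 2) a.+1 = qn v a.+1 * v ^ (- a%:Z).
Proof.
elim: a => [|a ih].
  by rewrite /geom big_ord1 expr0 oppr0 expr0z mulr1 /qn !expr1z exprN1 mulfV ?(v_subV_neq0 vn).
rewrite /geom big_ord_recr /= -/(geom _ _) ih exprAC expr2 exprVn exprnP.
by qfield vn.
Qed.

(** All diagonal factors are moved to the right of the steps, where psi collects them together with
    the power of v by which [geom] differs from a quantum integer; exactly [a]! is left in front. *)
Lemma step_power (x y : 'I_n) (xy : adjc x y) phi (psi : nat -> {ffun 'I_n -> nat} -> F) a :
  (forall mu, psi 0%N mu = 1) ->
  (forall a (mu : {ffun _}), (a < mu y)%N ->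
     geom (stepc v v^-1 x y) a.+1 * (phi (shiftc x y a mu) * psi a mu) = qn v a.+1 * psi a.+1 mu) ->
  (stepq r vw xy 1 * diagq v r phi) ^+ a =
  qf v a *: (stepq r vw xy a * diagq v r (psi a)).
Proof.
move=> psi0 psiS; elim: a => [|a ih].
  rewrite expr0 qf0 scale1r stepq0 mul1r -(diagq1 v n r).
  by apply: eq_diagq => mu _; rewrite psi0.
rewrite exprS ih -qS_scaleAr -mulrA (mulrA (diagq _ _ _)) diagq_step -mulrA diagqM mulrA.
rewrite stepq_mul -qS_scaleAl scalerA qfS -scalerA -[in RHS]scalerA; congr (_ *: _).
rewrite !qS_scaleAr !diagqZ; apply: stepq_diagq_ext => mu _ la.
exact: psiS.
Qed.
End StepPower.

(** * The elements A(j, r) *)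

Section AlmostDiagonal.
Variable n : nat.
Notation P := ('I_n * 'I_n)%type.
Implicit Types (x y i j : 'I_n) (A B : 'M[nat]_n) (s : seq P) (d : 'I_n -> nat).

Definition addiag A d : 'M[nat]_n := A + diag_mx (\row_i d i).

Lemma addiagE A d i j : addiag A d i j = (A i j + d i * (i == j))%N.
Proof. by rewrite !mxE; case: (i =P j) => [->|]; rewrite ?muln1 ?muln0 ?mulr1n ?mulr0n. Qed.

Lemma delta_nat x y i j : (delta_mx x y : 'M[nat]_n) i j = ((i == x) && (j == y))%N.
Proof. by rewrite mxE; case: (_ && _). Qed.

Lemma cont_snd s j : (cont (map snd s) j = \sum_i cntmx s i j)%N.
Proof.
under eq_bigr do rewrite mxE.
elim: s => [|[k l] s ih] /=; first by rewrite ffunE big1.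
rewrite big_split /= -ih !ffunE /=; congr (_ + _)%N.
rewrite (bigD1 k) //= xpair_eqE eqxx big1 ?addn0 // => i.
by rewrite xpair_eqE eq_sym => /negPf ->.
Qed.

Lemma cont_addiag x y d j :
  (cont (map snd (wordof (addiag (delta_mx x y) d))) j = d j + (j == y))%N.
Proof.
rewrite cont_snd cntmxK; under eq_bigr do rewrite addiagE delta_nat.
rewrite big_split /= addnC; congr (_ + _)%N.
  rewrite (bigD1 j) //= eqxx muln1 big1 ?addn0 // => i /negPf ->; exact: muln0.
rewrite (bigD1 x) //= eqxx big1 ?addn0 // => i /negPf -> //.
Qed.

Lemma cont_addiag0 d j : (cont (map snd (wordof (addiag 0 d))) j = d j)%N.
Proof.
rewrite cont_snd cntmxK; under eq_bigr do rewrite addiagE mxE add0n.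
by rewrite (bigD1 j) //= eqxx muln1 big1 ?addn0 // => i /negPf ->; exact: muln0.
Qed.

Lemma dA_addiag0 d : dA (addiag 0 d) = 0.
Proof.
rewrite /dA big1 ?oppr0 ?add0r => [|i _]; last first.
  rewrite big1 // => j _.
  rewrite big1 // => s lt_is; rewrite big1 // => t lt_tj; rewrite !addiagE !mxE !add0n.
  case: (i =P j) => [ij|]; last by rewrite muln0.
  case: (s =P t) => [st|]; last by rewrite !muln0.
  by move: lt_is lt_tj; rewrite ij st; lia.
rewrite big1 // => i _; rewrite big1 // => j _.
rewrite big1 // => t lt_tj; rewrite !addiagE !mxE !add0n.
case: (i =P j) => [ij|]; last by rewrite muln0.
case: (i =P t) => [it|]; last by rewrite !muln0.
by move: lt_tj; rewrite -it ij ltnn.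
Qed.

(** As x and y are adjacent, no two nonzero entries satisfy i < s and t < j, so the first sum
    vanishes; the second one sees only the two entries of row x. *)
Lemma dA_addiag x y d : adjc x y -> dA (addiag (delta_mx x y) d) = (d x)%:Z.
Proof.
move=> xy; have nxy := adjc_neq xy.
have nz i j : addiag (delta_mx x y) d i j = 0%N \/ i = j \/ i = x /\ j = y.
  rewrite addiagE delta_nat; case: (i =P j) => [->|_]; first by right; left.
  case: (i =P x) => [->|_]; last by left; rewrite muln0.
  by case: (j =P y) => [->|_]; [right; right|left; rewrite muln0].
rewrite /dA big1 ?oppr0 ?add0r => [|i _]; last first.
  rewrite big1 // => j _; rewrite big1 // => s lt_is; rewrite big1 // => t lt_tj.
  case: (nz i j) => [->//|ij]; case: (nz s t) => [->|st]; first by rewrite muln0.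
  exfalso; case: ij => [ij|[ij1 ij2]]; case: st => [st|[st1 st2]]; subst;
    move: xy lt_is lt_tj; rewrite /adjc; lia.
have row_x : (addiag (delta_mx x y) d x y = 1)%N /\ addiag (delta_mx x y) d x x = d x.
  by rewrite !addiagE !delta_nat !eqxx (negPf nxy) /= muln0 muln1.
rewrite (bigD1 x) //= [X in _ + X]big1 ?addr0 => [|i ix]; last first.
  rewrite big1 // => j _; rewrite big1 // => t lt_tj.
  case: (nz i j) => [->//|ij]; case: (nz i t) => [->|it]; first by rewrite muln0.
  exfalso; case: ij => [ij|[ij1 ij2]]; case: it => [it|[it1 it2]]; subst;
    move: ix lt_tj; rewrite ?eqxx ?ltnn //.
case: (ltngtP x y) => [lxy|lxy|/val_inj e]; last by rewrite e eqxx in nxy.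
- rewrite (bigD1 y) //= [X in _ + X]big1 ?addr0 => [|j jy].
    rewrite (bigD1 x) //= big1 ?addr0 => [|t /andP[lt_ty tx]].
      by rewrite row_x.1 row_x.2 mul1n.
    case: (nz x t) => [->|[e|[_ e]]]; first by rewrite muln0.
      by rewrite e eqxx in tx.
    by rewrite e ltnn in lt_ty.
  rewrite big1 // => t lt_tj; case: (nz x j) => [->//|[e|[_ e]]]; last by rewrite e eqxx in jy.
  case: (nz x t) => [->|[e'|[_ e']]]; [by rewrite muln0| |]; exfalso; subst.
    by rewrite ltnn in lt_tj.
  by move: lt_tj lxy; lia.
- rewrite (bigD1 x) //= [X in _ + X]big1 ?addr0 => [|j jx].
    rewrite (bigD1 y) //= big1 ?addr0 => [|t /andP[lt_tx ty]].
      by rewrite row_x.1 row_x.2 muln1.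
    case: (nz x t) => [->|[e|[_ e]]]; first by rewrite muln0.
      by rewrite e ltnn in lt_tx.
    by rewrite e eqxx in ty.
  rewrite big1 // => t lt_tj; case: (nz x j) => [->//|[e|[_ e]]]; first by rewrite e eqxx in jx.
  case: (nz x t) => [->|[e'|[_ e']]]; [by rewrite muln0| |]; exfalso; subst.
    by move: lt_tj lxy; lia.
  by rewrite ltnn in lt_tj.
Qed.

Section StepValue.
Variables (R : comNzRingType) (c : R) (x y : 'I_n).
Hypothesis xy : x != y.

Lemma stepw1_addiag s : stepw x y c 1 s != 0 ->
  exists d, cntmx s = addiag (delta_mx x y) d.
Proof.
elim: s => [|[i j] s ih]; first by rewrite /= eqxx.
case/(stepw_cons xy) => [[<- /ih[d dE]]|[-> -> [a [<-]]]].
  exists (fun k => (d k + (k == i))%N); apply/matrixP => k l.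
  have /matrixP/(_ k l) := dE; rewrite !addiagE !mxE /= xpair_eqE => ->.
  rewrite mulnDl addnCA; congr (_ + _)%N; rewrite addnC; congr (_ + _)%N.
  by rewrite (eq_sym i k); case: (k =P i) => [->|] /=; rewrite ?mul1n ?mul0n.
rewrite stepw0 => e; have {e} /eqP e : map fst s == map snd s.
  by apply: contraNT e => /negPf ->.
exists (fun k => cont (map snd s) k); apply/matrixP => k l.
rewrite addiagE delta_nat mxE /= xpair_eqE (eq_sym x) (eq_sym y); congr (_ + _)%N.
elim: s e {ih} => [|[i' j'] s ih] /=; first by rewrite ffunE.
case=> -> /ih ->; rewrite !ffunE /= xpair_eqE mulnDl; congr (_ + _)%N.
by case: (j' =P k) => [->|] /=; rewrite ?mul1n ?mul0n.
Qed.

(** Factors c come from the letters (y, y) to the left of (x, y). Both lie in column y, which is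
    ordered by rows: all of the former come first if y < x, none if x < y. *)
Lemma stepw1_sorted s : sorted (@lexle n) s ->
  (forall p, p \in s -> p.1 = p.2 \/ p = (x, y)) -> count_mem (x, y) s = 1%N ->
  stepw x y c 1 s = if (x < y)%N then 1 else c ^+ count_mem (y, y) s.
Proof.
elim: s => [//|[i j] s ih] ss sP /= c1.
have so : sorted (@lexle n) s by exact: path_sorted ss.
have al q : q \in s -> lexle (i, j) q.
  by move=> qs; apply: (allP (order_path_min (@lexle_trans n) ss)).
have [ij|[ei ej]] := sP (i, j) (mem_head _ _).
  rewrite /= in ij; subst j; have nix : ((i, i) == (x, y)) = false.
    by rewrite xpair_eqE; case: (i =P x) => //= ->; exact/negbTE.
  rewrite nix add0n in c1; rewrite nix mul0r addr0 eqxx mul1r ih //; last first.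
    by move=> p ps; apply: sP; rewrite inE ps orbT.
  rewrite xpair_eqE andbb; case: (i =P y) => [iy|_]; last by rewrite mul1r.
  have : (x, y) \in s by rewrite -has_pred1 has_count c1.
  move/al; rewrite iy /lexle /= ltnn eqxx /= => yx.
  have -> : (x < y)%N = false by rewrite ltnNge yx.
  by rewrite exprD.
subst i j; rewrite !eqxx (negPf xy) !mul0r add0r mul1r stepw0.
have c0 : count_mem (x, y) s = 0%N by move: c1; rewrite eqxx add1n => -[].
have -> : map fst s = map snd s.
  apply/eq_in_map => p ps; case: (sP p); rewrite ?inE ?ps ?orbT // => e.
  by move: c0; rewrite -e => /eqP; rewrite -leqn0 leqNgt -has_count has_pred1 ps.
rewrite eqxx xpair_eqE (negPf xy) /= add0n; case: ltnP => // yx.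
have -> : count_mem (y, y) s = 0%N; last by rewrite expr0.
apply/eqP; rewrite -leqn0 leqNgt -has_count has_pred1; apply/negP => /al.
rewrite /lexle /= ltnn eqxx /= => xy'; case/eqP: xy; apply/val_inj/anti_leq.
by rewrite yx xy'.
Qed.

Lemma stepw1_wordof d : stepw x y c 1 (wordof (addiag (delta_mx x y) d)) =
  if (x < y)%N then 1 else c ^+ d y.
Proof.
rewrite stepw1_sorted ?wordof_sorted ?count_wordof /= //.
- by rewrite addiagE delta_nat eq_sym (negPf xy) eqxx muln1.
- move=> [i j]; rewrite -has_pred1 has_count count_wordof /= addiagE delta_nat.
  case: (i =P j) => [->|_]; [by left|rewrite muln0 addn0].
  by case: (i =P x) => [->|]; case: (j =P y) => [->|] //=; right.
- by rewrite addiagE delta_nat !eqxx (negPf xy) muln0.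
Qed.
End StepValue.
End AlmostDiagonal.

Section AjrValues.
Variables (n r : nat) (w : Qv).
Hypothesis vw : vQ * w = 1.
Implicit Types (A B : 'M[nat]_n).

Lemma mxtotal_addiag_le A (d : 'I_n -> nat) i : (d i <= mxtotal (addiag A d))%N.
Proof.
rewrite /mxtotal (bigD1 i) //= (bigD1 i) //= addiagE eqxx muln1.
by rewrite [(A i i + _)%N]addnC -!addnA leq_addr.
Qed.

Lemma ev_Ajr_out A j B : mxtotal B = r -> (forall d, B <> addiag A d) ->
  ev (Ajr r A j) (wordof B) = 0.
Proof.
move=> Br nB; rewrite /Ajr ev_sum big1 // => d /eqP dr.
rewrite evZ /bracket evZ (ev_xi vw) //.
by case: eqP => [/nB//|_]; rewrite !mulr0.
Qed.

Lemma ev_Ajr A j (d : 'I_n -> nat) : mxtotal (addiag A d) = r ->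
  ev (Ajr r A j) (wordof (addiag A d)) =
  vQ ^ (\sum_i (d i)%:Z * j i) * vQ ^ (- dA (addiag A d)).
Proof.
move=> dr; have dlt i : (d i < r.+1)%N by rewrite ltnS -dr mxtotal_addiag_le.
pose e : {ffun 'I_n -> 'I_r.+1} := [ffun i => Ordinal (dlt i)].
have eE : A + diag_mx (\row_i (e i : nat)) = addiag A d.
  by congr (_ + diag_mx _); apply/rowP => i; rewrite !mxE ffunE.
rewrite /Ajr ev_sum (bigD1 e) /= ?eE ?dr //= [X in _ + X]big1 ?addr0 => [|e' /andP[/eqP e'r ne]].
  rewrite evZ /bracket evZ (ev_xi vw) ?eE // eqxx mulr1.
  by congr (vQ ^ _ * _); apply: eq_bigr => i _; rewrite ffunE.
rewrite evZ /bracket evZ (ev_xi vw) //.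
case: eqP => [E|_]; last by rewrite !mulr0.
case/eqP: ne; apply/ffunP => i; apply/val_inj; rewrite ffunE /=.
have := congr1 (fun M : 'M_n => M i i) E; rewrite -/(addiag A (fun i => e' i)) !addiagE eqxx !muln1.
by move/addnI.
Qed.
End AjrValues.

(** * The image of the integral form *)

Lemma vQ_neq0 : vQ != 0.
Proof. by rewrite /vQ tofrac_eq0 polyX_eq0. Qed.

Lemma vQ_mulV : vQ * vQ^-1 = 1.
Proof. exact: mulfV vQ_neq0. Qed.

Lemma vQ_generic k : vQ ^+ k.+1 - vQ ^- k.+1 != 0.
Proof.
rewrite subr_eq0; apply/eqP => /(congr1 (fun z => z * vQ ^+ k.+1)).
rewrite mulVf ?expf_neq0 ?vQ_neq0 // -exprD /vQ -tofracXn -tofrac1.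
move/eqP; rewrite tofrac_eq => /eqP/(congr1 (fun p : {poly rat} => size p)).
by rewrite size_polyXn size_poly1.
Qed.

Lemma qfactE a : qfact a = qf vQ a.
Proof. by rewrite /qfact /qf big_add1 /= big_mkord. Qed.

Lemma vQV_in : vQ^-1 \in Zv_pred.
Proof. by apply/subring_spanP; apply: subring_gen_base; right. Qed.

Lemma vQ_exp_in (x : int) : vQ ^ x \in Zv_pred.
Proof. by case: x => a; rewrite ?NegzE -?exprnN -?exprVn ?rpredX ?vQ_in ?vQV_in. Qed.

Definition vZexp (x : int) : Zv := MkZv (vQ_exp_in x).

Definition vZV : Zv := MkZv vQV_in.

Lemma vZ_mulV : vZ * vZV = 1.
Proof. by apply/val_inj; rewrite /= vQ_mulV. Qed.

Section QuantumGlRelations.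
Variable m : nat.

Lemma adjc_lohi (h : 'I_m) : adjc (lo h) (hi h).
Proof. by rewrite /adjc /= /bump add1n eqxx. Qed.

Lemma adjc_hilo (h : 'I_m) : adjc (hi h) (lo h).
Proof. by rewrite /adjc /= /bump add1n eqxx orbT. Qed.

Lemma lo_neq_hi (h : 'I_m) : lo h != hi h.
Proof. exact: adjc_neq (adjc_lohi h). Qed.

Lemma UE_UF (h : 'I_m) : UE h * UF h - UF h * UE h =
  (vQ - vQ^-1)^-1 *: (Ktilde h - KtildeV h).
Proof.
have := pres_rel (Urel_EF h h).
rewrite eqxx scale1r presZ !rmorphB !rmorphM /=.
by [].
Qed.

Lemma prod_single (T : pzSemiRingType) n (F : 'I_n -> T) (i : 'I_n) :
  (forall j, j != i -> F j = 1) -> \prod_j F j = F i.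
Proof.
move=> F1; have : forall s : seq 'I_n, uniq s -> \prod_(j <- s) F j = if i \in s then F i else 1.
  elim=> [_|j s ih /= /andP[js us]]; first by rewrite big_nil.
  rewrite big_cons ih // inE; case: (i =P j) => [<-|/eqP ij] /= in js *.
    by rewrite (negPf js) mulr1.
  by rewrite F1 1?eq_sym // mul1r.
by move=> /(_ (index_enum _) (index_enum_uniq _)) ->; rewrite mem_index_enum.
Qed.

Lemma Kmon_single (i : 'I_m.+1) (z : int) :
  Kmon (fun j => if j == i then z else 0) = Kexp i z.
Proof.
rewrite /Kmon (prod_single (i := i)) ?eqxx // => j /negPf ->.
exact: expr0.
Qed.
End QuantumGlRelations.

Section Image.
Variables (m r : nat).
Variable zeta : {lrmorphism Ugl m -> qSchur vQ m.+1 r}.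
Hypothesis zetaE : forall h : 'I_m,
  zeta (UE h) = Ajr r (delta_mx (lo h) (hi h)) (fun _ => 0).
Hypothesis zetaF : forall h : 'I_m,
  zeta (UF h) = Ajr r (delta_mx (hi h) (lo h)) (fun _ => 0).
Hypothesis zetaK : forall j : 'I_m.+1 -> int, zeta (Kmon j) = Ajr r 0 j.

Local Notation S := (qSchur vQ m.+1 r).
Local Notation step := (stepq r vQ_mulV).
Local Notation diag := (@diagq Qv vQ m.+1 r).

Lemma zetaE_step h : zeta (UE h) =
  step (adjc_lohi h) 1 * diag (fun mu => vQ ^ (- (mu (lo h))%:Z)).
Proof.
rewrite zetaE; apply: (qS_ext_wordof vQ_mulV) => B Br.
rewrite ev_mul_diagq ?size_wordof // ev_stepq ?size_wordof //.
have lh := lo_neq_hi h.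
have [[d BE]|no] := EM (exists d, B = addiag (delta_mx (lo h) (hi h)) d); last first.
  rewrite (ev_Ajr_out vQ_mulV) // => [|d Bd]; last by case: no; exists d.
  have [->|nz] := eqVneq (stepw (lo h) (hi h) (stepc vQ vQ^-1 (lo h) (hi h)) 1 (wordof B)) 0.
    by rewrite mul0r.
  by have [d] := stepw1_addiag lh nz; rewrite cntmxK => Bd; case: no; exists d.
rewrite BE in Br *; rewrite (ev_Ajr vQ_mulV) // dA_addiag ?adjc_lohi // stepw1_wordof //.
rewrite cont_addiag (negPf lh) addn0 big1 => [|i _]; last by rewrite mulr0.
by rewrite expr0z /= /bump add1n ltnSn.
Qed.

(** For the matrix with diagonal d, the power -d_hi is the normalisation by d_A, and 2 d_lo cancels
    the value v^(-2 d_lo) of the step. The weight at [lo h] also counts the off-diagonal letter, so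
    d_lo is that weight minus 1. *)
Lemma zetaF_step h : zeta (UF h) =
  step (adjc_hilo h) 1 *
  diag (fun mu => vQ ^ (((mu (lo h))%:Z - 1) * 2 - (mu (hi h))%:Z)).
Proof.
rewrite zetaF; apply: (qS_ext_wordof vQ_mulV) => B Br.
rewrite ev_mul_diagq ?size_wordof // ev_stepq ?size_wordof //.
have lh := lo_neq_hi h; have hl : hi h != lo h by rewrite eq_sym.
have [[d BE]|no] := EM (exists d, B = addiag (delta_mx (hi h) (lo h)) d); last first.
  rewrite (ev_Ajr_out vQ_mulV) // => [|d Bd]; last by case: no; exists d.
  have [->|nz] := eqVneq (stepw (hi h) (lo h) (stepc vQ vQ^-1 (hi h) (lo h)) 1 (wordof B)) 0.
    by rewrite mul0r.
  by have [d] := stepw1_addiag hl nz; rewrite cntmxK => Bd; case: no; exists d.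
rewrite BE in Br *; rewrite (ev_Ajr vQ_mulV) // dA_addiag ?adjc_hilo // stepw1_wordof //.
rewrite !cont_addiag (negPf hl) eqxx addn0 big1 => [|i _]; last by rewrite mulr0.
have -> : (hi h < lo h)%N = false by rewrite /= /bump; lia.
have -> : stepc vQ vQ^-1 (hi h) (lo h) = vQ ^ (-2).
  by rewrite /stepc (_ : (hi h < lo h)%N = false) ?exprVn //= /bump; lia.
rewrite exprnP exprz_exp -!(qexpD vQ_generic); congr (vQ ^ _); lia.
Qed.

Lemma zetaK_diag j : zeta (Kmon j) = diag (fun mu => vQ ^ (\sum_i (mu i)%:Z * j i)).
Proof.
rewrite zetaK; apply: (qS_ext_wordof vQ_mulV) => B Br.
rewrite ev_diagq ?size_wordof //.
have [[d BE]|no] := EM (exists d, B = addiag 0 d); last first.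
  rewrite (ev_Ajr_out vQ_mulV) // => [|d Bd]; last by case: no; exists d.
  case: eqP => [e|_]; last by rewrite mul0r.
  case: no; exists (fun i => B i i); apply/matrixP => i k; rewrite addiagE mxE add0n.
  case: (i =P k) => [->|/eqP ik]; first by rewrite muln1.
  rewrite muln0 -[LHS](count_wordof (i, k)); apply/eqP.
  rewrite -leqn0 leqNgt -has_count has_pred1; apply/negP => ikB.
  by move: e ik => /eq_in_map/(_ _ ikB) /= ->; rewrite eqxx.
rewrite BE in Br *; rewrite (ev_Ajr vQ_mulV) // dA_addiag0 oppr0 expr0z mulr1.
have -> : map fst (wordof (addiag 0 d)) = map snd (wordof (addiag 0 d)).
  apply/eq_in_map => -[i k]; rewrite -has_pred1 has_count count_wordof /= addiagE mxE add0n.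
  by case: (i =P k) => // _; rewrite muln0.
rewrite eqxx mul1r; congr (vQ ^ _); apply: eq_bigr => i _; by rewrite cont_addiag0.
Qed.
End Image.

Section ImageGenerators.
Variables (m r : nat).
Variable zeta : {lrmorphism Ugl m -> qSchur vQ m.+1 r}.
Hypothesis zetaE : forall h : 'I_m,
  zeta (UE h) = Ajr r (delta_mx (lo h) (hi h)) (fun _ => 0).
Hypothesis zetaF : forall h : 'I_m,
  zeta (UF h) = Ajr r (delta_mx (hi h) (lo h)) (fun _ => 0).
Hypothesis zetaK : forall j : 'I_m.+1 -> int, zeta (Kmon j) = Ajr r 0 j.

Local Notation S := (qSchur vQ m.+1 r).
Local Notation step := (stepq r vQ_mulV).
Local Notation diag := (@diagq Qv vQ m.+1 r).
Implicit Types (h : 'I_m) (mu lam : {ffun 'I_m.+1 -> nat}).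

Lemma zeta_divpow x a : zeta (divpow x a) = dpow vQ (zeta x) a.
Proof. by rewrite /divpow /dpow linearZ_LR rmorphXn qfactE. Qed.

Lemma zetaE_divpow h a : zeta (divpow (UE h) a) =
  step (adjc_lohi h) a * diag (fun mu => vQ ^ (- (a%:Z * (mu (lo h))%:Z))).
Proof.
rewrite zeta_divpow /dpow (zetaE_step zetaE).
rewrite (@step_power _ _ _ _ vQ_mulV _ _ _ _ ( fun a mu => vQ ^ (- (a%:Z * (mu (lo h))%:Z)))).
- by rewrite scalerA mulVf ?scale1r // (qf_neq0 vQ_generic).
- by move=> mu; rewrite mul0r oppr0.
move=> b mu _; have -> : stepc vQ vQ^-1 (lo h) (hi h) = vQ ^+ 2.
  by rewrite /stepc (_ : (lo h < hi h)%N) //= /bump add1n.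
rewrite (geom_qn vQ_generic) ffunE eqxx (negPf (lo_neq_hi h)) muln1 muln0 subn0.
rewrite -(qexpD vQ_generic) -mulrA -(qexpD vQ_generic); congr (_ * vQ ^ _); lia.
Qed.

Lemma zetaF_divpow h a : zeta (divpow (UF h) a) =
  step (adjc_hilo h) a * diag (fun mu => vQ ^ (a%:Z *
    (((mu (lo h))%:Z - a%:Z) * 2 - (mu (hi h))%:Z))).
Proof.
rewrite zeta_divpow /dpow (zetaF_step zetaF).
rewrite (@step_power _ _ _ _ vQ_mulV _ _ _ _ ( fun a mu => vQ ^ (a%:Z *
    (((mu (lo h))%:Z - a%:Z) * 2 - (mu (hi h))%:Z)))).
- by rewrite scalerA mulVf ?scale1r // (qf_neq0 vQ_generic).
- by move=> mu; rewrite mul0r.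
move=> b mu bmu; have -> : stepc vQ vQ^-1 (hi h) (lo h) = vQ^-1 ^+ 2.
  by rewrite /stepc (_ : (hi h < lo h)%N = false) //= /bump; lia.
rewrite (geom_qnV vQ_generic) !ffunE !eqxx (eq_sym (hi h)) (eq_sym (lo h)).
rewrite (eq_sym (hi h)) (negPf (lo_neq_hi h)) !muln1 !muln0 subn0 addn0.
rewrite -(qexpD vQ_generic) -mulrA -(qexpD vQ_generic); congr (_ * vQ ^ _).
move: (mu (lo h)) (mu (hi h)) bmu => p q bmu; nia.
Qed.

Lemma zetaUK i : zeta (UK i) = diag (fun mu => vQ ^ (mu i)%:Z).
Proof.
rewrite -[UK i]expr1 -[_ ^+ 1](Kmon_single i 1) (zetaK_diag zetaK).
apply: eq_diagq => mu _; congr (vQ ^ _).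
by rewrite (bigD1 i) //= eqxx mulr1 big1 ?addr0 // => j /negPf ->; rewrite mulr0.
Qed.

Lemma zetaUKinv i : zeta (UKinv i) = diag (fun mu => vQ ^ (- (mu i)%:Z)).
Proof.
rewrite -[UKinv i]expr1 -[_ ^+ 1](Kmon_single i (-1)) (zetaK_diag zetaK).
apply: eq_diagq => mu _; congr (vQ ^ _).
by rewrite (bigD1 i) //= eqxx mulrN1 big1 ?addr0 // => j /negPf ->; rewrite mulr0.
Qed.

Lemma zeta_Ktilde h : zeta (Ktilde h) =
  diag (fun mu => vQ ^ ((mu (lo h))%:Z - (mu (hi h))%:Z)).
Proof.
rewrite /Ktilde rmorphM /= zetaUK zetaUKinv diagqM.
by apply: eq_diagq => mu _; rewrite -(qexpD vQ_generic).
Qed.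

Lemma zeta_KtildeV h : zeta (KtildeV h) =
  diag (fun mu => vQ ^ (- ((mu (lo h))%:Z - (mu (hi h))%:Z))).
Proof.
rewrite /KtildeV rmorphM /= zetaUK zetaUKinv diagqM.
by apply: eq_diagq => mu _; rewrite -(qexpD vQ_generic) opprB.
Qed.

Definition hweight h mu : int := (mu (lo h))%:Z - (mu (hi h))%:Z.

Definition hdiag h (phi : int -> Qv) : S := diag (fun mu => phi (hweight h mu)).

Lemma hdiag_E h phi : hdiag h phi * zeta (UE h) =
  zeta (UE h) * hdiag h (fun k => phi (k + 2)).
Proof.
rewrite (zetaE_step zetaE) mulrA /hdiag diagq_step -!mulrA !diagqM.
apply: stepq_diagq_ext => mu _ mu_hi; rewrite mulrC; congr (_ * phi _).
rewrite /hweight !ffunE !eqxx (eq_sym (hi h)) (negPf (lo_neq_hi h)) !muln1 !muln0.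
by move: (mu (lo h)) (mu (hi h)) mu_hi => p q; lia.
Qed.

Lemma hdiag_F h phi : hdiag h phi * zeta (UF h) =
  zeta (UF h) * hdiag h (fun k => phi (k - 2)).
Proof.
rewrite (zetaF_step zetaF) mulrA /hdiag diagq_step -!mulrA !diagqM.
apply: stepq_diagq_ext => mu _ mu_lo; rewrite mulrC; congr (_ * phi _).
rewrite /hweight !ffunE !eqxx (eq_sym (hi h)) (negPf (lo_neq_hi h)) !muln1 !muln0.
by move: (mu (lo h)) (mu (hi h)) mu_lo => p q; lia.
Qed.

Lemma hdiag_EF h : zeta (UE h) * zeta (UF h) - zeta (UF h) * zeta (UE h) = hdiag h (qn vQ).
Proof.
have := congr1 zeta (UE_UF h).
rewrite rmorphB !rmorphM linearZ_LR rmorphB /= zeta_Ktilde zeta_KtildeV => ->.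
rewrite diagqN diagqD diagqZ; apply: eq_diagq => mu _.
by rewrite mulrC.
Qed.

Definition inZ (x : S) : Prop := exists u : UZsl m, zeta (UZsl_val u) = x.

Lemma inZ_gen x : UZsl_gen x -> inZ (zeta x).
Proof.
move=> gx; have xin : x \in @UZsl_pred m by apply/subring_spanP/subring_gen_base.
by exists (MkUZsl xin).
Qed.

Lemma inZ_D x y : inZ x -> inZ y -> inZ (x + y).
Proof. by move=> [u <-] [t <-]; exists (u + t); rewrite rmorphD. Qed.

Lemma inZ_M x y : inZ x -> inZ y -> inZ (x * y).
Proof. by move=> [u <-] [t <-]; exists (u * t); rewrite rmorphM. Qed.

Lemma inZ_Z c x : c \in Zv_pred -> inZ x -> inZ (c *: x).
Proof. by move=> cZ [u <-]; exists (MkZv cZ *: u); rewrite linearZ_LR. Qed.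

Lemma inZ_1 : inZ 1.
Proof. by exists 1; rewrite rmorph1. Qed.

Lemma inZ_hdiag h (k0 : int) : inZ (hdiag h (fun k => (k == k0)%:R)).
Proof.
have weight_le mu : (\sum_i mu i)%N = r -> (`|hweight h mu| <= r)%N.
  move=> mur; have lo_le : (mu (lo h) <= r)%N by rewrite -mur (bigD1 (lo h)) //= leq_addr.
  have hi_le : (mu (hi h) <= r)%N by rewrite -mur (bigD1 (hi h)) //= leq_addr.
  by rewrite /hweight; lia.
have [k0r|k0r] := leqP `|k0|%N r; last first.
  have -> : hdiag h (fun k => (k == k0)%:R) = 0.
    rewrite -(diagq0 vQ m.+1 r); apply: eq_diagq => mu /weight_le le.
    by case: eqP => // e; move: le; rewrite e leqNgt k0r.
  by rewrite -(scale0r 1); apply: inZ_Z inZ_1; exact: rpred0.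
have dpE a : inZ (dpow vQ (zeta (UE h)) a) by rewrite -zeta_divpow; apply/inZ_gen/UZsl_E.
have dpF a : inZ (dpow vQ (zeta (UF h)) a) by rewrite -zeta_divpow; apply/inZ_gen/UZsl_F.
have KV : inZ (hdiag h (fun k => vQ ^ (- k))).
  by rewrite /hdiag /hweight -zeta_KtildeV; apply/inZ_gen/UZsl_KV.
apply: (@form_point Qv vQ vQ_generic S (hdiag h) r (zeta (UE h)) (zeta (UF h)) _ _ _ _ _
  (hdiag_E h) (hdiag_F h) (hdiag_EF h) Zv_pred inZ) => //.
- by move=> phi psi e; apply: eq_diagq => mu /weight_le /e.
- exact: diagq1.
- by move=> phi psi; rewrite diagqM.
- by move=> phi psi; rewrite diagqD.
- by move=> c phi; rewrite diagqZ.
- exact: vQ_exp_in.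
- exact: inZ_D.
- exact: inZ_M.
- exact: inZ_Z.
- exact: inZ_1.
Qed.

(** Equal differences make mu - lam constant, and equal totals make m + 1 times this constant
    vanish. This is why sl_n can replace gl_n here. *)
Lemma hweight_inj lam mu : (\sum_i lam i)%N = r -> (\sum_i mu i)%N = r ->
  (forall h, hweight h mu = hweight h lam) -> mu = lam.
Proof.
move=> lr mr e.
have step (i : nat) (lti : (i < m.+1)%N) : (mu (Ordinal lti))%:Z - (lam (Ordinal lti))%:Z =
    (mu ord0)%:Z - (lam ord0)%:Z.
  elim: i lti => [|i ih] lti; first by congr ((mu _)%:Z - (lam _)%:Z); apply/val_inj.
  have lti' : (i < m)%N by rewrite -ltnS.
  have := e (Ordinal lti'); rewrite /hweight.
  have -> : lo (Ordinal lti') = Ordinal (ltnW lti) by apply/val_inj.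
  have -> : hi (Ordinal lti') = Ordinal lti by apply/val_inj.
  by have := ih (ltnW lti); lia.
have step' i : (mu i)%:Z - (lam i)%:Z = (mu ord0)%:Z - (lam ord0)%:Z.
  by case: i => i lti; exact: step.
have : \sum_i ((mu i)%:Z - (lam i)%:Z) = 0.
  rewrite sumrB -!(big_morph Posz PoszD (erefl _)) lr mr; exact: subrr.
rewrite (eq_bigr _ (fun i _ => step' i)) sumr_const card_ord => /eqP.
rewrite Num.Theory.mulrn_eq0 /= => /eqP e0; apply/ffunP => i; apply/eqP; rewrite -eqz_nat.
by rewrite -subr_eq0 step' e0.
Qed.

Lemma inZ_point lam : inZ (diag (fun mu => (mu == lam)%:R)).
Proof.
have [lr|lr] := eqVneq (\sum_i lam i)%N r; last first.
  have -> : diag (fun mu => (mu == lam)%:R) = 0.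
    rewrite -(diagq0 vQ m.+1 r); apply: eq_diagq => mu mur.
    by case: eqP => // e; rewrite -e mur eqxx in lr.
  by rewrite -(scale0r 1); apply: inZ_Z inZ_1; exact: rpred0.
have -> : diag (fun mu => (mu == lam)%:R) =
    \prod_h hdiag h (fun k => (k == hweight h lam)%:R).
  transitivity (diag (fun mu => \prod_h (hweight h mu == hweight h lam)%:R)).
    apply: eq_diagq => mu mur; case: eqP => [->|ne].
      by rewrite big1 // => h _; rewrite eqxx.
    apply/esym/eqP; rewrite prodf_seq_eq0; apply: contrapT => /negP/hasPn no.
    case: ne; apply: hweight_inj => // h; apply/eqP; have := no h (mem_index_enum _).
    by case: (hweight h mu == hweight h lam) => /=; rewrite ?eqxx.
  elim: (index_enum _) => [|h l ih].
    by rewrite big_nil -(diagq1 vQ m.+1 r); apply: eq_diagq => mu _; rewrite big_nil.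
  by rewrite big_cons -ih diagqM; apply: eq_diagq => mu _; rewrite big_cons.
by apply: (big_ind inZ); [exact: inZ_1|exact: inZ_M|move=> h _; exact: inZ_hdiag].
Qed.
End ImageGenerators.

Section IntegralImage.
Variables (m r : nat).
Variable zeta : {lrmorphism Ugl m -> qSchur vQ m.+1 r}.
Hypothesis zetaE : forall h : 'I_m,
  zeta (UE h) = Ajr r (delta_mx (lo h) (hi h)) (fun _ => 0).
Hypothesis zetaF : forall h : 'I_m,
  zeta (UF h) = Ajr r (delta_mx (hi h) (lo h)) (fun _ => 0).
Hypothesis zetaK : forall j : 'I_m.+1 -> int, zeta (Kmon j) = Ajr r 0 j.

Local Notation S := (qSchur vQ m.+1 r).
Local Notation step := (stepq r vQ_mulV).
Local Notation diag := (@diagq Qv vQ m.+1 r).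
Local Notation SZ := (qSchur vZ m.+1 r).
Local Notation inZ := (inZ zeta).

Lemma inZ_diag (phi : {ffun 'I_m.+1 -> nat} -> Qv) :
  (forall mu, phi mu \in Zv_pred) -> inZ (diag phi).
Proof.
move=> phiZ; pose c (lam : {ffun 'I_m.+1 -> 'I_r.+1}) : {ffun 'I_m.+1 -> nat} := [ffun i => lam i : nat].
have -> : diag phi = \sum_lam phi (c lam) *: diag (fun mu => (mu == c lam)%:R).
  transitivity (diag (fun mu => \sum_lam phi (c lam) * (mu == c lam)%:R)).
    apply: eq_diagq => mu mur.
    have lt i : (mu i < r.+1)%N by rewrite ltnS -mur (bigD1 i) //= leq_addr.
    pose mu' : {ffun 'I_m.+1 -> 'I_r.+1} := [ffun i => Ordinal (lt i)].
    have cmu : c mu' = mu by apply/ffunP => i; rewrite !ffunE.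
    rewrite (bigD1 mu') //= cmu eqxx mulr1 big1 ?addr0 // => lam ne.
    case: eqP => [e|_]; last by rewrite mulr0.
    case/eqP: ne; apply/ffunP => i; apply/val_inj; rewrite ffunE /=.
    by move/ffunP/(_ i): e; rewrite ffunE.
  elim: (index_enum _) => [|lam l ih].
    by rewrite big_nil -(diagq0 vQ m.+1 r); apply: eq_diagq => mu _; rewrite big_nil.
  by rewrite big_cons -ih diagqZ diagqD; apply: eq_diagq => mu _; rewrite big_cons.
have i0 : inZ 0.
  by rewrite -(scale0r 1); apply: inZ_Z (inZ_1 _); exact: rpred0.
apply: (big_ind inZ) => // [x y|lam _]; first exact: inZ_D.
apply: inZ_Z => //; exact: inZ_point.
Qed.

(** A divided power maps to the step times a diagonal of powers of v; the inverse diagonal lies in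
    the integral image by [inZ_diag] and cancels it. *)
Lemma inZ_step (x y : 'I_m.+1) (xy : adjc x y) a : inZ (step xy a).
Proof.
have vdiag (f : {ffun 'I_m.+1 -> nat} -> int) : inZ (diag (fun mu => vQ ^ f mu)).
  by apply: inZ_diag => mu; exact: vQ_exp_in.
have vK (f : {ffun 'I_m.+1 -> nat} -> int) :
    diag (fun mu => vQ ^ f mu) * diag (fun mu => vQ ^ (- f mu)) = 1.
  rewrite diagqM -(diagq1 vQ m.+1 r); apply: eq_diagq => mu _.
  by rewrite -(qexpD vQ_generic) subrr.
have cancel s f : inZ (s * diag (fun mu => vQ ^ f mu)) -> inZ s.
  by move=> h; rewrite -[s]mulr1 -(vK f) mulrA; apply: inZ_M.
case/orP: (xy) => /eqP e.
- have lt : (x < m)%N by rewrite -ltnS e.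
  have ex : x = lo (Ordinal lt) by apply/val_inj.
  have ey : y = hi (Ordinal lt) by apply/val_inj; rewrite /= /bump add1n.
  move: xy; move: (Ordinal lt) ex ey => h -> -> xy; rewrite (bool_irrelevance xy (adjc_lohi h)).
  apply: (cancel _ (fun mu => - (a%:Z * (mu (lo h))%:Z))).
  by rewrite -(zetaE_divpow zetaE); apply/inZ_gen/UZsl_E.
- have lt : (y < m)%N by rewrite -ltnS e.
  have ey : y = lo (Ordinal lt) by apply/val_inj.
  have ex : x = hi (Ordinal lt) by apply/val_inj; rewrite /= /bump add1n.
  move: xy; move: (Ordinal lt) ex ey => h -> -> xy; rewrite (bool_irrelevance xy (adjc_hilo h)).
  apply: (cancel _ (fun mu => a%:Z * (((mu (lo h))%:Z - a%:Z) * 2 - (mu (hi h))%:Z))).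
  by rewrite -(zetaF_divpow zetaF); apply/inZ_gen/UZsl_F.
Qed.

Lemma qS_incl_step (x y : 'I_m.+1) (xy : adjc x y) a :
  qS_incl (stepq r vZ_mulV xy a) = step xy a.
Proof. exact: (@qS_bc_stepq _ _ Zv_incl vZ vZV m.+1 r vZ_mulV vQ_mulV x y xy a). Qed.

Lemma qS_incl_diag (f : {ffun 'I_m.+1 -> nat} -> int) :
  qS_incl (diagq vZ r (fun mu => vZexp (f mu))) = diag (fun mu => vQ ^ f mu).
Proof. exact: (@qS_bc_diagq _ _ Zv_incl vZ m.+1 r). Qed.

Lemma qS_incl_inj : injective (@qS_incl m.+1 r).
Proof. exact: (@qS_bc_inj _ _ Zv_incl vZ m.+1 r val_inj). Qed.

Lemma inZ_qS_incl (y : SZ) : inZ (qS_incl y).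
Proof.
move: y; apply: (qSchur_generated (vw := vZ_mulV)) => [f g|c f|f g|x y xy a|lam].
- by rewrite /qS_incl qS_bcD; apply: inZ_D.
- by rewrite /qS_incl qS_bcZ; apply: inZ_Z; exact: Zv_valP.
- by rewrite /qS_incl qS_bcM; apply: inZ_M.
- by rewrite qS_incl_step; exact: inZ_step.
- have -> : qS_incl (diagq vZ r (fun mu => (mu == lam)%:R)) = diag (fun mu => (mu == lam)%:R).
    by rewrite /qS_incl qS_bc_diagq; apply: eq_diagq => mu _; rewrite rmorph_nat.
  exact: inZ_point.
Qed.

Lemma zeta_integral (u : UZsl m) : exists y : SZ, zeta (UZsl_val u) = qS_incl y.
Proof.
have /subring_spanP := UZsl_valP u; elim=> [_ [h a|h a|h|h|c]||x y _ [f fE] _ [g gE]|x y _ [f fE] _ [g gE]] {u}.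
- rewrite (zetaE_divpow zetaE) -qS_incl_step -qS_incl_diag.
  by eexists; apply/esym; exact: (@qS_bcM _ _ Zv_incl vZ m.+1 r).
- rewrite (zetaF_divpow zetaF) -qS_incl_step -qS_incl_diag.
  by eexists; apply/esym; exact: (@qS_bcM _ _ Zv_incl vZ m.+1 r).
- by rewrite (zeta_Ktilde zetaK) -qS_incl_diag; eexists.
- by rewrite (zeta_KtildeV zetaK) -qS_incl_diag; eexists.
- by exists (c *: 1); rewrite linearZ_LR rmorph1 /qS_incl qS_bcZ qS_bc1.
- by exists 1; rewrite rmorph1 /qS_incl qS_bc1.
- by exists (f - g); rewrite rmorphB /= fE gE /qS_incl qS_bcB.
- by exists (f * g); rewrite rmorphM /= fE gE /qS_incl qS_bcM.
Qed.
End IntegralImage.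

(** * Base change of the epimorphism *)

Section BaseChangedMap.
Variables (m r : nat) (k : fieldType) (phi : {rmorphism Zv -> k}).
Variable f : {lrmorphism UZsl m -> qSchur vZ m.+1 r}.
Local Notation Sk := (qSchur (phi vZ) m.+1 r).

Definition bc_lift_tens (u : UZsl m) (c : restr phi) : Sk := (c : k) *: qS_bc phi (f u).

Lemma bc_lift_balanced : balanced bc_lift_tens.
Proof.
rewrite /bc_lift_tens; split=> [u u' c|u c c'|a u c].
- by rewrite rmorphD qS_bcD scalerDr.
- by rewrite scalerDl.
- by rewrite linearZ_LR qS_bcZ scalerA restr_scaleE mulrC.
Qed.

Definition bc_lift (x : Uk_sl m phi) : Sk := tlift bc_lift_tens x.

Lemma bc_lift_bct u c : bc_lift (bct phi u c) = c *: qS_bc phi (f u).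
Proof. exact: tlift_tens bc_lift_balanced u c. Qed.

Lemma bc_lift0 : bc_lift 0 = 0.
Proof. exact: tlift0 bc_lift_balanced. Qed.

Lemma bc_liftD x y : bc_lift (x + y) = bc_lift x + bc_lift y.
Proof. exact: tliftD bc_lift_balanced x y. Qed.

Lemma Uk_ind (P : Uk_sl m phi -> Prop) :
  P 0 -> (forall u c x, P x -> P (bct phi u c + x)) -> forall x, P x.
Proof. exact: (@tens_ind Zv (UZsl m) (restr phi) P). Qed.

Lemma Uk_bctZ c u d : c *: (bct phi u d : Uk_sl m phi) = bct phi u (c * d).
Proof. exact: bctZ. Qed.

Lemma Uk_bctM u c t d :
  (bct phi u c : Uk_sl m phi) * bct phi t d = bct phi (u * t) (c * d).
Proof. exact: bctM. Qed.

Lemma bc_liftZ c x : bc_lift (c *: x) = c *: bc_lift x.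
Proof.
elim/Uk_ind: x => [|u d x ih]; first by rewrite scaler0 bc_lift0 scaler0.
rewrite scalerDr [LHS]bc_liftD ih bc_liftD scalerDr; congr (_ + _).
apply: (etrans (congr1 bc_lift (Uk_bctZ c u d))); apply: (etrans (bc_lift_bct u (c * d))).
apply: (etrans (esym (scalerA c d (qS_bc phi (f u))))).
exact: (congr1 (fun z : Sk => c *: z) (esym (bc_lift_bct u d))).
Qed.

Lemma bc_lift_linear : linear bc_lift.
Proof. by move=> c x y; rewrite bc_liftD bc_liftZ. Qed.

Lemma bc_lift_monoid_morphism : monoid_morphism bc_lift.
Proof.
split=> [|x y]; first by rewrite bc_lift_bct rmorph1 qS_bc1 scale1r.
elim/Uk_ind: x => [|u c x ih]; first by rewrite mul0r bc_lift0 mul0r.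
rewrite mulrDl [LHS]bc_liftD ih bc_liftD mulrDl; congr (_ + _) => {x ih}.
elim/Uk_ind: y => [|t d y ih]; first by rewrite mulr0 bc_lift0 mulr0.
rewrite mulrDr [LHS]bc_liftD ih bc_liftD mulrDr; congr (_ + _).
apply: (etrans (congr1 bc_lift (Uk_bctM u c t d))); apply: (etrans (bc_lift_bct (u * t) (c * d))).
apply: (etrans _ (esym (congr2 (fun a b : Sk => a * b) (bc_lift_bct u c) (bc_lift_bct t d)))).
by rewrite rmorphM qS_bcM -scalerAl -scalerAr -scalerA.
Qed.

HB.instance Definition _ := GRing.isLinear.Build k (Uk_sl m phi) Sk *:%R bc_lift bc_lift_linear.
HB.instance Definition _ := GRing.isMonoidMorphism.Build (Uk_sl m phi) Sk bc_lift bc_lift_monoid_morphism.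
End BaseChangedMap.

(* n = m.+1, so that n ranges over the integers n >= 1. *)
Theorem theorem9p3 (m r : nat)
    (zeta : {lrmorphism Ugl m -> qSchur vQ m.+1 r})
    (zetaE : forall h : 'I_m,
       zeta (UE h) = Ajr r (delta_mx (lo h) (hi h)) (fun _ => 0))
    (zetaF : forall h : 'I_m,
       zeta (UF h) = Ajr r (delta_mx (hi h) (lo h)) (fun _ => 0))
    (zetaK : forall j : 'I_m.+1 -> int, zeta (Kmon j) = Ajr r 0 j) :
  (forall x : qSchur vQ m.+1 r,
     (exists u : UZsl m, zeta (UZsl_val u) = x) <->
     (exists y : qSchur vZ m.+1 r, qS_incl y = x)) /\
  (forall (k : fieldType) (phi : {rmorphism Zv -> k}),
     exists zeta_k : {lrmorphism Uk_sl m phi -> qSchur (phi vZ) m.+1 r},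
       (forall (u : UZsl m) (y : qSchur vZ m.+1 r) (c : k),
          zeta (UZsl_val u) = qS_incl y ->
          zeta_k (bct phi u c) = c *: qS_bc phi y) /\
       (forall z : qSchur (phi vZ) m.+1 r, exists x : Uk_sl m phi, zeta_k x = z)).
Proof.
split=> [x|k phi].
  split=> [[u <-]|[y <-]]; last exact: inZ_qS_incl zetaE zetaF zetaK y.
  by have [y ->] := zeta_integral zetaE zetaF zetaK u; exists y.
(* Injectivity of [qS_incl] determines Y and transfers linearity and multiplicativity from
   [zeta]. *)
have /choice[Y YE] := zeta_integral zetaE zetaF zetaK.
have Ylin : linear Y.
  move=> c u t; apply: qS_incl_inj; rewrite -YE.
  have -> : UZsl_val (c *: u + t) = Zv_val c *: UZsl_val u + UZsl_val t by [].
  by rewrite linearP /= !YE /qS_incl qS_bcD qS_bcZ.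
have Ymul : monoid_morphism Y.
  split=> [|u t]; apply: qS_incl_inj; rewrite -YE.
    have -> : UZsl_val (1 : UZsl m) = 1 by [].
    by rewrite rmorph1 /qS_incl qS_bc1.
  have -> : UZsl_val (u * t) = UZsl_val u * UZsl_val t by [].
  by rewrite rmorphM /= !YE /qS_incl qS_bcM.
pose f : {lrmorphism UZsl m -> qSchur vZ m.+1 r} := HB.pack Y
  (GRing.isLinear.Build Zv (UZsl m) (qSchur vZ m.+1 r) *:%R Y Ylin)
  (GRing.isMonoidMorphism.Build (UZsl m) (qSchur vZ m.+1 r) Y Ymul).
exists (@bc_lift m r k phi f); split=> [u y c uy|z].
  rewrite /= bc_lift_bct; congr (_ *: qS_bc phi _).
  by apply: qS_incl_inj; rewrite -uy YE.
have phi_vw : phi vZ * phi vZV = 1 by rewrite -rmorphM vZ_mulV rmorph1.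
have bcG (y : qSchur vZ m.+1 r) : exists x : Uk_sl m phi, bc_lift f x = qS_bc phi y.
  have [u uy] := inZ_qS_incl zetaE zetaF zetaK y.
  exists (bct phi u 1); rewrite bc_lift_bct scale1r; congr (qS_bc phi _).
  by apply: qS_incl_inj; rewrite -uy YE.
(* Generation over k is applied to the image of [bc_lift f]: it contains the generators because
   these are base changes of the generators over Z[v, v^-1]. *)
move: z; apply: (qSchur_generated (vw := phi_vw)).
- by move=> _ _ [x <-] [x' <-]; exists (x + x'); rewrite rmorphD.
- by move=> c _ [x <-]; exists (c *: x); rewrite linearZ_LR.
- by move=> _ _ [x <-] [x' <-]; exists (x * x'); rewrite rmorphM.
- by move=> x y xy a; rewrite -(qS_bc_stepq r vZ_mulV phi_vw xy a); exact: bcG.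
- move=> lam; have := bcG (diagq vZ r (fun mu => (mu == lam)%:R)).
  rewrite qS_bc_diagq (_ : (fun mu => phi _) = (fun mu => (mu == lam)%:R)) //.
  by apply/funext => mu; rewrite rmorph_nat.
Qed.
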